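(* Let $n\ge1$, let $\mathbb{R}^n_+=\{(x_1,\dots,x_n)\in\mathbb{R}^n : x_n>0\}$, let $t$ be a real constant, and equip $\mathbb{R}^n_+$ with the metric $$\widetilde g=\frac{dx_1^2+dx_2^2+\cdots+dx_n^2}{x_n^t}.$$ Let $\Omega$ be a bounded connected domain in $(\mathbb{R}^n_+,\widetilde g)$. Let $0<\lambda_1<\lambda_2\le\lambda_3\le\cdots$ be the eigenvalues of the Dirichlet problem $\widetilde\Delta u=-\lambda u$ in $\Omega$, $u|_{\partial\Omega}=0$, and let $u_1,u_2,\dots$ be corresponding orthonormal eigenfunctions. Then for every integer $k\ge1$, $$\sum_{i=1}^{k}(\lambda_{k+1}-\lambda_i)^2\left(n\int_\Omega x_n^t u_i^2\right)\le\sum_{i=1}^{k}(\lambda_{k+1}-\lambda_i)\left(4\lambda_i\int_\Omega x_n^t u_i^2+\left(\left(-\frac{n^2}{4}+n+1\right)t^2-nt\right)\int_\Omega x_n^{2t-2}u_i^2\right).$$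
   Context: $\widetilde\Delta$ is the Laplacian (Laplace--Beltrami operator, the divergence of the gradient) of $\widetilde g$. Bounded domain means an open set with compact closure in the manifold $\mathbb{R}^n_+$. Eigenvalues are repeated according to multiplicity. The Dirichlet condition is understood in the usual sense ($u\in H^1_0(\Omega)$). The eigenfunctions $u_i$ are real-valued with $\widetilde\Delta u_i=-\lambda_iu_i$ in $\Omega$, $u_i|_{\partial\Omega}=0$ and $\int_\Omega u_iu_j=\delta_{ij}$. All integrals are with respect to the Riemannian volume measure of $\widetilde g$. *)

(* Defs.v *)
From HB Require Import structures.
From mathcomp Require Import all_boot all_order all_algebra.
From mathcomp Require Import all_classical all_reals all_analysis.

Set Implicit Arguments.
Unset Strict Implicit.
Unset Printing Implicit Defensive.

Import Order.TTheory GRing.Theory Num.Theory.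
Import numFieldNormedType.Exports.

Local Open Scope classical_set_scope.
Local Open Scope ring_scope.

(* 'rV[R]_n carries the sigma-algebra generated by the coordinates, which is
   its Borel sigma-algebra. *)
Section measurable_rV.
Context (R : realType) (n : nat).

Let coors : 'I_n -> 'rV[R]_n -> R := fun i x => x 0 i.

Let rV_set0 : g_sigma_preimage coors set0.
Proof. exact: sigma_algebra0. Qed.

Let rV_setC A : g_sigma_preimage coors A -> g_sigma_preimage coors (~` A).
Proof. exact: sigma_algebraC. Qed.

Let rV_bigcup (F : (set 'rV[R]_n)^nat) :
  (forall i, g_sigma_preimage coors (F i)) ->
  g_sigma_preimage coors (\bigcup_i (F i)).
Proof. exact: sigma_algebra_bigcup. Qed.

HB.instance Definition _ := @isMeasurable.Build
  (measure_tuple_display default_measure_display)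
  'rV[R]_n (g_sigma_preimage coors) rV_set0 rV_setC rV_bigcup.

Lemma measurable_coor (i : 'I_n) :
  measurable_fun [set: 'rV[R]_n] (fun x : 'rV[R]_n => x 0 i).
Proof.
move=> _ Y mY; rewrite setTI; apply: sub_sigma_algebra => /=.
rewrite -bigcup_seq/=; exists i => /=; first by rewrite mem_index_enum.
by exists Y => //; rewrite setTI.
Qed.

Lemma measurable_fun_rVP d (T : measurableType d) (f : T -> 'rV[R]_n) :
  (forall i, measurable_fun [set: T] (fun x => f x 0 i)) ->
  measurable_fun [set: T] f.
Proof.
move=> mf; apply: (@measurability _ _ _ _ _ _
  (\big[setU/set0]_(i < n) preimage_set_system setT (coors i) measurable)) => //.
move=> _ [A /= + <-]; rewrite -bigcup_seq/= => -[i _ [B mB <-]].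
have := mf i measurableT B mB.
by rewrite !setTI.
Qed.

End measurable_rV.

Section lebesgue_rV.
Context (R : realType).

Definition rV_cons n (p : measurableTypeR R * 'rV[R]_n) : 'rV[R]_n.+1 :=
  row_mx (p.1 : R)%:M p.2.

(* n-dimensional Lebesgue measure, as an iterated product measure. *)
Fixpoint lebesgue_rV (n : nat) : set 'rV[R]_n -> \bar R :=
  match n with
  | 0 => \d_(0 : 'rV[R]_0)
  | m.+1 => pushforward (@lebesgue_measure R \x @lebesgue_rV m)%E (@rV_cons m)
  end.

Let measurable_rV_cons n : measurable_fun setT (@rV_cons n).
Proof.
apply: measurable_fun_rVP => i.
have [j ->|j ->] := split_ordP (i : 'I_(1 + n)).
- rewrite (_ : (fun _ => _) = fst); first exact: measurable_fst.
  apply/funext => x; rewrite /rV_cons.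
  by rewrite (@row_mxEl _ 1 1 n) !ord1 mxE eqxx mulr1n.
- rewrite (_ : (fun _ => _) = (fun x : 'rV[R]_n => x 0 j) \o snd).
    exact: measurableT_comp (measurable_coor _) measurable_snd.
  by apply/funext => x; rewrite /rV_cons (@row_mxEr _ 1 1 n).
Qed.

Let rV_uncons n (x : 'rV[R]_n.+1) : measurableTypeR R * 'rV[R]_n :=
  (x 0 0, rsubmx (x : 'rV[R]_(1 + n))).

Let rV_consK n : cancel (@rV_cons n) (@rV_uncons n).
Proof.
move=> [x y]; rewrite /rV_uncons /rV_cons row_mxKr; congr pair => /=.
rewrite (_ : 0 = lshift n (0 : 'I_1)) ?(@row_mxEl _ 1 1 n); last exact/val_inj.
by rewrite mxE eqxx mulr1n.
Qed.

Let measurable_rV_uncons n : measurable_fun setT (@rV_uncons n).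
Proof.
apply: measurable_fun_pair; first exact: measurable_coor.
apply: measurable_fun_rVP => i.
rewrite (_ : (fun _ => _) = fun x : 'rV[R]_n.+1 => x 0 (rshift 1 i)).
  exact: measurable_coor.
by apply/funext => x; rewrite mxE.
Qed.

Let lebesgue_rV_measure n :
  exists m : {sigma_finite_measure set 'rV[R]_n -> \bar R}, @lebesgue_rV n = m.
Proof.
elim: n => [|n [m mE]].
  by exists (\d_(0 : 'rV[R]_0)).
pose p : {measure set (measurableTypeR R * 'rV[R]_n)%type -> \bar R} :=
  (@lebesgue_measure R \x m)%E.
have sp : sigma_finite setT p.
  have /sigma_finiteP[F [FT ndF Foo]] := sigma_finiteT (@lebesgue_measure R).
  have /sigma_finiteP[G [GT ndG Goo]] := sigma_finiteT m.
  exists (fun k => F k `*` G k).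
    rewrite -setXTT FT GT predeqE => -[x y]; split.
      move=> [/= [i _ Fix] [j _ Gjy]]; exists (maxn i j) => //; split.
      - by move: x Fix; exact/subsetPset/ndF/leq_maxl.
      - by move: y Gjy; exact/subsetPset/ndG/leq_maxr.
    by move=> [k _ []/= ? ?]; split; exists k.
  move=> k; have [? ?] := Foo k; have [? ?] := Goo k.
  split; first exact: measurableX.
  by rewrite /p/= product_measure1E// lte_mul_pinfty// ge0_fin_numE.
pose mu : {measure set 'rV[R]_n.+1 -> \bar R} :=
  measure_function.measure_function_pushforward__canonical__measure_function_Measure
    p (@measurable_rV_cons n).
have smu : sigma_finite setT mu.
  have [F FT Foo] := sp.
  exists (fun k => @rV_uncons n @^-1` F k).
    by rewrite -preimage_bigcup -FT preimage_setT.
  move=> k; have [mF Fk] := Foo k; split.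
    by rewrite -[X in measurable X]setTI; exact: measurable_rV_uncons.
  rewrite /mu/= /pushforward -comp_preimage (_ : _ \o _ = id)//.
  by apply/funext => x; exact: rV_consK.
pose b := Measure_isSigmaFinite.Build _ _ _ mu smu.
exists (HB.pack_for (SigmaFiniteMeasure.type 'rV[R]_n.+1 R) (Measure.sort mu) b).
by rewrite /= mE.
Qed.

Context (n : nat).
Notation leb := (@lebesgue_rV n).

Let leb0 : leb set0 = 0%E.
Proof. by have [m ->] := lebesgue_rV_measure n; exact: measure0. Qed.

Let leb_ge0 A : (0 <= leb A)%E.
Proof. by have [m ->] := lebesgue_rV_measure n; exact: measure_ge0. Qed.

Let leb_sigma_additive : semi_sigma_additive leb.
Proof.
by have [m ->] := lebesgue_rV_measure n; exact: measure_semi_sigma_additive.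
Qed.

HB.instance Definition _ :=
  isMeasure.Build _ _ _ leb leb0 leb_ge0 leb_sigma_additive.

Let leb_sigma_finite : sigma_finite setT leb.
Proof. by have [m ->] := lebesgue_rV_measure n; exact: sigma_finiteT. Qed.

HB.instance Definition _ :=
  Measure_isSigmaFinite.Build _ _ _ leb leb_sigma_finite.

End lebesgue_rV.

Section smooth.
Context (R : realType) (n : nat).
Implicit Types (f : 'rV[R]_n -> R) (X : 'rV[R]_n -> 'rV[R]_n).

Definition partial (i : 'I_n) f (x : 'rV[R]_n) : R := 'D_(delta_mx 0 i) f x.

Fixpoint Ck (k : nat) f : Prop :=
  match k with
  | 0 => continuous f
  | j.+1 => (forall x, differentiable f x) /\ forall i, Ck j (partial i f)
  end.

Definition smooth f : Prop := forall k, Ck k f.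

(* C_c^oo(Omega), each function being extended by 0 outside Omega *)
Definition test_function (Omega : set 'rV[R]_n) f : Prop :=
  smooth f /\
  exists K, [/\ compact K, K `<=` Omega & forall x, ~ K x -> f x = 0].

Definition test_field (Omega : set 'rV[R]_n) X : Prop :=
  forall i, test_function Omega (fun x => X x 0 i).

End smooth.

(* Riemannian geometry in one global chart: g x is the matrix (g_ij) of the
   metric at x, and a vector field is given by its components X^i. *)
Section riemannian.
Context (R : realType) (n : nat) (g : 'rV[R]_n -> 'M[R]_n).
Implicit Types (Omega : set 'rV[R]_n) (f u : 'rV[R]_n -> R)
  (X G : 'rV[R]_n -> 'rV[R]_n) (x : 'rV[R]_n) (lam : R).

Definition inner x (v w : 'rV[R]_n) : R := (v *m g x *m w^T) 0 0.

Definition vol_density x : R := Num.sqrt (\det (g x)).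

Definition grad f x : 'rV[R]_n := (\row_i partial i f x) *m invmx (g x).

Definition divergence X x : R :=
  (vol_density x)^-1 *
  \sum_i partial i (fun y => vol_density y * X y 0 i) x.

Definition laplacian f x : R := divergence (grad f) x.

(* Integrals over Omega for the Riemannian volume; the first one is
   extended-real valued and meant for nonnegative integrands. *)
Definition evol_integral Omega f : \bar R :=
  (\int[@lebesgue_rV R n]_(x in Omega) (f x * vol_density x)%:E)%E.

Definition vol_integral Omega f : R :=
  \int[@lebesgue_rV R n]_(x in Omega) (f x * vol_density x).

Definition L2 Omega u : Prop :=
  measurable_fun Omega u /\
  (evol_integral Omega (fun x => u x ^+ 2)%R < +oo)%E.

Definition L2_field Omega G : Prop :=
  (forall i, measurable_fun Omega (fun x => G x 0 i)) /\
  (evol_integral Omega (fun x => inner x (G x) (G x))%R < +oo)%E.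

Definition weak_grad Omega u G : Prop :=
  forall X, test_field Omega X ->
    vol_integral Omega (fun x => u x * divergence X x) =
    - vol_integral Omega (fun x => inner x (G x) (X x)).

(* u belongs to H^1(Omega) and its weak gradient is G *)
Definition sobolev_H1 Omega u G : Prop :=
  [/\ L2 Omega u, L2_field Omega G & weak_grad Omega u G].

(* H^1_0(Omega), the closure of C_c^oo(Omega) in H^1(Omega) *)
Definition sobolev_H10 Omega u : Prop :=
  exists2 G, sobolev_H1 Omega u G &
  exists phi : nat -> 'rV[R]_n -> R,
    (forall m, test_function Omega (phi m)) /\
    (evol_integral Omega (fun x => (phi m x - u x) ^+ 2)%R +
     evol_integral Omega (fun x =>
       inner x (grad (phi m) x - G x) (grad (phi m) x - G x))%R)%E
      @[m --> \oo] --> 0%E.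

(* Solutions u in H^1_0(Omega) of laplacian u = - lam u in Omega, the equation
   being understood in the sense of distributions. Functions are not identified
   almost everywhere, and u = 0 is allowed. *)
Definition dirichlet_solution Omega lam u : Prop :=
  sobolev_H10 Omega u /\
  forall phi, test_function Omega phi ->
    vol_integral Omega (fun x => u x * laplacian phi x) =
    - lam * vol_integral Omega (fun x => u x * phi x).

(* The space of solutions for lam, modulo almost everywhere equality, has
   dimension d; in particular lam is an eigenvalue iff d > 0. *)
Definition dirichlet_multiplicity Omega lam (d : nat) : Prop :=
  exists w : 'I_d -> 'rV[R]_n -> R,
  [/\ forall j, dirichlet_solution Omega lam (w j),
      forall c : 'I_d -> R,
        (\forall x \ae @lebesgue_rV R n,
           Omega x -> \sum_j c j * w j x = 0) ->
        forall j, c j = 0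
    & forall v, dirichlet_solution Omega lam v ->
        exists c : 'I_d -> R,
        \forall x \ae @lebesgue_rV R n,
          Omega x -> v x = \sum_j c j * w j x].

(* lam_ enumerates, in nondecreasing order, all Dirichlet eigenvalues of Omega,
   each one as many times as its multiplicity; indices start at 0, so that lam_ i
   is the (i+1)-st eigenvalue. *)
Definition dirichlet_spectrum Omega (lam_ : nat -> R) : Prop :=
  {homo lam_ : i j / (i <= j)%N >-> i <= j} /\
  forall mu, exists2 N : nat, (forall i, lam_ i = mu -> (i < N)%N) &
    dirichlet_multiplicity Omega mu #|[pred i : 'I_N | lam_ i == mu]|.

End riemannian.

Section half_space.
Context (R : realType) (m : nat).

(* the coordinate x_n of R^n, n = m.+1 *)
Definition xlast (x : 'rV[R]_m.+1) : R := x 0 ord_max.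

Definition half_space : set 'rV[R]_m.+1 := [set x | 0 < xlast x].

Definition half_metric (t : R) (x : 'rV[R]_m.+1) : 'M[R]_m.+1 :=
  ((xlast x `^ t)^-1)%:M.

(* The closure of Omega in the manifold, i.e., in the subspace half_space, has
   to be compact. *)
Definition bounded_domain (Omega : set 'rV[R]_m.+1) : Prop :=
  [/\ open Omega, Omega `<=` half_space
    & compact (closure Omega `&` half_space)].

End half_space.

(* Main.v *)
From HB Require Import structures.
Require Import Defs.
From mathcomp Require Import all_boot all_order all_algebra.
From mathcomp Require Import all_classical all_reals all_analysis.
From mathcomp Require Import measurable_realfun ring lra.
Import Order.TTheory GRing.Theory Num.Theory.
Import numFieldNormedType.Exports.
Local Open Scope classical_set_scope.
Local Open Scope ring_scope.

(** The proof is Yang's: the products x_p u_i of the coordinates with the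
  eigenfunctions are used as trial functions for the eigenvalue of index k.

  Since laplacian (x_p u_i) = - lam_i x_p u_i + y with
  y = 2 <grad x_p, grad u_i> + u_i (laplacian x_p), the component of x_p u_i
  orthogonal to the first k eigenfunctions has its Rayleigh quotient controlled by y.
  The variational principle for lam_k and the Cauchy-Schwarz inequality give, after a
  cancellation by antisymmetry (psd_Yang), for each p,

    sum_i (lam_k - lam_i)^2 int |grad x_p|^2 u_i^2 <= sum_i (lam_k - lam_i) int y^2.

  Here |grad x_p|^2 = x_n^t, and laplacian x_p vanishes for p < n and is a multiple of
  x_n^(t - 1) for p = n. Summing over p, the term int x_n^(2t) |D u_i|^2 is evaluated by
  testing the equation with x_n^t u_i, and the cross term u_i (partial_n u_i) by an
  integration by parts (sum_yang_p); this produces the constants of the statement.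

  The variational principle (rayleigh_bound) is derived from the enumeration of the
  spectrum by multiplicity: if some function orthogonal to the first k eigenfunctions had
  a Rayleigh quotient below lam_k, the direct method (rayleigh_minimizer) would produce
  an eigenfunction for an eigenvalue mu < lam_k orthogonal to the eigenfunctions already
  listed for mu, exceeding the multiplicity of mu. The direct method rests on
  completeness of L2 (l2_complete) and on Rellich's compactness theorem (H10_compact).
  For the latter, the domain, bounded in the Euclidean sense, is cut into small cubes,
  on each of which the L2 norm of a test function is bounded by its
  integral and its gradient (poincare_cubes). This Poincare inequality and the
  integration by parts formula rely on translation invariance of Lebesgue measure and
  on difference quotients.

  All weights are powers of x_n. They are bounded, with bounded inverses, on a domain
  whose closure in the half-space is compact, so the Riemannian Sobolev space H^1_0 is
  the Euclidean one (h1, H10), and only the forms bvol and evol on it depend on t. *)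

Set Implicit Arguments.
Unset Strict Implicit.
Unset Printing Implicit Defensive.

(** * Semi-inner products and the abstract Yang inequality *)

(** The L2 products and Dirichlet energies of this development live on spaces of
  functions that are not identified when they agree almost everywhere: definiteness
  is not available. *)
Record psd_form (R : realType) (V : lmodType R) (b : V -> V -> R) : Prop := PsdForm {
  psdC : forall u v, b u v = b v u;
  psd_linearl : forall a u v w, b (a *: u + v) w = a * b u w + b v w;
  psd_ge0 : forall u, 0 <= b u u }.

Section psd_form_theory.
Context (R : realType) (V : lmodType R) (b : V -> V -> R) (pb : psd_form b).
Implicit Types (u v w : V).

Lemma psdDl u v w : b (u + v) w = b u w + b v w.
Proof. by rewrite -{1}[u]scale1r psd_linearl// mul1r. Qed.

Lemma psd0l w : b 0 w = 0.
Proof. by have := psdDl 0 0 w; rewrite addr0; lra. Qed.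

Lemma psdZl a u w : b (a *: u) w = a * b u w.
Proof. by rewrite -[a *: u]addr0 psd_linearl// psd0l addr0. Qed.

Lemma psdNl u w : b (- u) w = - b u w.
Proof. by rewrite -scaleN1r psdZl mulN1r. Qed.

Lemma psdBl u v w : b (u - v) w = b u w - b v w.
Proof. by rewrite psdDl psdNl. Qed.

Lemma psdDr u v w : b w (u + v) = b w u + b w v.
Proof. by rewrite !(psdC pb w) psdDl. Qed.

Lemma psdZr a u w : b w (a *: u) = a * b w u.
Proof. by rewrite !(psdC pb w) psdZl. Qed.

Lemma psdNr u w : b w (- u) = - b w u.
Proof. by rewrite !(psdC pb w) psdNl. Qed.

Lemma psdBr u v w : b w (u - v) = b w u - b w v.
Proof. by rewrite psdDr psdNr. Qed.

Lemma psd_suml I (r : seq I) (F : I -> V) w :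
  b (\sum_(i <- r) F i) w = \sum_(i <- r) b (F i) w.
Proof.
elim: r => [|i r ih]; first by rewrite !big_nil psd0l.
by rewrite !big_cons psdDl ih.
Qed.

Lemma psd_sumr I (r : seq I) (F : I -> V) w :
  b w (\sum_(i <- r) F i) = \sum_(i <- r) b w (F i).
Proof.
by rewrite psdC// psd_suml; apply: eq_bigr => i _; rewrite psdC.
Qed.

Definition psdE := (psdDl, psdNl, psdZl, psdDr, psdNr, psdZr).

Lemma psd_CauchySchwarz u v : b u v ^+ 2 <= b u u * b v v.
Proof.
have H s : 0 <= b u u + s * (2 * b u v) + s ^+ 2 * b v v.
  have := psd_ge0 pb (u + s *: v); rewrite !psdE (psdC pb v u).
  by move=> h; apply: (le_trans h); rewrite le_eqVlt; apply/orP; left; apply/eqP; ring.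
have [v0|v0] := eqVneq (b v v) 0.
  have [->|uv0] := eqVneq (b u v) 0; first by rewrite expr0n /= v0 mulr0.
  have := H (- (b u u + 1) / (2 * b u v)); rewrite v0 mulr0 addr0.
  rewrite mulfVK ?mulf_neq0//; by lra.
have vp : 0 < b v v by rewrite lt_def v0 psd_ge0.
have := H (- b u v / b v v) => h.
rewrite -subr_ge0.
have -> : b u u * b v v - b u v ^+ 2 =
  b v v * (b u u + (- b u v / b v v) * (2 * b u v) + (- b u v / b v v) ^+ 2 * b v v).
  by field.
by rewrite mulr_ge0// ltW.
Qed.

Lemma psd_normD_le u v : b (u + v) (u + v) <= 2 * b u u + 2 * b v v.
Proof.
have := psd_ge0 pb (u - v); rewrite !psdE (psdC pb v u); lra.
Qed.

Section projection.
Context (k : nat) (u : 'I_k -> V)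
  (u_orthonormal : forall i j, b (u i) (u j) = (i == j)%:R).

Definition coproj v := v - \sum_j b v (u j) *: u j.

Lemma coproj_orth v j : b (coproj v) (u j) = 0.
Proof.
rewrite /coproj psdBl psd_suml (bigD1 j)//= psdZl u_orthonormal eqxx mulr1.
rewrite big1 ?addr0 ?subrr// => i ij.
by rewrite psdZl u_orthonormal (negbTE ij) mulr0.
Qed.

Lemma coprojE v w : (forall j, b v (u j) = 0) -> b v (coproj w) = b v w.
Proof.
move=> vu; rewrite /coproj psdBr psd_sumr big1 ?subr0// => i _.
by rewrite psdZr vu mulr0.
Qed.

Lemma coproj_norm v : b (coproj v) (coproj v) = b v v - \sum_j b v (u j) ^+ 2.
Proof.
rewrite coprojE; last exact: coproj_orth.
rewrite /coproj psdBl psd_suml; congr (_ - _); apply: eq_bigr => j _.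
by rewrite psdZl (psdC pb (u j)) expr2.
Qed.

(** Yang's argument for one family of trial vectors g i, with residues p i. Put
  A i j = b (g i) (u j) ^+ 2. Expanding - b (p i) (coproj (g i)) leaves, besides
  - b (g i) (p i), the sum over j of (lam i - lam j) * A i j. In the Cauchy-Schwarz
  inequality with coproj (p i), the norm of coproj (p i) loses the sum of
  (lam i - lam j) ^+ 2 * A i j. Weighted and summed over i, both sums combine into
  (L - lam i) * (L - lam j) * (lam i - lam j) * A i j, antisymmetric in i and j. *)
Lemma psd_Yang (lam : 'I_k -> R) (L : R) (g p : 'I_k -> V) :
  (forall i, lam i <= L) ->
  (forall i j, b (g i) (u j) = b (g j) (u i)) ->
  (forall i j, b (p i) (u j) = (lam i - lam j) * b (g i) (u j)) ->
  (forall i, (L - lam i) * b (coproj (g i)) (coproj (g i)) <=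
             - b (p i) (coproj (g i))) ->
  \sum_i (L - lam i) ^+ 2 * (- b (g i) (p i)) <=
  \sum_i (L - lam i) * b (p i) (p i).
Proof.
move=> lamL gC pu trial.
pose A i j := b (g i) (u j) ^+ 2.
pose w i := - b (p i) (coproj (g i)).
have wE i : w i = - b (g i) (p i) + \sum_j (lam i - lam j) * A i j.
  rewrite /w /coproj psdBr psd_sumr opprB addrC (psdC pb (g i)); congr (_ + _).
  by apply: eq_bigr => j _; rewrite psdZr pu /A; ring.
have main i : (L - lam i) ^+ 2 * w i <=
    (L - lam i) * (b (p i) (p i) - \sum_j ((lam i - lam j) * b (g i) (u j)) ^+ 2).
  have dl : 0 <= L - lam i by rewrite subr_ge0.
  have cs := psd_CauchySchwarz (coproj (g i)) (coproj (p i)).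
  rewrite coprojE in cs; last exact: coproj_orth.
  move: cs; rewrite (coproj_norm (p i)) (psdC pb (coproj _) (p i)).
  under eq_bigr do rewrite pu.
  set Q := _ - \sum_j _ => cs.
  have Q0 : 0 <= Q.
    rewrite /Q; under eq_bigr do rewrite -pu.
    by rewrite -coproj_norm psd_ge0.
  have := trial i; rewrite -/(w i) => tr.
  have w0 : 0 <= w i by apply: le_trans tr; rewrite mulr_ge0// psd_ge0.
  have cs' : w i ^+ 2 <= b (coproj (g i)) (coproj (g i)) * Q.
    by rewrite /w sqrrN.
  move: w0; rewrite le_eqVlt => /orP[/eqP <-|w0].
    by rewrite mulr0 mulr_ge0.
  rewrite expr2 -mulrA ler_wpM2l//.
  rewrite -(ler_pM2r w0) -mulrA -expr2.
  apply: (le_trans (ler_wpM2l dl cs')).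
  by rewrite mulrA [Q * _]mulrC ler_wpM2r.
have := ler_sum (index_enum 'I_k) (P := xpredT) (fun i _ => main i).
set S := \sum_i _ * _.
rewrite -subr_ge0 => h; rewrite -subr_ge0; apply: (le_trans h).
rewrite le_eqVlt; apply/orP; left; apply/eqP.
rewrite /S -!sumrB; apply/eqP; rewrite -subr_eq0 -sumrB; apply/eqP.
(* The double sum of B vanishes, B being antisymmetric. *)
pose B i j := (L - lam i) * (L - lam j) * (lam i - lam j) * A i j.
transitivity (- \sum_i \sum_j B i j).
  rewrite -sumrN; apply: eq_bigr => i _; rewrite wE.
  transitivity (- ((L - lam i) ^+ 2 * (\sum_j (lam i - lam j) * A i j) +
    (L - lam i) * \sum_j ((lam i - lam j) * b (g i) (u j)) ^+ 2)).
    by ring.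
  rewrite !mulr_sumr -big_split/=; congr (- _); apply: eq_bigr => j _.
  rewrite /B /A; ring.
suff : \sum_i \sum_j B i j = - \sum_i \sum_j B i j by lra.
rewrite {1}exchange_big/= -sumrN; apply: eq_bigr => i _.
rewrite -sumrN; apply: eq_bigr => j _.
by rewrite /B /A gC; ring.
Qed.

End projection.
End psd_form_theory.

(** * The direct method for Rayleigh quotients *)

(** An ultrafilter replaces the repeated extraction of subsequences: by
  compactness of segments, every bounded sequence is Cauchy along it. *)
Lemma bounded_ultra_cauchy (R : realType) (U : set_system nat) (f : nat -> R) C eps :
  UltraFilter U -> (forall m, `|f m| <= C) -> 0 < eps ->
  exists2 A, U A & forall m l, A m -> A l -> `|f m - f l| < eps.
Proof.
move=> UU fC e0.
have e20 : 0 < eps / 2 by rewrite divr_gt0.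
have [|x [_ xc]] := @segment_compact R (- C) C (f @ U).
  change (U (f @^-1` [set` `[- C, C]])).
  by apply: (filterS _ (@filterT _ U _)) => m _ /=; rewrite in_itv/= -ler_norml; exact: fC.
have fx : U (f @^-1` ball x (eps / 2)).
  have [//|nf] := in_ultra_setVsetC (f @^-1` ball x (eps / 2)) UU.
  by have [y []] := xc (~` ball x (eps / 2)) _ nf (nbhsx_ballx x _ e20).
exists (f @^-1` ball x (eps / 2)) => //.
move=> m l /= xm xl.
have -> : f m - f l = (x - f l) - (x - f m) by ring.
apply: (le_lt_trans (ler_normB _ _)).
by move: xm xl; rewrite /ball/= => *; lra.
Qed.

Section variational.
Context (R : realType) (V : lmodType R) (b e : V -> V -> R)
  (pb : psd_form b) (pe : psd_form e) (P : V -> Prop)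
  (P_lin : forall a v w, P v -> P w -> P (a *: v + w)).

Let PB v w : P v -> P w -> P (v - w).
Proof. by move=> Pv Pw; rewrite addrC -scaleN1r; exact: P_lin. Qed.

Lemma functionals_ultra_cauchy (U : set_system nat) (C d : R) (q : seq V)
    (v : nat -> V) :
  UltraFilter U -> (forall m, b (v m) (v m) <= C) -> 0 < d ->
  exists2 A, U A & forall m l, A m -> A l ->
    \sum_(x <- q) b x (v m - v l) ^+ 2 <= (size q)%:R * d.
Proof.
move=> UU bC d0; elim: q => [|x q [A UA AP]].
  by exists setT; [exact: filterT|move=> m l _ _; rewrite big_nil mul0r].
have [||B UB BP] := @bounded_ultra_cauchy _ U (fun m => b x (v m))
    (Num.sqrt (b x x * C)) (Num.sqrt d) UU.
- move=> m; rewrite -sqrtr_sqr ler_wsqrtr//.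
  apply: (le_trans (psd_CauchySchwarz pb _ _)).
  by rewrite ler_wpM2l// psd_ge0.
- by rewrite sqrtr_gt0.
exists (A `&` B); first exact: filterI.
move=> m l [Am Bm] [Al Bl]; rewrite big_cons /= -[(size q).+1]addn1 natrD.
rewrite mulrDl mul1r addrC lerD ?AP//.
rewrite psdBr//; have := BP _ _ Bm Bl.
move=> /ltW; rewrite -(@ler_sqr _ `|_|) ?nnegrE ?sqrtr_ge0//.
by rewrite sqr_sqrtr ?(ltW d0)// real_normK ?num_real.
Qed.

(** The first hypothesis is compactness of the e-bounded sets for b: up to a small
  multiple of e, the form b is controlled by finitely many functionals. These are
  Cauchy along one ultrafilter, hence so is v; choosing s j in the first j + 1 sets of
  the ultrafilter found in this way yields a subsequence. *)
Lemma cauchy_subsequence (C : R) (v : nat -> V) :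
  (forall eps : R, 0 < eps -> exists q : seq V, forall v, P v ->
     b v v <= eps * e v v + \sum_(x <- q) b x v ^+ 2) ->
  (forall m, P (v m)) ->
  (forall m, b (v m) (v m) <= C) -> (forall m, e (v m) (v m) <= C) ->
  exists2 s : nat -> nat, forall j, (j <= s j)%N &
    forall eps : R, 0 < eps -> exists N, forall m l, (N <= m)%N -> (N <= l)%N ->
      b (v (s m) - v (s l)) (v (s m) - v (s l)) < eps.
Proof.
move=> b_compact Pv bC eC.
have [U [UU nU]] := ultraFilterLemma (eventually_filter : ProperFilter \oo).
have C0 : 0 <= C by apply: le_trans (bC 0%N); exact: psd_ge0.
have key (eps : R) : 0 < eps -> exists2 A, U A & forall m l, A m -> A l ->
    b (v m - v l) (v m - v l) < eps.
  move=> e0.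
  (* The energies of the differences are at most 4 * C, so the energy term takes
     at most half of eps, and the functionals at most a quarter. *)
  have C8 : 0 < 8 * (C + 1) by lra.
  have [q qP] := b_compact (eps / (8 * (C + 1))) (divr_gt0 e0 C8).
  pose d := eps / (4 * (size q).+1%:R).
  have d0 : 0 < d by rewrite divr_gt0// mulr_gt0.
  have [A UA AP] := functionals_ultra_cauchy q UU bC d0.
  exists A => // m l Am Al.
  apply: (le_lt_trans (qP _ (PB (Pv m) (Pv l)))).
  have h1 : eps / (8 * (C + 1)) * e (v m - v l) (v m - v l) <= eps / 2.
    rewrite -ler_pdivlMl ?divr_gt0//.
    have -> : (eps / (8 * (C + 1)))^-1 * (eps / 2) = 4 * (C + 1).
      by field; rewrite !gt_eqF//; lra.
    apply: (le_trans (psd_normD_le pe _ _)).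
    rewrite !(psdNl pe, psdNr pe) opprK.
    have := eC m; have := eC l; lra.
  have h2 : (size q)%:R * d <= eps / 4.
    rewrite /d mulrCA ler_pM2l// ler_pdivrMr ?mulr_gt0//.
    by rewrite mulrA mulVf// mul1r ler_nat.
  have := AP _ _ Am Al; lra.
have inv_gt0 j : 0 < (j.+1%:R : R)^-1 by rewrite invr_gt0.
pose A j := sval (cid2 (key _ (inv_gt0 j))).
have UA j : U (A j) by rewrite /A; case: cid2.
have AP j m l : A j m -> A j l -> b (v m - v l) (v m - v l) < j.+1%:R^-1.
  by rewrite /A; case: cid2 => B ? /=; exact.
have sP j : exists s, (j <= s)%N /\ forall i : 'I_j.+1, A i s.
  apply: (@filter_ex _ U); apply: filterI.
    by apply: nU; exists j.
  by apply: filter_forall => i; exact: UA.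
exists (fun j => sval (cid (sP j))).
  by move=> j; case: cid => s [].
move=> eps e0.
have [N HN] : exists N : nat, (N.+1%:R : R)^-1 < eps.
  have [N _ HN] := near_infty_natSinv_lt (PosNum e0).
  by exists N; apply: HN => /=.
exists N => m l Nm Nl; apply: lt_trans HN; apply: AP.
  case: cid => s /= [_ As]; exact: (As (Ordinal (Nm : (N < m.+1)%N))).
case: cid => s /= [_ As]; exact: (As (Ordinal (Nl : (N < l.+1)%N))).
Qed.

Context (k : nat) (u : 'I_k -> V) (lam : 'I_k -> R)
  (Pu : forall i, P (u i))
  (u_orthonormal : forall i j, b (u i) (u j) = (i == j)%:R)
  (u_eigen : forall i v, P v -> e (u i) v = lam i * b (u i) v).

(** Direct method: a minimising sequence for the Rayleigh quotient on the
  orthogonal complement of the u i has a b-Cauchy subsequence, which the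
  parallelogram law makes e-Cauchy. The limit satisfies the Euler-Lagrange equation
  against vectors orthogonal to the u i, hence against all of P since the u i are
  themselves eigenvectors. *)
Lemma rayleigh_minimizer (L : R) (v0 : V) :
  (forall eps : R, 0 < eps -> exists q : seq V, forall v, P v ->
     b v v <= eps * e v v + \sum_(x <- q) b x v ^+ 2) ->
  (forall v : nat -> V, (forall m, P (v m)) ->
    (forall eps : R, 0 < eps -> exists N, forall m l, (N <= m)%N -> (N <= l)%N ->
      b (v m - v l) (v m - v l) + e (v m - v l) (v m - v l) < eps) ->
    exists2 w, P w & forall eps : R, 0 < eps -> exists N, forall m, (N <= m)%N ->
      b (v m - w) (v m - w) + e (v m - w) (v m - w) < eps) ->
  P v0 -> (forall i, b v0 (u i) = 0) -> e v0 v0 < L * b v0 v0 ->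
  exists mu v, [/\ mu < L, P v, b v v = 1, forall i, b v (u i) = 0 &
    forall w, P w -> e v w = mu * b v w].
Proof.
move=> b_compact complete Pv0 v0u v0L.
have PZ a v : P v -> P (a *: v).
  by move=> Pv; rewrite -[a *: v]addr0 -(subrr v); exact/P_lin/PB.
have PD v w : P v -> P w -> P (v + w).
  by move=> Pv Pw; rewrite -[v]scale1r; exact: P_lin.
pose Q v := P v /\ forall i, b v (u i) = 0.
have QZ a v : Q v -> Q (a *: v).
  by move=> [Pv vu]; split; [exact: PZ|move=> i; rewrite psdZl// vu mulr0].
have QD v w : Q v -> Q w -> Q (v + w).
  move=> [Pv vu] [Pw wu]; split; [exact: PD|move=> i].
  by rewrite psdDl// vu wu addr0.
pose E := [set r | exists v, [/\ Q v, b v v = 1 & r = e v v]].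
have normalize v : Q v -> 0 < b v v -> E (e v v / b v v).
  move=> Qv v_gt0; exists ((Num.sqrt (b v v))^-1 *: v); split; first exact: QZ.
    rewrite psdZl// psdZr// mulrA -expr2 exprVn sqr_sqrtr ?ltW//.
    by rewrite mulVf// gt_eqF.
  by rewrite psdZl// psdZr// mulrA -expr2 exprVn sqr_sqrtr ?ltW// mulrC.
have lbE : has_lbound E by exists 0 => _ [v [_ _ ->]]; exact: psd_ge0.
have v00 : 0 < b v0 v0.
  rewrite lt_def psd_ge0// andbT; apply/negP => /eqP b0.
  by move: v0L; rewrite b0 mulr0 ltNge psd_ge0.
have infE : has_inf E by split => //; exists (e v0 v0 / b v0 v0); exact: normalize.
pose mu := inf E.
have muE v : Q v -> mu * b v v <= e v v.
  move=> Qv; have := psd_ge0 pb v; rewrite le_eqVlt => /orP[/eqP <-|bv].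
    by rewrite mulr0 psd_ge0.
  by rewrite -ler_pdivlMr//; apply: ge_inf => //; exact: normalize.
have muL : mu < L.
  apply: (@le_lt_trans _ _ (e v0 v0 / b v0 v0)).
    by apply: ge_inf => //; exact: normalize.
  by rewrite ltr_pdivrMr.
have inv_gt0 j : 0 < (j.+1%:R : R)^-1 by rewrite invr_gt0.
have vP m : exists v, [/\ Q v, b v v = 1 & e v v < mu + m.+1%:R^-1].
  have [_ [v [Qv bv ->]] ev] := inf_adherent (inv_gt0 m) infE.
  by exists v.
have {vP} [v vP] := choice vP.
have Qv m : Q (v m) by have [] := vP m.
have Pv m : P (v m) by have [] := Qv m.
have bv m : b (v m) (v m) = 1 by have [] := vP m.
have ev m : e (v m) (v m) < mu + m.+1%:R^-1 by have [] := vP m.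
have mu0 : 0 <= mu.
  by apply: lb_le_inf; [by case: infE|move=> _ [x [_ _ ->]]; exact: psd_ge0].
have [||s sj sP] := @cauchy_subsequence (mu + 1) v b_compact Pv.
- by move=> m; rewrite bv; lra.
- move=> m; apply: (le_trans (ltW (ev m))); rewrite lerD2l.
  by rewrite invf_le1// ler1n.
have es m j : (j <= m)%N -> e (v (s m)) (v (s m)) < mu + j.+1%:R^-1.
  move=> jm; apply: (lt_le_trans (ev _)); rewrite lerD2l lef_pV2 ?posrE//.
  by rewrite ler_nat ltnS (leq_trans jm).
have smallN (eps : R) : 0 < eps -> exists N : nat, (N.+1%:R : R)^-1 < eps.
  move=> e0; have [N _ HN] := near_infty_natSinv_lt (PosNum e0).
  by exists N; apply: HN => /=.
(* parallelogram law, and mu * b <= e on the half-sum *)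
have par m l : e (v (s m) - v (s l)) (v (s m) - v (s l)) <=
    2 * e (v (s m)) (v (s m)) + 2 * e (v (s l)) (v (s l)) - 4 * mu
    + mu * b (v (s m) - v (s l)) (v (s m) - v (s l)).
  have := muE _ (QD _ _ (Qv (s m)) (Qv (s l))).
  rewrite !(psdE pb, psdE pe) !bv.
  rewrite (psdC pe (v (s l))) (psdC pb (v (s l))); lra.
have [|w Pw wP] := complete (v \o s) (fun m => Pv _).
  move=> eps eps0.
  have h0 : 0 < eps / (2 * (mu + 1)) by rewrite divr_gt0// mulr_gt0//; lra.
  have [N1 N1P] := sP _ h0.
  have [N2 N2P] := smallN (eps / 8) (divr_gt0 eps0 (ltr0Sn _ _)).
  exists (maxn N1 N2) => m l; rewrite !geq_max => /andP[m1 m2] /andP[l1 l2] /=.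
  have := N1P _ _ m1 l1; rewrite ltr_pdivlMr ?mulr_gt0//; last lra.
  have := par m l; have := es _ _ m2; have := es _ _ l2.
  set bb := b _ _; set e1 := e (v (s l)) _; set e2 := e (v (s m)) _.
  set e3 := e (_ - _) _; move: (N2.+1%:R^-1) N2P.
  by move=> d N2P h1 h2 h3 h4; lra.
pose z m := v (s m) - w.
have zP (eps : R) : 0 < eps -> exists m, b (z m) (z m) < eps /\ e (z m) (z m) < eps /\
    e (v (s m)) (v (s m)) < mu + eps.
  move=> e0; have [N NP] := wP _ e0; have [M MP] := smallN _ e0.
  exists (maxn N M); have h := NP _ (leq_maxl N M).
  have bz := psd_ge0 pb (z (maxn N M)); have ez := psd_ge0 pe (z (maxn N M)).
  split; first by apply: le_lt_trans h; rewrite lerDl.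
  split; first by apply: le_lt_trans h; rewrite lerDr.
  by apply: (lt_trans (es _ _ (leq_maxr N M))); rewrite ltrD2l.
have wE m : w = v (s m) - z m by rewrite /z opprB addrC subrK.
clearbody z.
have sq_lt0 (x : R) : (forall eps : R, 0 < eps -> x ^+ 2 < eps) -> x = 0.
  move=> h; apply/eqP; rewrite -sqrf_eq0 eq_le sqr_ge0 andbT.
  by apply/ler_addgt0Pr => eps e0; rewrite add0r ltW// h.
have wu i : b w (u i) = 0.
  apply: sq_lt0 => eps e0; have [m [bz _]] := zP _ e0.
  rewrite (wE m) psdBl// (Qv (s m)).2 sub0r sqrrN.
  apply: (le_lt_trans (psd_CauchySchwarz pb _ _)).
  by rewrite u_orthonormal eqxx mulr1.
have Qw : Q w by split.
have bw : b w w = 1.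
  apply/eqP; rewrite -subr_eq0; apply/eqP; apply: sq_lt0 => eps e0.
  pose d := Num.min 1 (eps / 20).
  have d0 : 0 < d by rewrite lt_min ltr01 divr_gt0.
  have [m [bz _]] := zP _ d0.
  have d1 : d <= 1 by rewrite /d ge_min lexx.
  have d2 : d <= eps / 20 by rewrite /d ge_min lexx orbT.
  have := psd_CauchySchwarz pb (v (s m)) (z m); rewrite bv mul1r.
  have z0 := psd_ge0 pb (z m).
  rewrite (wE m) !(psdE pb) bv (psdC pb (z m)).
  move: (b (v (s m)) (z m)) (b (z m) (z m)) z0 bz => c zz z0 bz cz.
  have -> : (1 - c - (c - zz) - 1) = zz - 2 * c by ring.
  have zz1 : zz <= 1 by lra.
  have := ler_wpM2l z0 zz1; have := sqr_ge0 (zz + 2 * c); rewrite !expr2 => *; lra.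
have ew : e w w = mu.
  apply/eqP; rewrite eq_le; apply/andP; split; last first.
    by have := muE _ Qw; rewrite bw mulr1.
  apply/ler_addgt0Pr => eps e0.
  (* By Cauchy-Schwarz, an error of norm less than d moves the energy of v (s m) by
     twice a cross term of size at most eps / 4, up to d itself. *)
  pose K := mu + 2.
  pose d := Num.min 1 (eps ^+ 2 / (16 * K + 16 * eps + 16)).
  have [K0 muK] : 0 < K /\ mu + 1 <= K by rewrite /K; split; lra.
  have D0 : 0 < 16 * K + 16 * eps + 16 by lra.
  have d0 : 0 < d by rewrite lt_min ltr01 divr_gt0// exprn_gt0.
  have d1 : d <= 1 by rewrite /d ge_min lexx.
  have d2 : d * (16 * K + 16 * eps + 16) <= eps ^+ 2.
    by rewrite -ler_pdivlMr// /d ge_min lexx orbT.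
  have [m [_ [ez em]]] := zP _ d0.
  have z0 := psd_ge0 pe (z m).
  have v0' := psd_ge0 pe (v (s m)).
  have := psd_CauchySchwarz pe (v (s m)) (z m).
  rewrite (wE m) !(psdE pe) (psdC pe (z m)).
  move: (e (v (s m)) (z m)) (e (z m) (z m)) (e (v (s m)) (v (s m))) z0 ez em v0'.
  move=> c zz vv z0 ez em v0' cs; clearbody K d.
  have dK : d < eps / 4.
    rewrite -(ltr_pM2r D0); apply: (le_lt_trans d2).
    have := mulr_gt0 K0 e0; have := mulr_gt0 e0 e0; rewrite expr2 => *; lra.
  have ch : c ^+ 2 <= (eps / 4) ^+ 2.
    apply: (le_trans cs); apply: (@le_trans _ _ (K * d)); last first.
      have := mulr_gt0 d0 e0; rewrite expr2 => *; lra.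
    by rewrite ler_pM//; [lra|exact: ltW].
  have : `|c| <= eps / 4.
    by rewrite -(@ler_sqr _ `|c|) ?nnegrE ?real_normK ?num_real//; lra.
  rewrite ler_norml => /andP[? ?]; lra.
exists mu, w; split => // x Px.
have EL y : Q y -> e w y = mu * b w y.
  move=> Qy; apply/eqP; rewrite -subr_eq0; apply/eqP.
  set c := _ - _.
  have H r : 0 <= r * (2 * c) + r ^+ 2 * (e y y - mu * b y y).
    have := muE _ (QD _ _ Qw (QZ r _ Qy)).
    rewrite !(psdE pb, psdE pe) bw ew (psdC pe y) (psdC pb y) /c; lra.
  have q0 : 0 <= e y y - mu * b y y by rewrite subr_ge0 muE.
  (* This value of r makes the quadratic negative unless c is zero. *)
  have := H (- c / (e y y - mu * b y y + 1)).
  move: (e y y - _) q0 => q q0.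
  have q1 : q + 1 != 0 by rewrite gt_eqF//; lra.
  have -> : - c / (q + 1) * (2 * c) + (- c / (q + 1)) ^+ 2 * q =
     - (c ^+ 2 * ((q + 2) / (q + 1) ^+ 2)) by field.
  rewrite oppr_ge0 pmulr_lle0; last by rewrite divr_gt0 ?exprn_gt0//; lra.
  by move=> h; apply/eqP; rewrite -sqrf_eq0 eq_le h sqr_ge0.
have Psum (F : 'I_k -> R) : P (\sum_j F j *: u j).
  elim/big_ind : _ => [||i _]; [|exact: PD|exact: PZ].
  by rewrite -(subrr v0); exact: PB.
have Qx : Q (coproj b u x).
  by split; [exact: PB|move=> i; exact: coproj_orth].
have := EL _ Qx.
rewrite (coprojE pb x wu) => <-; rewrite /coproj psdBr// psd_sumr// big1 ?subr0//.
by move=> i _; rewrite psdZr// (psdC pe) u_eigen// (psdC pb (u i)) wu !mulr0.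
Qed.

End variational.

(** * Lebesgue measure on R^n *)

Section borel_rV.
Context (R : realType) (n : nat).

Lemma ball_rVE (x : 'rV[R]_n) (e : R) : 0 < e ->
  ball x e = [set y | forall i, `|x 0 i - y 0 i| < e].
Proof.
move=> e0; apply/seteqP; split => [y [_ xy] i|y xy]; first exact: xy.
by split=> // i j; rewrite ord1; exact: xy.
Qed.

Lemma measurable_ball_rV (x : 'rV[R]_n) (e : R) : 0 < e -> measurable (ball x e).
Proof.
move=> e0.
have -> : ball x e =
    \bigcap_(i in [set: 'I_n]) ((fun y : 'rV[R]_n => y 0 i) @^-1` ball (x 0 i) e).
  rewrite ball_rVE//.
  by apply/seteqP; split => [y xy i _|y xy i]; [exact: xy|exact: (xy i I)].
apply: fin_bigcap_measurable => // i _; rewrite -[X in measurable X]setTI.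
by apply: measurable_coor => //; exact: measurable_ball.
Qed.

(** An open set is the countable union of the balls with rational centre and
  radius 1 / (k + 1) that it contains. *)
Lemma open_measurable_rV (U : set 'rV[R]_n) : open U -> measurable U.
Proof.
move=> oU.
(* Empty unless the ball of index q lies in U. *)
pose B (q : 'rV[rat]_n * nat) : set 'rV[R]_n :=
  let b := ball (map_mx ratr q.1 : 'rV[R]_n) (q.2.+1%:R^-1 : R) in
  [set y | b `<=` U /\ b y].
suff -> : U = \bigcup_q B q.
  apply: countable_bigcupT_measurable => //.
  move=> [q k]; rewrite /B /=; set b := ball _ _.
  have [bU|bU] := pselect (b `<=` U); last first.
    by rewrite (_ : [set _ | _] = set0)//; apply/seteqP; split => y // [].
  rewrite (_ : [set _ | _] = b); first by apply: measurable_ball_rV; rewrite invr_gt0.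
  by apply/seteqP; split => y // [].
apply/seteqP; split => [x Ux|x [q _ [+ qx]]]; last exact.
have /nbhs_ballP[e /= e0 xeU] := open_nbhs_nbhs (conj oU Ux).
have [k _ /(_ k (leqnn k))/= ke] := near_infty_natSinv_lt (PosNum (divr_gt0 e0 (ltr0Sn _ 1))).
have k0 : (0 : R) < k.+1%:R^-1 by rewrite invr_gt0.
have qP i : exists q : rat, `|x 0 i - ratr q| < k.+1%:R^-1.
  have [|q] := @rat_in_itvoo R (x 0 i - k.+1%:R^-1) (x 0 i + k.+1%:R^-1).
    by rewrite ltrBlDr -addrA ltrDl addr_gt0.
  by rewrite in_itv/= => qx; exists q; rewrite distrC ltr_distl.
have [q {}qP] := choice qP.
exists (\row_i q i, k) => //; split => /=; last first.
  by rewrite ball_rVE//= => i; rewrite !mxE distrC.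
move=> y; rewrite ball_rVE//= => qy; apply: xeU; rewrite ball_rVE// => i.
have := qy i; rewrite !mxE => h; rewrite (_ : _ - _ = (x 0 i - ratr (q i)) + (ratr (q i) - y 0 i)); last by rewrite addrA subrK.
rewrite (le_lt_trans (ler_normD _ _))// (splitr e) ltrD// (lt_trans _ ke)//.
Qed.

Lemma continuous_in_measurable_rV (D : set 'rV[R]_n) (f : 'rV[R]_n -> R) :
  open D -> {in D, continuous f} -> measurable_fun D f.
Proof.
move=> oD cf; apply: (measurability _ (RGenOpens.measurableE R)).
move=> _ [_ [a [b ->]] <-]; apply: open_measurable_rV.
by apply: (iffLR (continuous_inP _ oD)) => //; exact: interval_open.
Qed.

Lemma continuous_measurable_rV (f : 'rV[R]_n -> R) :
  continuous f -> measurable_fun setT f.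
Proof.
by move=> cf; apply: continuous_in_measurable_rV => //; exact: openT.
Qed.

End borel_rV.

Section translation.
Context (R : realType).

(** The translate of the measure gives the same mass to intervals. *)
Lemma lebesgue_measure_shift (a : R) (A : set R) : measurable A ->
  lebesgue_measure ((fun x => x + a) @^-1` A) = lebesgue_measure A.
Proof.
move=> mA.
have ms : measurable_fun [set: measurableTypeR R] (fun x : measurableTypeR R => x + a : measurableTypeR R).
  by apply: measurable_funD.
pose m : {measure set (measurableTypeR R) -> \bar R} :=
  measure_function.measure_function_pushforward__canonical__measure_function_Measure
    (@lebesgue_measure R) ms.
rewrite [RHS](@lebesgue_measure_unique _ m)// => X [[x y] _ <-]/=.
rewrite /pushforward.
rewrite (_ : _ @^-1` _ = `]x - a, y - a]%classic).
  rewrite !lebesgue_measure_itv/= !lte_fin ltrD2r; case: ifPn => // _.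
  by rewrite -!EFinB opprB addrA subrK.
by apply/seteqP; split => z /=; rewrite !in_itv/= ltrBlDr lerBrDr.
Qed.

Lemma ge0_integral_shift_lebesgue (a : R) (f : R -> \bar R) :
  measurable_fun setT f -> (forall x, 0 <= f x)%E ->
  (\int[@lebesgue_measure R]_x f (x + a)%R = \int[@lebesgue_measure R]_x f x)%E.
Proof.
move=> mf f0.
have ms : measurable_fun [set: measurableTypeR R] (fun x : measurableTypeR R => x + a : measurableTypeR R).
  by apply: measurable_funD.
have := @ge0_integral_pushforward _ _ _ _ R _ ms (@lebesgue_measure R) setT f measurableT mf
  (fun x _ => f0 x).
rewrite preimage_setT => <-; apply: eq_measure_integral => A mA _.
exact: lebesgue_measure_shift.
Qed.

Lemma measurable_rV_cons n : measurable_fun setT (@rV_cons R n).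
Proof.
apply: measurable_fun_rVP => i.
have [j ->|j ->] := split_ordP (i : 'I_(1 + n)).
- rewrite (_ : (fun _ => _) = fst); first exact: measurable_fst.
  apply/funext => x; rewrite /rV_cons.
  by rewrite (@row_mxEl _ 1 1 n) !ord1 mxE eqxx mulr1n.
- rewrite (_ : (fun _ => _) = (fun x : 'rV[R]_n => x 0 j) \o snd).
    exact: measurableT_comp (measurable_coor _) measurable_snd.
  by apply/funext => x; rewrite /rV_cons (@row_mxEr _ 1 1 n).
Qed.

Lemma ge0_integral_rVS n (f : 'rV[R]_n.+1 -> \bar R) :
  measurable_fun setT f -> (forall x, 0 <= f x)%E ->
  (\int[@lebesgue_rV R n.+1]_x f x =
   \int[@lebesgue_measure R]_x \int[@lebesgue_rV R n]_y f (rV_cons (x, y)))%E.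
Proof.
move=> mf f0.
have := @ge0_integral_pushforward _ _ _ _ R _ (@measurable_rV_cons n)
  (@lebesgue_measure R \x @lebesgue_rV R n)%E setT f measurableT mf (fun x _ => f0 x).
rewrite preimage_setT => H.
transitivity (\int[pushforward (@lebesgue_measure R \x @lebesgue_rV R n)%E (@rV_cons R n)]_x f x)%E.
  apply: eq_measure_integral; first exact: measurable_rV_cons.
  by move=> mc A mA _; exact: erefl.
rewrite H fubini_tonelli1//.
  exact: (measurableT_comp mf (@measurable_rV_cons n)).
by move=> x; exact: f0.
Qed.

Lemma measurable_shift_rV n (a : 'rV[R]_n) :
  measurable_fun setT (fun x : 'rV[R]_n => x + a).
Proof.
apply: measurable_fun_rVP => i.
rewrite (_ : (fun _ => _) = (fun x : 'rV[R]_n => x 0 i + a 0 i)).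
  by apply: measurable_funD => //; exact: measurable_coor.
by apply/funext => x; rewrite mxE.
Qed.

(** Translation invariance, by induction on the dimension: the first coordinate is
  split off and translated separately. *)
Lemma ge0_integral_shift_rV n (a : 'rV[R]_n) (f : 'rV[R]_n -> \bar R) :
  measurable_fun setT f -> (forall x, 0 <= f x)%E ->
  (\int[@lebesgue_rV R n]_x f (x + a)%R = \int[@lebesgue_rV R n]_x f x)%E.
Proof.
elim: n a f => [|n ih] a f mf f0.
  by apply: eq_integral => x _; rewrite [in LHS](thinmx0 a) addr0.
rewrite ge0_integral_rVS//; last first.
  exact: (measurableT_comp mf (measurable_shift_rV a)).
rewrite ge0_integral_rVS//.
pose F (x : measurableTypeR R) := (\int[@lebesgue_rV R n]_y f (rV_cons (x, y)))%E.
have mF : measurable_fun setT F.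
  apply: (@measurable_fun_fubini_tonelli_F _ _ _ _ R (@lebesgue_rV R n)
    (fun p => f (rV_cons p))) => //.
  exact: (measurableT_comp mf (@measurable_rV_cons n)).
rewrite -[RHS](ge0_integral_shift_lebesgue (a 0 0) mF); last first.
  by move=> x; exact: integral_ge0.
apply: eq_integral => x _.
rewrite /F -[RHS](ih (rsubmx (a : 'rV_(1 + n)))); last 2 first.
- exact: (measurableT_comp mf (measurableT_comp (@measurable_rV_cons n)
    (pair1_measurable (x + a 0 0 : measurableTypeR R)))).
- by [].
apply: eq_integral => y _; congr f; apply/rowP => i; rewrite mxE /rV_cons.
have [j ->|j ->] := split_ordP (i : 'I_(1 + n)).
  rewrite !(@row_mxEl _ 1 1 n) !ord1 !mxE eqxx !mulr1n.
  by congr (_ + a _ _); apply/val_inj.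
by rewrite !(@row_mxEr _ 1 1 n) !mxE.
Qed.

(** Half-open, so that adjacent boxes tile the space. *)
Definition box n (a b : 'rV[R]_n) : set 'rV[R]_n :=
  [set x | forall i, a 0 i <= x 0 i < b 0 i].

Lemma measurable_box n (a b : 'rV[R]_n) : measurable (box a b).
Proof.
rewrite (_ : box a b = \bigcap_(i in [set: 'I_n])
   ((fun y : 'rV[R]_n => y 0 i) @^-1` `[a 0 i, b 0 i[%classic)).
  apply: fin_bigcap_measurable => // i _; rewrite -[X in measurable X]setTI.
  by apply: measurable_coor => //; exact: measurable_itv.
by apply/seteqP; split => [y xy i _|y xy i] /=;
  [rewrite in_itv/= xy|have := xy i I; rewrite /= in_itv].
Qed.

Lemma lebesgue_rV_box n (a b : 'rV[R]_n) : (forall i, a 0 i <= b 0 i) ->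
  lebesgue_rV (box a b) = (\prod_i (b 0 i - a 0 i))%:E.
Proof.
elim: n a b => [|n ih] a b ab.
  by rewrite big_ord0 /= diracE mem_set// => -[].
pose a' := rsubmx (a : 'rV_(1 + n)); pose b' := rsubmx (b : 'rV_(1 + n)).
rewrite /= /pushforward (_ : _ @^-1` _ = `[a 0 0, b 0 0[%classic `*` box a' b').
  rewrite product_measure1E//; last exact: measurable_box.
  have ab' i : a' 0 i <= b' 0 i by rewrite !mxE.
  rewrite [X in (_ * X)%E](ih a' b' ab').
  rewrite big_ord_recl EFinM; congr (_ * _)%E; last first.
    congr EFin; apply: eq_bigr => i _; rewrite !mxE.
    by congr (b _ _ - a _ _); apply: val_inj.
  rewrite [LHS](lebesgue_measure_itv `[a 0 0, b 0 0[)/= lte_fin.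
  by case: ltgtP (ab 0) => // ->; rewrite subrr.
rewrite /rV_cons; apply/seteqP; split => [[x y]/= h|[x y]/= [x1 y1] i].
  split => /=.
    have := h (lshift n (0 : 'I_1)).
    rewrite (@row_mxEl _ 1 1 n) mxE eqxx mulr1n in_itv/=.
    by rewrite (_ : lshift n 0 = 0)//; exact: val_inj.
  by move=> i; have := h (rshift 1 i); rewrite (@row_mxEr _ 1 1 n) !mxE.
have [j ->|j ->] := split_ordP (i : 'I_(1 + n)).
  rewrite (@row_mxEl _ 1 1 n) !ord1 mxE eqxx mulr1n; move: x1; rewrite in_itv/=.
  by rewrite (_ : lshift n 0 = 0)//; exact: val_inj.
by have := y1 j; rewrite (@row_mxEr _ 1 1 n) !mxE.
Qed.

End translation.

(** * Smooth functions and test functions *)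

Lemma near_eq_differentiable (R : numFieldType) (V W : normedModType R)
    (f g : V -> W) x :
  (\near x, f x = g x) -> differentiable f x -> differentiable g x.
Proof.
move=> fg df; have fgx : f x = g x by exact: nbhs_singleton fg.
have H : g \o shift x = cst (g x) + 'd f x +o_ 0 id.
  apply/eqaddoP => e e0.
  have /eqaddoP/(_ e e0) := diff_locally df.
  have : \forall z \near 0, f (z + x) = g (z + x).
    by move: fg; rewrite (near_shift 0 x)/= subr0.
  apply: filterS2 => z fgz; apply: le_trans.
  by rewrite !fctE /= fgz fgx.
have cdf := diff_continuous df.
by apply/diff_locallyP; rewrite (diff_unique cdf H).
Qed.

Section calculus.
Context (R : realType) (n : nat).
Implicit Types (f g : 'rV[R]_n -> R) (x h : 'rV[R]_n) (U : set 'rV[R]_n).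

Lemma near_eq_partial f g x i :
  (\near x, f x = g x) -> partial i f x = partial i g x.
Proof. exact: near_eq_derive. Qed.

Lemma partial_cst (c : R) i x : partial i (fun=> c) x = 0.
Proof. exact: derive_cst. Qed.

Lemma partialD f g x i : differentiable f x -> differentiable g x ->
  partial i (fun y => f y + g y) x = partial i f x + partial i g x.
Proof. by move=> df dg; rewrite /partial deriveD//; exact: diff_derivable. Qed.

Lemma partialM f g x i : differentiable f x -> differentiable g x ->
  partial i (fun y => f y * g y) x = partial i f x * g x + f x * partial i g x.
Proof.
move=> df dg; rewrite /partial deriveM; [|exact: diff_derivable..].
by rewrite addrC mulrC.
Qed.

Lemma partial_coord x i j : partial i (fun y => y 0 j) x = (i == j)%:R.
Proof.
rewrite /partial /derive; apply: cvg_lim => //.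
apply: (@cvg_trans _ (cst ((i == j)%:R : R) @ 0^')); last exact: cvg_cst.
apply: near_eq_cvg; near=> z.
rewrite /= !mxE eqxx /= addrK eq_sym scalerA mulVf ?scale1r//.
by near: z; exact: nbhs_dnbhs_neq.
Unshelve. all: by end_near. Qed.

Lemma derive_partial f x h : differentiable f x ->
  'D_h f x = \sum_i h 0 i * partial i f x.
Proof.
move=> df; rewrite deriveE// {1}(row_sum_delta h) linear_sum.
by apply: eq_bigr => i _; rewrite linearZ /= /partial deriveE.
Qed.

(** Differentiability in the ambient space, at the points of U only: powers of the
  last coordinate are total functions, but need only be smooth on the half-space. *)
Fixpoint Ck_on U (k : nat) f : Prop :=
  match k with
  | 0 => forall x, U x -> {for x, continuous f}
  | j.+1 => (forall x, U x -> differentiable f x) /\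
            forall i, Ck_on U j (partial i f)
  end.

Definition smooth_on U f := forall k, Ck_on U k f.

Lemma Ck_onW U k f : Ck_on U k.+1 f -> Ck_on U k f.
Proof.
elim: k f => [|k ih] f [df dk].
  by move=> x Ux; exact/differentiable_continuous/df.
by split => // i; exact: ih.
Qed.

(** On an open set, partial derivatives depend on germs. *)
Lemma Ck_on_ext U k f g : open U -> (forall x, U x -> f x = g x) ->
  Ck_on U k f -> Ck_on U k g.
Proof.
move=> oU; have nU x : U x -> \forall y \near x, U y.
  by move=> Ux; apply: open_nbhs_nbhs.
elim: k f g => [|k ih] f g fg.
  move=> cf x Ux; rewrite /prop_for /continuous_at -(fg _ Ux).
  have fgx : \near x, f x = g x by apply: filterS (nU _ Ux).
  exact: (cvg_trans (@near_eq_cvg _ _ (nbhs x) _ f g fgx) (cf _ Ux)).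
move=> [df dk]; split => [x Ux|i].
  by apply: near_eq_differentiable (df _ Ux); apply: filterS (nU _ Ux).
apply: ih (dk i) => x Ux; apply: near_eq_partial.
by apply: filterS (nU _ Ux).
Qed.

Lemma Ck_on_cst U k (c : R) : open U -> Ck_on U k (fun=> c).
Proof.
move=> oU; elim: k c => [|k ih] c; first by move=> x _; exact: cst_continuous.
split=> [x _|i]; first exact: differentiable_cst.
by apply: Ck_on_ext (ih 0) => // x _; rewrite partial_cst.
Qed.

Lemma Ck_onD U k f g : open U -> Ck_on U k f -> Ck_on U k g ->
  Ck_on U k (fun x => f x + g x).
Proof.
move=> oU; elim: k f g => [|k ih] f g.
  by move=> cf cg x Ux; apply: continuousD; [exact: cf|exact: cg].
move=> [df fk] [dg gk]; split => [x Ux|i].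
  by apply: differentiableD; [exact: df|exact: dg].
apply: Ck_on_ext (ih _ _ (fk i) (gk i)) => // x Ux.
by rewrite partialD; [|exact: df|exact: dg].
Qed.

Lemma Ck_onM U k f g : open U -> Ck_on U k f -> Ck_on U k g ->
  Ck_on U k (fun x => f x * g x).
Proof.
move=> oU; elim: k f g => [|k ih] f g.
  by move=> cf cg x Ux; apply: continuousM; [exact: cf|exact: cg].
move=> /[dup] fS [df fk] /[dup] gS [dg gk]; split => [x Ux|i].
  by apply: differentiableM; [exact: df|exact: dg].
apply: Ck_on_ext (Ck_onD oU (ih _ _ (fk i) (Ck_onW gS)) (ih _ _ (Ck_onW fS) (gk i))) => //.
by move=> x Ux; rewrite partialM; [|exact: df|exact: dg].
Qed.

Lemma Ck_on_cover U (V : set 'rV[R]_n) k f : (forall x, U x \/ V x) ->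
  Ck_on U k f -> Ck_on V k f -> Ck k f.
Proof.
move=> UV; elim: k f => [|k ih] f.
  by move=> fU fV x; have [/fU|/fV] := UV x.
move=> [dU fU] [dV fV]; split => [x|i]; last exact: (ih _ (fU i) (fV i)).
by have [/dU|/dV] := UV x.
Qed.

Lemma Ck_CkT k f : Ck k f -> Ck_on setT k f.
Proof.
elim: k f => [|k ih] f; first by move=> cf x _; exact: cf.
by move=> [df fk]; split => [x _|i]; [exact: df|exact/ih/fk].
Qed.

Lemma Ck_on_sub U (V : set 'rV[R]_n) k f : U `<=` V -> Ck_on V k f -> Ck_on U k f.
Proof.
move=> UV; elim: k f => [|k ih] f; first by move=> h x /UV/h.
by move=> [df fk]; split => [x /UV/df|i]; last exact/ih/fk.
Qed.

Lemma smooth_smooth_on U f : smooth f -> smooth_on U f.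
Proof. by move=> sf k; apply: Ck_on_sub (Ck_CkT (sf k)). Qed.

Lemma smooth_on_cst U (c : R) : open U -> smooth_on U (fun=> c).
Proof. by move=> oU k; exact: Ck_on_cst. Qed.

Lemma smooth_on_differentiable U f x : smooth_on U f -> U x -> differentiable f x.
Proof. by move=> /(_ 1%N)[df _]; exact: df. Qed.

Lemma smooth_on_continuous U f x : smooth_on U f -> U x -> {for x, continuous f}.
Proof. by move=> /(_ 0%N); exact. Qed.

Lemma smooth_on_coord U j : open U -> smooth_on U (fun x => x 0 j).
Proof.
move=> oU [|k]; first by move=> x _; exact: coord_continuous.
split=> [x _|i]; first exact: differentiable_coord.
apply: Ck_on_ext (Ck_on_cst k ((i == j)%:R : R) oU) => // x _.
by rewrite partial_coord.
Qed.

Lemma smooth_differentiable f x : smooth f -> differentiable f x.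
Proof. by move=> /(_ 1%N)[df _]; exact: df. Qed.

Lemma smooth_continuous f : smooth f -> continuous f.
Proof. by move=> /(_ 0%N). Qed.

Lemma smooth_partial f i : smooth f -> smooth (partial i f).
Proof. by move=> sf k; have [_] := sf k.+1; exact. Qed.

Section test_functions.
Context (Omega : set 'rV[R]_n).

Lemma near_supp_eq0 (K : set 'rV[R]_n) f x : closed K ->
  (forall y, ~ K y -> f y = 0) -> ~ K x -> \near x, f x = 0.
Proof.
move=> cK fK Kx; have : nbhs x (~` K).
  by apply: open_nbhs_nbhs; split => //; exact: closed_openC.
by apply: filterS.
Qed.

Lemma test_function_partial f i :
  test_function Omega f -> test_function Omega (partial i f).
Proof.
move=> [sf [K [cK KO fK]]]; split; first exact: smooth_partial.
exists K; split => // x Kx.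
have cK' : closed K by apply: compact_closed cK; exact: norm_hausdorff.
rewrite -(partial_cst 0 i x); apply: near_eq_partial.
exact: near_supp_eq0 Kx.
Qed.

(** Away from the compact support of f the product is locally zero, so it is
  smooth everywhere although a is smooth on U only. *)
Lemma test_functionM U (a : 'rV[R]_n -> R) f : open U -> Omega `<=` U ->
  smooth_on U a -> test_function Omega f ->
  test_function Omega (fun x => a x * f x).
Proof.
move=> oU OU sa [sf [K [cK KO fK]]]; split; last first.
  by exists K; split => // x /fK ->; rewrite mulr0.
have cK' : closed K by apply: compact_closed cK; exact: norm_hausdorff.
move=> k; apply: (@Ck_on_cover U (~` K)).
- by move=> x; have [/KO/OU|] := pselect (K x); [left|right].
- by apply: Ck_onM => //; exact: smooth_smooth_on.
- apply: Ck_on_ext (Ck_on_cst k (0 : R) _); try exact: closed_openC.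
  by move=> x /fK ->; rewrite mulr0.
Qed.

Lemma test_functionD f g : test_function Omega f -> test_function Omega g ->
  test_function Omega (fun x => f x + g x).
Proof.
move=> [sf [K [cK KO fK]]] [sg [L [cL LO gL]]]; split.
  move=> k; apply: (@Ck_on_cover setT setT); first by left.
    by apply: Ck_onD; [exact: openT|exact: Ck_CkT..].
  by apply: Ck_onD; [exact: openT|exact: Ck_CkT..].
exists (K `|` L); split; first exact: compactU.
  by move=> x [/KO|/LO].
by move=> x /not_orP[/fK -> /gL ->]; rewrite addr0.
Qed.

Lemma test_functionZ (c : R) f : test_function Omega f ->
  test_function Omega (fun x => c * f x).
Proof.
by apply: (@test_functionM setT) => //; [exact: openT|exact/smooth_on_cst/openT].
Qed.

Lemma test_function0 : test_function Omega (fun=> 0).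
Proof.
split; last by exists set0; split => //; exact: compact0.
move=> k; apply: (@Ck_on_cover setT setT); first by left.
  exact/Ck_on_cst/openT.
exact/Ck_on_cst/openT.
Qed.

Lemma test_function_bounded f : test_function Omega f ->
  exists2 M, 0 <= M & forall x, `|f x| <= M.
Proof.
move=> [sf [K [cK KO fK]]].
have [K0|/set0P K0] := eqVneq K set0.
  by exists 0 => // x; rewrite fK ?normr0// K0.
have [x Kx xM] : exists2 x, K x & forall y, K y -> `|f y| <= `|f x|.
  have [|x xK xM] := @compact_EVT_max _ R (fun x => `|f x|) K K0 cK.
    apply: continuous_subspaceT => x; apply: continuous_comp.
      exact: smooth_continuous.
    exact: norm_continuous.
  by exists x => [|y Ky]; [exact: set_mem|apply: xM; exact: mem_set].
exists `|f x| => // y; have [/xM//|/fK ->] := pselect (K y).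
by rewrite normr0.
Qed.

End test_functions.

Lemma segment_mean_value f x h : smooth f ->
  exists c : R, f (x + h) - f x = 'D_h f (c *: h + x).
Proof.
move=> sf.
have df (s : R) : is_derive s 1 (fun s : R => f (s *: h + x)) ('D_h f (s *: h + x)).
  have dd : derivable f (s *: h + x) h.
    exact/diff_derivable/smooth_differentiable.
  have E : (fun e : R => e^-1 *: (((fun s : R => f (s *: h + x)) \o shift s) (e *: (1 : R)) - f (s *: h + x)))
      = (fun e => e^-1 *: ((f \o shift (s *: h + x)) (e *: h) - f (s *: h + x))).
    apply/funext => e /=; congr (_ *: (f _ - _)).
    by rewrite [e *: 1]mulr1 scalerDl addrA.
  by apply: DeriveDef; [rewrite /derivable E|rewrite /derive E].
have cf : {within `[0, 1], continuous (fun s : R => f (s *: h + x))}.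
  apply: continuous_subspaceT => s.
  by apply/differentiable_continuous/derivable1_diffP; case: (df s).
have [c _ E] := MVT_segment ler01 (fun s _ => df s) cf.
exists c; move: E; rewrite scale1r scale0r add0r subr0 mulr1 => <-.
by rewrite [x + h]addrC.
Qed.

End calculus.

Section half_space_calculus.
Context (R : realType) (m : nat).

Lemma open_half_space : open (@half_space R m).
Proof.
have := @continuousP _ _ (@xlast R m); rewrite /half_space => -[+ _].
move=> /(_ (@coord_continuous _ _ _ _ _))/(_ _ (@open_gt _ 0)).
by [].
Qed.

Lemma differentiable_xlast_powR (s : R) (x : 'rV[R]_m.+1) : half_space x ->
  differentiable (fun y => xlast y `^ s) x.
Proof.
move=> x0.
apply: (@differentiable_comp _ _ _ _ (@xlast R m) (fun r => r `^ s)).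
  exact: differentiable_coord.
by apply/derivable1_diffP/derivable_powR; rewrite in_itv/= andbT.
Qed.

Lemma partial_xlast_powR (s : R) (x : 'rV[R]_m.+1) i : half_space x ->
  partial i (fun y => xlast y `^ s) x = (i == ord_max)%:R * (s * xlast x `^ (s - 1)).
Proof.
move=> x0; rewrite /partial deriveE; last exact: differentiable_xlast_powR.
have dp : differentiable (fun r : R => r `^ s) (xlast x).
  by apply/derivable1_diffP/derivable_powR; rewrite in_itv/= andbT.
rewrite (@diff_comp _ _ _ _ (@xlast R m) (fun r => r `^ s))//; last first.
  exact: differentiable_coord.
rewrite /= -(deriveE _ (differentiable_coord _ _ _)).
rewrite -[X in 'd _ _ X]/(partial i (fun y : 'rV[R]_m.+1 => y 0 ord_max) x) partial_coord.
case: (i == ord_max); last by rewrite mul0r linear0.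
rewrite mul1r -deriveE//; exact: (@derive_val _ _ _ _ _ _ _ (is_derive1_powR s x0)).
Qed.

Lemma smooth_on_xlast_powR (s : R) :
  smooth_on (@half_space R m) (fun y => xlast y `^ s).
Proof.
move=> k; elim: k s => [|k ih] s.
  by move=> x x0; exact/differentiable_continuous/differentiable_xlast_powR.
split=> [x x0|i]; first exact: differentiable_xlast_powR.
apply: Ck_on_ext (Ck_onM open_half_space
  (Ck_on_cst k ((i == ord_max)%:R * s) open_half_space) (ih (s - 1))).
  exact: open_half_space.
by move=> x x0; rewrite partial_xlast_powR// mulrA.
Qed.

End half_space_calculus.

(** * Weighted L2 spaces *)

Definition l2_pred d (T : measurableType d) (R : realType)
    (mu : {measure set T -> \bar R}) (D : set T) (mD : measurable D) :
    {pred T -> R} :=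
  mem [set f : T -> R | measurable_fun D f /\
                        mu.-integrable D (EFin \o (fun x => f x ^+ 2))].

Section l2_closed.
Context d (T : measurableType d) (R : realType)
  (mu : {measure set T -> \bar R}) (D : set T) (mD : measurable D).

Lemma integrableZ_fin (c : R) (f : T -> R) : mu.-integrable D (EFin \o f) ->
  mu.-integrable D (EFin \o (fun x => c * f x)).
Proof.
move=> fi; rewrite (_ : _ \o _ = fun x => (c%:E * (EFin \o f) x)%E)//.
exact: integrableZl.
Qed.

Lemma l2_submod_closed : submod_closed (l2_pred mu mD).
Proof.
split => [|a f g]; rewrite !inE /=.
  split; first exact: measurable_cst.
  rewrite (_ : _ \o _ = cst 0%E); first exact: integrable0.
  by apply/funext => x /=; rewrite /GRing.zero/= expr0n.
move=> [mf iff] [mg ig]; split.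
  by apply: measurable_funD => //; exact: measurable_funM.
apply: (@le_integrable _ _ _ mu _ mD _
  (EFin \o (fun x => 2 * a ^+ 2 * f x ^+ 2 + 2 * g x ^+ 2))).
- apply/measurable_EFinP/measurable_funX.
  by apply: measurable_funD => //; exact: measurable_funM.
- move=> x Dx; rewrite /= lee_fin !ger0_norm ?sqr_ge0//; last first.
    by rewrite -mulrA -exprMn addr_ge0// mulr_ge0// sqr_ge0.
  have -> : (a *: f + g) x = a * f x + g x by [].
  rewrite -subr_ge0 (_ : _ - _ = (a * f x - g x) ^+ 2) ?sqr_ge0//; ring.
- rewrite (_ : _ \o _ = (fun x => (2 * a ^+ 2)%:E * (f x ^+ 2)%:E)%E \+
    (fun x => 2%:E * (g x ^+ 2)%:E)%E)//.
  by apply: integrableD => //; exact: integrableZl.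
Qed.

HB.instance Definition _ := GRing.isSubmodClosed.Build _ _ (l2_pred mu mD)
  l2_submod_closed.

(** Square-integrable functions on D, as functions: two of them that agree almost
  everywhere are not identified. *)
Record l2 : Type := L2Fun { l2_fun :> T -> R; l2P : l2_fun \in l2_pred mu mD }.

HB.instance Definition _ := [isSub for l2_fun].
HB.instance Definition _ := [Choice of l2 by <:].
HB.instance Definition _ := [SubChoice_isSubLmodule of l2 by <:].

(** Bounded measurable functions, the multipliers of L2. *)
Record bweight : Type := BWeight {
  bw_fun :> T -> R;
  bw_measurable : measurable_fun D bw_fun;
  bw_bounded : exists M, forall x, D x -> `|bw_fun x| <= M }.

Implicit Types (f g : l2) (a : bweight).

Lemma measurable_l2 f : measurable_fun D f.
Proof. by have := l2P f; rewrite inE => -[]. Qed.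

Lemma integrable_l2_sqr f : mu.-integrable D (EFin \o (fun x => f x ^+ 2)).
Proof. by have := l2P f; rewrite inE => -[]. Qed.

Lemma l2_intro (f : T -> R) : measurable_fun D f ->
  mu.-integrable D (EFin \o (fun x => f x ^+ 2)) -> f \in l2_pred mu mD.
Proof. by move=> mf f2; rewrite inE. Qed.

Lemma integrable_bw_l2 a f g :
  mu.-integrable D (EFin \o (fun x => a x * (f x * g x))).
Proof.
have [M aM] := bw_bounded a.
apply: (@le_integrable _ _ _ mu _ mD _
  (EFin \o (fun x => M * f x ^+ 2 + M * g x ^+ 2))).
- apply/measurable_EFinP; apply: measurable_funM; first exact: bw_measurable.
  by apply: measurable_funM; exact: measurable_l2.
- move=> x Dx; rewrite /= lee_fin; have aMx := aM x Dx.
  have M0 : 0 <= M by exact: le_trans aMx.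
  rewrite [leRHS]ger0_norm; last by rewrite addr_ge0// mulr_ge0// sqr_ge0.
  rewrite normrM -mulrDr ler_pM// ler_norml !expr2; apply/andP.
  by have := sqr_ge0 (f x - g x); have := sqr_ge0 (f x + g x);
     have := sqr_ge0 (f x); have := sqr_ge0 (g x); rewrite !expr2; split; lra.
- rewrite (_ : _ \o _ = (fun x => M%:E * (f x ^+ 2)%:E)%E \+
    (fun x => M%:E * (g x ^+ 2)%:E)%E)//.
  by apply: integrableD => //; apply: integrableZl => //; exact: integrable_l2_sqr.
Qed.

(** On a domain where the weights are bounded, all the weighted L2 products are
  forms on the same space. *)
Definition wip a f g : R := \int[mu]_(x in D) (a x * (f x * g x)).

Lemma eq_wip a f g a' f' g' :
  (forall x, D x -> a x * (f x * g x) = a' x * (f' x * g' x)) ->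
  wip a f g = wip a' f' g'.
Proof. by move=> E; apply: eq_Rintegral => x /[!inE] Dx; exact: E. Qed.

Lemma l2_linE (c : R) f g x : (c *: f + g : l2) x = c * f x + g x.
Proof. by []. Qed.

Lemma l2_BE f g x : (f - g : l2) x = f x - g x.
Proof. by []. Qed.

Lemma wip_psd a : (forall x, D x -> 0 <= a x) -> psd_form (wip a).
Proof.
move=> a0; split.
- by move=> f g; apply: eq_Rintegral => x _; rewrite (mulrC (f x)).
- move=> c f g h; rewrite /wip.
  rewrite -RintegralZl//; last exact: integrable_bw_l2.
  rewrite -RintegralD//; last 2 first.
  + exact/integrableZ_fin/integrable_bw_l2.
  + exact: integrable_bw_l2.
  by apply: eq_Rintegral => x _; rewrite l2_linE; ring.
- move=> f; apply: Rintegral_ge0 => x Dx.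
  by rewrite mulr_ge0 ?a0// -expr2 sqr_ge0.
Qed.

Lemma bw1_subproof : exists M : R, forall x, D x -> `|(1 : R)| <= M.
Proof. by exists 1 => x _; rewrite normr1. Qed.

Definition bw1 : bweight := @BWeight (fun=> 1) (measurable_cst _) bw1_subproof.

Definition ip := wip bw1.

Lemma ip_psd : psd_form ip.
Proof. by apply: wip_psd => x _. Qed.

Lemma bwM_measurable a (b : bweight) : measurable_fun D (fun x => a x * b x).
Proof. by apply: measurable_funM; exact: bw_measurable. Qed.

Lemma bwM_bounded a (b : bweight) :
  exists M, forall x, D x -> `|a x * b x| <= M.
Proof.
have [M aM] := bw_bounded a; have [N bN] := bw_bounded b.
by exists (M * N) => x Dx; rewrite normrM ler_pM// ?aM ?bN.
Qed.

Definition bwM a (b : bweight) : bweight :=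
  BWeight (bwM_measurable a b) (bwM_bounded a b).

Lemma bwZ_measurable (c : R) a : measurable_fun D (fun x => c * a x).
Proof. by apply: measurable_funM => //; exact: bw_measurable. Qed.

Lemma bwZ_bounded (c : R) a : exists M, forall x, D x -> `|c * a x| <= M.
Proof.
have [M aM] := bw_bounded a.
by exists (`|c| * M) => x Dx; rewrite normrM ler_wpM2l// aM.
Qed.

Definition bwZ (c : R) a : bweight := BWeight (bwZ_measurable c a) (bwZ_bounded c a).

Lemma l2mul_subproof a f : (fun x => a x * f x) \in l2_pred mu mD.
Proof.
apply: l2_intro.
  by apply: measurable_funM; [exact: bw_measurable|exact: measurable_l2].
rewrite (_ : _ \o _ = EFin \o (fun x => bwM a a x * (f x * f x))).
  exact: integrable_bw_l2.
by apply/funext => x /=; congr EFin; ring.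
Qed.

Definition l2mul a f : l2 := L2Fun (l2mul_subproof a f).

Lemma l2mulB a f g : l2mul a (f - g) = l2mul a f - l2mul a g.
Proof. by apply/val_inj/funext => x; exact: mulrBr. Qed.

Lemma l2mul_bounded a : exists2 C, 0 <= C & forall f, ip (l2mul a f) (l2mul a f) <= C * ip f f.
Proof.
have [M aM] := bw_bounded a; exists (M ^+ 2); first exact: sqr_ge0.
move=> f; rewrite /ip /wip -RintegralZl//; last exact: (integrable_bw_l2 bw1).
apply: le_Rintegral => //; first exact: (integrable_bw_l2 bw1).
  exact/integrableZ_fin/(integrable_bw_l2 bw1).
move=> x Dx /=; rewrite !mul1r -!expr2 exprMn ler_wpM2r ?sqr_ge0//.
by rewrite -real_normK ?num_real// ler_sqr ?nnegrE ?aM// (le_trans _ (aM _ Dx)).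
Qed.

Lemma EFin_wip a f g :
  (wip a f g)%:E = (\int[mu]_(x in D) (a x * (f x * g x))%:E)%E.
Proof.
by rewrite /wip fineK// integrable_fin_num//; exact: integrable_bw_l2.
Qed.

(** Riesz-Fischer: a subsequence with geometrically decreasing increments
  converges almost everywhere, and Fatou's lemma identifies its limit. *)
Lemma l2_complete (u : nat -> l2) :
  (forall eps : R, 0 < eps -> exists N, forall m l, (N <= m)%N -> (N <= l)%N ->
    ip (u m - u l) (u m - u l) < eps) ->
  exists w : l2, forall eps : R, 0 < eps -> exists N, forall m, (N <= m)%N ->
    ip (u m - w) (u m - w) < eps.
Proof.
move=> cu.
(* With increments of squared norm at most 8^-j, the weights 4^j leave a convergent
   series G of integrals, and finiteness of G x bounds the j-th increment at x by a
   multiple of 2^-j. *)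
have c8 j : (0 : R) < 8^-1 ^+ j by rewrite exprn_gt0// invr_gt0.
pose Nj j := sval (cid (cu _ (c8 j))).
have NjP j m l : (Nj j <= m)%N -> (Nj j <= l)%N ->
    ip (u m - u l) (u m - u l) < 8^-1 ^+ j.
  by rewrite /Nj; case: cid => N /= NP; exact: NP.
pose k j := (\sum_(i < j.+1) Nj i)%N.
have Nk i j : (i <= j)%N -> (Nj i <= k j)%N.
  move=> ij; rewrite /k (bigD1 (Ordinal (ij : (i < j.+1)%N)))//=.
  exact: leq_addr.
pose dd j x := u (k j.+1) x - u (k j) x.
have mdd j : measurable_fun D (dd j).
  by apply: measurable_funB; exact: measurable_l2.
pose h j x := (4 ^+ j * dd j x ^+ 2)%:E.
have mh j : measurable_fun D (h j).
  by apply/measurable_EFinP; apply: measurable_funM => //; exact: measurable_funX.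
have h0 j x : D x -> (0 <= h j x)%E.
  by move=> _; rewrite lee_fin; apply: mulr_ge0; [exact: exprn_ge0|exact: sqr_ge0].
pose G x := (\sum_(0 <= j <oo) h j x)%E.
have mG : measurable_fun D G.
  by apply: ge0_emeasurable_sum => // i x Dx _; exact: h0.
have ih j : (\int[mu]_(x in D) h j x <= ((1 / 2) ^+ j)%:E)%E.
  have -> : (\int[mu]_(x in D) h j x =
      (4 ^+ j * ip (u (k j.+1) - u (k j)) (u (k j.+1) - u (k j)))%:E)%E.
    rewrite EFinM EFin_wip -ge0_integralZl//; last 2 first.
    - by apply/measurable_EFinP; apply/measurable_EFinP/measurable_int/integrable_bw_l2.
    - by move=> x Dx; rewrite lee_fin mul1r -expr2 sqr_ge0.
    apply: eq_integral => x _; rewrite -EFinM /h /dd; congr EFin.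
    by rewrite mul1r -expr2 l2_BE.
  rewrite lee_fin (_ : (1 / 2) ^+ j = 4 ^+ j * 8^-1 ^+ j); last first.
    by rewrite -exprMn; congr (_ ^+ _); field.
  rewrite ler_wpM2l ?exprn_ge0//; apply/ltW/NjP; apply: Nk => //.
have iG : (\int[mu]_(x in D) G x < +oo)%E.
  rewrite integral_nneseries//.
  apply: (@le_lt_trans _ _ (\sum_(0 <= j <oo) ((1 / 2) ^+ j)%:E)%E).
    apply: lee_nneseries => // i _ _; apply: integral_ge0 => x Dx; exact: h0.
  have cg : cvgn (series (geometric 1 (1 / 2 : R))).
    by apply: is_cvg_geometric_series; rewrite ger0_norm; lra.
  rewrite (_ : limn _ = (limn (series (geometric 1 (1 / 2 : R))))%:E) ?ltry//.
  rewrite -EFin_lim//; congr (limn _); apply/funext => n /=.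
  rewrite -sumEFin; apply: eq_bigr => i _; congr EFin.
  by rewrite /geometric/= [RHS]mul1r.
have Gfin : {ae mu, forall x, D x -> G x \is a fin_num}.
  apply: integrable_ae => //; apply/integrableP; split => //.
  suff -> : (\int[mu]_(x in D) `|G x| = \int[mu]_(x in D) G x)%E by exact: iG.
  apply: eq_integral => x /[!inE] Dx; rewrite gee0_abs//.
  by apply: nneseries_ge0 => i _ _; exact: h0.
pose w x := fine (limn_esup (fun j => (u (k j) x)%:E)).
have mw : measurable_fun D w.
  apply: measurableT_comp; first exact: fine_measurable.
  by apply: measurable_fun_limn_esup => n; apply/measurable_EFinP/measurable_l2.
have cvw x : D x -> G x \is a fin_num -> (fun j => u (k j) x) @ \oo --> w x.
  move=> Dx Gx.
  have dG j : `|dd j x| <= Num.sqrt (fine (G x)) * (1 / 2) ^+ j.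
    rewrite -(@ler_pM2r _ (2 ^+ j)) ?exprn_gt0// -mulrA -exprMn.
    rewrite mulfVK//= expr1n mulr1.
    rewrite -[leLHS]ger0_norm ?mulr_ge0 ?exprn_ge0// -sqrtr_sqr ler_wsqrtr//.
    rewrite exprMn -exprM mulnC exprM real_normK ?num_real//.
    rewrite (_ : 2 ^+ 2 = 4 :> R); last by rewrite expr2; lra.
    rewrite -lee_fin fineK// mulrC.
    apply: le_trans (nneseries_lim_ge (m := 0) j.+1 _); last first.
      by move=> n _ _; exact: h0.
    rewrite big_nat_recr//= leeDr//; apply: sume_ge0 => i _; exact: h0.
  have cs : cvgn (series (fun j => dd j x)).
    apply: normed_cvg; set a := Num.sqrt _ in dG.
    have g0 n : 0 <= geometric a (1 / 2) n.
      by rewrite /geometric/= mulr_ge0 ?sqrtr_ge0// exprn_ge0.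
    apply: (series_le_cvg _ g0 dG) => //.
    by apply: is_cvg_geometric_series; rewrite ger0_norm; lra.
  have cu' : cvgn (fun j => u (k j) x).
    have -> : (fun j => u (k j) x) = (fun j => u (k 0%N) x + series (fun j => dd j x) j).
      apply/funext => j; rewrite /series /= /dd telescope_sumr// addrC subrK//.
    exact: is_cvgD (is_cvg_cst _) cs.
  have cuE : (fun j => (u (k j) x)%:E) @ \oo --> (limn (fun j => u (k j) x))%:E.
    by apply/cvg_EFin; [exact: nearW|exact: cu'].
  by rewrite /w (cvg_limn_einf_sup cuE).2.
have fat J m : (Nj J <= m)%N ->
    (\int[mu]_(x in D) ((u m x - w x) ^+ 2)%:E <= (8^-1 ^+ J)%:E)%E.
  move=> Jm.
  pose F j x := ((u m x - u (k j) x) ^+ 2)%:E.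
  have mF j : measurable_fun D (F j).
    apply/measurable_EFinP/measurable_funX/measurable_funB; exact: measurable_l2.
  have E : (\int[mu]_(x in D) ((u m x - w x) ^+ 2)%:E =
     \int[mu]_(x in D) limn_einf (F ^~ x))%E.
    apply: ae_eq_integral => //.
    - apply/measurable_EFinP/measurable_funX/measurable_funB => //.
      exact: measurable_l2.
    - apply: measurableT_comp => //; apply: measurable_fun_limn_esup => n.
      exact: measurableT_comp.
    - apply: filterS Gfin => x Gx Dx.
      have cF : F ^~ x @ \oo --> ((u m x - w x) ^+ 2)%:E.
        apply/cvg_EFin; first by apply: nearW.
        have cx := cvw _ Dx (Gx Dx).
        apply: (@cvg_trans _ ((fun j => (u m x - u (k j) x) * (u m x - u (k j) x)) @ \oo)).
          exact: cvg_refl.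
        by apply: cvgM; apply: cvgB => //; exact: cvg_cst.
      by rewrite (cvg_limn_einf_sup cF).1.
  rewrite E; apply: (le_trans (fatou _ _ _ _)) => //.
    by move=> n x Dx; rewrite lee_fin sqr_ge0.
  rewrite limn_einf_lim; apply: lime_le; first exact: is_cvg_einfs.
  exists J => // n Jn /=.
  apply: (@le_trans _ _ (\int[mu]_(x in D) F n x)%E).
    by apply: ereal_inf_lbound; exists n => /=.
  have -> : (\int[mu]_(x in D) F n x = (ip (u m - u (k n)) (u m - u (k n)))%:E)%E.
    rewrite EFin_wip; apply: eq_integral => x _; rewrite /F; congr EFin.
    by rewrite mul1r -expr2 l2_BE.
  by rewrite lee_fin; apply/ltW/NjP => //; exact: Nk.
have vl2 : (fun x => u (Nj 0%N) x - w x) \in l2_pred mu mD.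
  apply: l2_intro; first by apply: measurable_funB => //; exact: measurable_l2.
  apply/integrableP; split.
    apply/measurable_EFinP/measurable_funX/measurable_funB => //.
    exact: measurable_l2.
  apply: le_lt_trans (ltry (8^-1 ^+ 0%N)).
  rewrite (eq_integral (fun x => ((u (Nj 0%N) x - w x) ^+ 2)%:E)) ?fat//.
  by move=> x _ /=; rewrite ger0_norm// sqr_ge0.
have wl2 : w \in l2_pred mu mD.
  rewrite (_ : w = (u (Nj 0%N) - L2Fun vl2 : l2)); first exact: l2P.
  by apply/funext => x; rewrite l2_BE /= opprB addrC subrK.
exists (L2Fun wl2) => eps e0.
have [J JP] : exists J : nat, (8^-1 ^+ J : R) < eps.
  have : (fun n => (8^-1 : R) ^+ n) @ \oo --> 0.
    by apply: cvg_expr; rewrite ger0_norm ?invr_ge0// invf_lt1// ltr1n.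
  move=> /cvgr0Pnorm_lt/(_ _ e0)[J _ /(_ J (leqnn J))] /=.
  by rewrite ger0_norm ?exprn_ge0 ?invr_ge0// => JP; exists J.
exists (Nj J) => m Jm; apply: le_lt_trans JP.
rewrite -lee_fin EFin_wip; apply: le_trans (fat _ _ Jm).
rewrite le_eqVlt; apply/orP; left; apply/eqP.
by apply: eq_integral => x _; rewrite /= mul1r -expr2.
Qed.

End l2_closed.

(** * Difference quotients and a Poincare inequality on cubes *)

Lemma sqr_sum_le (R : realFieldType) (I : finType) (a : I -> R) :
  (\sum_i a i) ^+ 2 <= #|I|%:R * \sum_i a i ^+ 2.
Proof.
have : 0 <= \sum_i \sum_j (a i - a j) ^+ 2.
  by apply: sumr_ge0 => i _; apply: sumr_ge0 => j _; exact: sqr_ge0.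
set A := \sum_i a i ^+ 2; set S := \sum_i a i.
have -> : \sum_i \sum_j (a i - a j) ^+ 2 = \sum_i (#|I|%:R * a i ^+ 2 - 2 * S * a i + A).
  apply: eq_bigr => i _.
  transitivity (\sum_j (a i ^+ 2 - 2 * a i * a j + a j ^+ 2)).
    by apply: eq_bigr => j _; ring.
  have E : \sum_j 2 * a i * a j = 2 * S * a i by rewrite -mulr_sumr -/S; ring.
  by rewrite big_split/= sumrB E sumr_const [#|I|%:R * _]mulr_natl.
rewrite big_split/= sumrB sumr_const -!mulr_sumr -/A -/S -mulr_natl expr2; lra.
Qed.

Lemma coord_le_norm (R : realType) n (x : 'rV[R]_n) i : `|x 0 i| <= `|x|.
Proof.
apply/ler_addgt0Pr => e e0.
have r0 : 0 < `|x| + e by rewrite ltr_wpDl.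
have : ball 0 (`|x| + e) x by rewrite -ball_normE /ball_/= sub0r normrN ltrDl.
by rewrite ball_rVE// => /(_ i); rewrite mxE sub0r normrN => /ltW.
Qed.

Lemma integral_shift_rV (R : realType) n (a : 'rV[R]_n) (f : 'rV[R]_n -> \bar R) :
  measurable_fun setT f ->
  (\int[@lebesgue_rV R n]_x f (x + a)%R = \int[@lebesgue_rV R n]_x f x)%E.
Proof.
move=> mf; rewrite integralE [RHS]integralE; congr (_ - _)%E.
  transitivity (\int[@lebesgue_rV R n]_x (f^\+ (x + a)%R))%E; first by apply: eq_integral => y _; rewrite !funeposE.
  by rewrite ge0_integral_shift_rV//; exact: measurable_funepos.
transitivity (\int[@lebesgue_rV R n]_x (f^\- (x + a)%R))%E; first by apply: eq_integral => y _; rewrite !funenegE.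
by rewrite ge0_integral_shift_rV//; exact: measurable_funeneg.
Qed.

Section difference_quotients.
Context (R : realType) (n : nat) (Omega : set 'rV[R]_n).
Implicit Types (f : 'rV[R]_n -> R) (h x : 'rV[R]_n).
Local Notation leb := (@lebesgue_rV R n).

Lemma test_function_measurable f :
  test_function Omega f -> measurable_fun setT f.
Proof. by move=> [/smooth_continuous cf _]; exact: continuous_measurable_rV. Qed.

Lemma test_function_sum (I : Type) (r : seq I) (F : I -> 'rV[R]_n -> R) :
  (forall i, test_function Omega (F i)) ->
  test_function Omega (fun x => \sum_(i <- r) F i x).
Proof.
move=> tF; elim: r => [|i r ih].
  by under eq_fun do rewrite big_nil; exact: test_function0.
under eq_fun do rewrite big_cons.
exact: test_functionD.
Qed.

Lemma test_function_derive f h :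
  test_function Omega f -> test_function Omega (fun x => 'D_h f x).
Proof.
move=> tf.
rewrite (_ : (fun x => _) = (fun x => \sum_i h 0 i * partial i f x)); last first.
  apply/funext => x; rewrite derive_partial//.
  by case: tf => sf _; exact: smooth_differentiable.
by apply: test_function_sum => i; exact/test_functionZ/test_function_partial.
Qed.

(** One box serves all the difference quotients of f along h, as dominated
  convergence requires. *)
Lemma test_function_box f h : test_function Omega f ->
  exists a b : 'rV[R]_n, (forall i, a 0 i <= b 0 i) /\
    forall x (s : R), 0 <= s <= 1 -> ~ box a b x -> f (x + s *: h) = 0.
Proof.
move=> [sf [K [cK KO fK]]].
have [M [Mr KM]] := compact_bounded cK.
have M1 : M < `|M| + 1 by rewrite (le_lt_trans (ler_norm M))// ltrDl.
have {}KM x : K x -> `|x| <= `|M| + 1 by exact: KM.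
pose C := `|M| + 1 + `|h| + 1.
have C0 : 0 <= C by rewrite /C !addr_ge0.
exists (\row_i - C), (\row_i C); split => [i|x s /andP[s0 s1] xab].
  by rewrite !mxE; lra.
apply: fK => Kx; apply: xab => i; rewrite !mxE.
have : `|x 0 i| < C.
  have -> : x 0 i = (x + s *: h) 0 i - s * h 0 i by rewrite !mxE addrK.
  apply: (le_lt_trans (ler_normB _ _)); rewrite /C ltr_pwDr// lerD//.
    exact: (le_trans (coord_le_norm _ _) (KM _ Kx)).
  rewrite normrM ger0_norm// (le_trans _ (coord_le_norm h i))//.
  by rewrite ler_piMl.
by rewrite ltr_norml => /andP[/ltW -> ->].
Qed.

Lemma integrable_indic_box (C : R) (a b : 'rV[R]_n) : (forall i, a 0 i <= b 0 i) ->
  leb.-integrable setT (EFin \o (fun x => C * \1_(box a b) x)).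
Proof.
move=> ab; rewrite (_ : _ \o _ = fun x => (C%:E * (EFin \o \1_(box a b)) x)%E)//.
apply: integrableZl => //; apply/integrableP; split.
  by apply/measurable_EFinP; apply: measurable_indic; exact: measurable_box.
under eq_integral do rewrite /= ger0_norm//.
rewrite integral_indic//; last exact: measurable_box.
by rewrite setIT [X in (X < _)%E](lebesgue_rV_box ab) ltry.
Qed.

Lemma test_function_integrable f :
  test_function Omega f -> leb.-integrable setT (EFin \o f).
Proof.
move=> tf; have [a [b [ab fab]]] := test_function_box 0 tf.
have [M M0 fM] := test_function_bounded tf.
apply: (le_integrable _ _ _ (integrable_indic_box M ab)) => //.
  by apply/measurable_EFinP; exact: test_function_measurable.
move=> x _ /=; rewrite lee_fin indicE.
have [xab|xab] := pselect (box a b x).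
  by rewrite mem_set// mulr1 (ger0_norm M0) fM.
have := fab x 0; rewrite lexx ler01 scale0r addr0 => -> //.
by rewrite normr0.
Qed.

Definition diff_quot f h (N : nat) x : R :=
  N.+1%:R * (f (x + N.+1%:R^-1 *: h) - f x).

Lemma cvg_harmonic_dnbhs : (fun N : nat => N.+1%:R^-1 : R) @ \oo --> (0 : R)^'.
Proof.
move=> A A0.
have H : \forall N \near \oo, @harmonic R N != 0 -> A (harmonic N).
  exact: (@cvg_harmonic R _ A0).
apply: (@filterS _ \oo _ _ _ _ H) => N /=; apply.
by rewrite invr_neq0// pnatr_eq0.
Qed.

Lemma diff_quot_cvg f h x : smooth f ->
  (fun N => diff_quot f h N x) @ \oo --> 'D_h f x.
Proof.
move=> sf.
have df : derivable f x h by exact/diff_derivable/smooth_differentiable.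
have := cvg_comp _ _ cvg_harmonic_dnbhs df; rewrite /derive.
apply: cvg_trans; apply: near_eq_cvg; near=> N.
rewrite /= /diff_quot invrK [x + _]addrC.
by [].
Unshelve. all: by end_near. Qed.

Lemma diff_quot_bounded f h : test_function Omega f ->
  exists C (a b : 'rV[R]_n), [/\ 0 <= C, forall i, a 0 i <= b 0 i &
    forall N x, `|diff_quot f h N x| <= C * \1_(box a b) x].
Proof.
move=> tf; have [a [b [ab fab]]] := test_function_box h tf.
have [C C0 fC] := test_function_bounded (test_function_derive h tf).
exists C, a, b; split => // N x; rewrite indicE.
have [xab|xab] := pselect (box a b x); last first.
  rewrite /diff_quot fab//; last first.
    by rewrite invr_ge0 ler0n/= invf_le1 ?ler1n.
  have := fab x 0; rewrite lexx ler01 scale0r addr0 => -> //.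
  by rewrite subr0 mulr0 normr0 mulr_ge0.
rewrite mem_set// mulr1 /diff_quot.
have [sf _] := tf.
have [c ->] := segment_mean_value x (N.+1%:R^-1 *: h) sf.
rewrite derive_partial; last exact: smooth_differentiable.
under eq_bigr do rewrite mxE -mulrA.
rewrite -mulr_sumr -derive_partial; last exact: smooth_differentiable.
by rewrite mulrA mulfV ?mul1r ?pnatr_eq0.
Qed.

Lemma measurable_diff_quot f h N : test_function Omega f ->
  measurable_fun setT (diff_quot f h N).
Proof.
move=> tf; have mf := test_function_measurable tf.
apply: measurable_funM => //; apply: measurable_funB => //.
exact: (measurableT_comp mf (measurable_shift_rV _)).
Qed.

(** Translation invariance replaces the fundamental theorem of calculus: the
  difference quotients have integral zero, are dominated, and converge to the
  derivative. *)
Lemma integral_derive_test f h : test_function Omega f ->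
  (\int[leb]_x ('D_h f x)%:E = 0)%E.
Proof.
move=> tf; have [C [a [b [C0 ab dC]]]] := diff_quot_bounded h tf.
have [|||||_ _ cv] := @dominated_convergence _ _ _ leb setT measurableT
  (fun N => EFin \o diff_quot f h N) (fun x => ('D_h f x)%:E)
  (EFin \o (fun x => C * \1_(box a b) x)).
- by move=> N; apply/measurable_EFinP; exact: measurable_diff_quot.
- apply/measurable_EFinP; apply: test_function_measurable.
  exact: test_function_derive.
- apply: nearW => x _; apply/cvg_EFin; first exact: nearW.
  by apply: diff_quot_cvg; case: tf.
- exact: integrable_indic_box.
- by apply: nearW => x N _; rewrite lee_fin.
have E N : (\int[leb]_x (EFin \o diff_quot f h N) x = 0)%E.
  rewrite /diff_quot.
  have i1 : leb.-integrable setT (EFin \o (fun x => f (x + N.+1%:R^-1 *: h))).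
    have if' := test_function_integrable tf.
    apply/integrableP; split.
      apply/measurable_EFinP.
      exact: (measurableT_comp (test_function_measurable tf) (measurable_shift_rV _)).
    move/integrableP : if' => [_]; rewrite -(integral_shift_rV (N.+1%:R^-1 *: h))//.
    apply/measurableT_comp => //.
    by apply/measurable_EFinP; exact: test_function_measurable.
  rewrite (eq_integral (fun x => N.+1%:R%:E * ((f (x + N.+1%:R^-1 *: h))%:E - (f x)%:E))%E)//.
  rewrite integralZl//; last exact: (integrableB _ i1 (test_function_integrable tf)).
  rewrite (integralB _ i1 (test_function_integrable tf))//.
  rewrite (@integral_shift_rV _ _ (N.+1%:R^-1 *: h) (EFin \o f)); last first.
    by apply/measurable_EFinP; exact: test_function_measurable.
  rewrite subee ?mule0//; apply: integrable_fin_num => //.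
  exact: test_function_integrable.
apply/esym/(cvg_unique _ _ cv) => //.
rewrite (_ : [sequence _]_N = cst 0%E); first exact: cvg_cst.
by apply/funext => N; exact: E.
Qed.

(** The increments of f along h are averages of its difference quotients at
  arbitrarily small scales, which converge to the directional derivative. *)
Lemma shift_sqr_le f h : test_function Omega f ->
  (\int[leb]_x ((f (x + h) - f x) ^+ 2)%:E <= \int[leb]_x (('D_h f x) ^+ 2)%:E)%E.
Proof.
move=> tf; have [C [a [b [C0 ab dC]]]] := diff_quot_bounded h tf.
have mf := test_function_measurable tf.
have [|||||_ _ cv] := @dominated_convergence _ _ _ leb setT measurableT
  (fun N => EFin \o (fun x => diff_quot f h N x ^+ 2)) (fun x => ('D_h f x ^+ 2)%:E)
  (EFin \o (fun x => C ^+ 2 * \1_(box a b) x)).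
- move=> N; apply/measurable_EFinP/measurable_funX.
  exact: measurable_diff_quot.
- apply/measurable_EFinP/measurable_funX; apply: test_function_measurable.
  exact: test_function_derive.
- apply: nearW => x _; apply/cvg_EFin; first exact: nearW.
  have cd : (fun N => diff_quot f h N x) @ \oo --> 'D_h f x.
    by apply: diff_quot_cvg; case: tf.
  exact: (cvgM cd cd).
- exact: integrable_indic_box.
- apply: nearW => x N _; rewrite lee_fin ger0_norm ?sqr_ge0//.
  rewrite -real_normK ?num_real//.
  have -> : C ^+ 2 * \1_(box a b) x = (C * \1_(box a b) x) ^+ 2.
    by rewrite exprMn indicE; case: (_ \in _); rewrite ?expr1n ?expr0n.
  by rewrite ler_sqr ?nnegrE// (le_trans _ (dC N x)).
apply: (cvge_to_ge cv); apply: nearW => N /=.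
pose s := N.+1%:R^-1 : R.
pose g x := f (x + s *: h) - f x.
have mg : measurable_fun setT g.
  by apply: measurable_funB => //; exact: (measurableT_comp mf (measurable_shift_rV _)).
have gE (l : nat) x : f (x + (l.+1%:R * s) *: h) - f (x + (l%:R * s) *: h) =
    g (x + (l%:R * s) *: h).
  by rewrite /g -addrA -scalerDl -natr1 mulrDl mul1r.
have step x : (f (x + h) - f x) ^+ 2 <=
    \sum_(l < N.+1) N.+1%:R * g (x + (l%:R * s) *: h) ^+ 2.
  have -> : f (x + h) - f x = \sum_(l < N.+1) g (x + (l%:R * s) *: h).
    under eq_bigr do rewrite -gE.
    rewrite -(big_mkord xpredT (fun l => f (x + (l.+1%:R * s) *: h) - f (x + (l%:R * s) *: h))).
    rewrite telescope_sumr// mulfV ?pnatr_eq0// scale1r mul0r scale0r addr0//.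
  by apply: (le_trans (sqr_sum_le _)); rewrite card_ord mulr_sumr.
have mgl (l : nat) : measurable_fun setT (fun x => (N.+1%:R * g (x + (l%:R * s) *: h) ^+ 2)%:E).
  apply/measurable_EFinP/measurable_funM => //; apply: measurable_funX.
  exact: (measurableT_comp mg (measurable_shift_rV _)).
apply: (@le_trans _ _ (\int[leb]_x \sum_(l < N.+1) (N.+1%:R * g (x + (l%:R * s) *: h) ^+ 2)%:E)%E).
  apply: ge0_le_integral => //.
  - by move=> x _; rewrite lee_fin sqr_ge0.
  - apply/measurable_EFinP/measurable_funX/measurable_funB => //.
    exact: (measurableT_comp mf (measurable_shift_rV _)).
  - by apply: emeasurable_sum => l; exact: mgl.
  - by move=> x _; rewrite sumEFin lee_fin.
rewrite ge0_integral_sum//; last by move=> l x _; rewrite lee_fin mulr_ge0// sqr_ge0.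
under eq_bigr => l _.
  rewrite (@integral_shift_rV _ _ ((l%:R * s) *: h) (fun x => (N.+1%:R * g x ^+ 2)%:E)); last first.
    by apply/measurable_EFinP/measurable_funM => //; exact: measurable_funX.
  over.
rewrite big_const_ord iter_addr_0.
have -> : (fun x => (diff_quot f h N x ^+ 2)%:E) =
    (fun x => N.+1%:R%:E * (N.+1%:R * g x ^+ 2)%:E)%E.
  apply/funext => x; rewrite -EFinM /diff_quot -/s; congr EFin.
  by rewrite exprMn [N.+1%:R ^+ 2]expr2 -mulrA.
rewrite ge0_integralZl//; last 2 first.
- by apply/measurable_EFinP/measurable_funM => //; exact: measurable_funX.
- by move=> x _; rewrite lee_fin mulr_ge0// sqr_ge0.
by rewrite mule_natl.
Qed.

Lemma derive_sqr_le f h x (delta : R) : smooth f -> 0 <= delta ->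
  (forall i, `|h 0 i| <= delta) ->
  'D_h f x ^+ 2 <= n%:R * delta ^+ 2 * \sum_i partial i f x ^+ 2.
Proof.
move=> sf d0 hd; rewrite derive_partial; last exact: smooth_differentiable.
apply: (le_trans (sqr_sum_le _)); rewrite card_ord -mulrA ler_wpM2l//.
rewrite mulr_sumr ler_sum// => i _; rewrite exprMn ler_wpM2r ?sqr_ge0//.
by rewrite -real_normK ?num_real// ler_sqr ?nnegrE.
Qed.

End difference_quotients.

Section variance.
Context d (T : measurableType d) (R : realType)
  (mu : {measure set T -> \bar R}) (Q : set T) (mQ : measurable Q) (c : R)
  (Qc : mu Q = c%:E) (f : T -> R)
  (fi : mu.-integrable Q (EFin \o f))
  (f2i : mu.-integrable Q (EFin \o (fun x => f x ^+ 2))).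

Lemma EFin_Rintegral (g : T -> R) : mu.-integrable Q (EFin \o g) ->
  (\int[mu]_(x in Q) (g x)%:E)%E = (\int[mu]_(x in Q) g x)%:E.
Proof. by move=> gi; rewrite /Rintegral fineK// integrable_fin_num. Qed.

Let integrable_quadratic (a b e : R) :
  mu.-integrable Q (EFin \o (fun x => a * f x ^+ 2 + b * f x + e)) /\
  \int[mu]_(x in Q) (a * f x ^+ 2 + b * f x + e) =
  a * (\int[mu]_(x in Q) (f x ^+ 2)) + b * (\int[mu]_(x in Q) f x) + e * c.
Proof.
have i1 : mu.-integrable Q (EFin \o (fun x => a * f x ^+ 2)).
  rewrite (_ : _ \o _ = fun x => (a%:E * (EFin \o (fun x => f x ^+ 2)%R) x)%E)//.
  exact: integrableZl.
have i2 : mu.-integrable Q (EFin \o (fun x => b * f x)).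
  rewrite (_ : _ \o _ = fun x => (b%:E * (EFin \o f) x)%E)//.
  exact: integrableZl.
have i3 : mu.-integrable Q (EFin \o (fun=> e)).
  apply/integrableP; split; first by apply/measurable_EFinP.
  under eq_integral do rewrite /=.
  by rewrite integral_cst// Qc -EFinM ltry.
have i12 : mu.-integrable Q (EFin \o (fun x => a * f x ^+ 2 + b * f x)).
  rewrite (_ : _ \o _ = (EFin \o (fun x => a * f x ^+ 2)%R) \+ (EFin \o (fun x => b * f x)%R))%E//.
  exact: integrableD.
split.
  rewrite (_ : _ \o _ = (EFin \o (fun x => (a * f x ^+ 2 + b * f x)%R)) \+ (EFin \o (fun=> e)))%E//.
  exact: integrableD.
rewrite (RintegralD mQ i12 i3) (RintegralD mQ i1 i2) (RintegralZl a mQ f2i).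
by rewrite (RintegralZl b mQ fi) Rintegral_cst// Qc.
Qed.

(** The deviation of f from its mean over Q is a double integral of increments. *)
Lemma variance_integral :
  (\int[mu]_(x in Q) \int[mu]_(y in Q) ((f x - f y) ^+ 2)%:E)%E =
  (2 * c * (\int[mu]_(x in Q) (f x ^+ 2)) - 2 * (\int[mu]_(x in Q) f x) ^+ 2)%:E.
Proof.
set S2 := \int[mu]_(x in Q) (f x ^+ 2); set S := \int[mu]_(x in Q) f x.
transitivity (\int[mu]_(x in Q) (c * f x ^+ 2 + (- 2 * S) * f x + S2)%:E)%E.
  apply: eq_integral => x _.
  have [i1 E] := integrable_quadratic 1 (- 2 * f x) (f x ^+ 2).
  rewrite (eq_integral (fun y => (1 * f y ^+ 2 + - 2 * f x * f y + f x ^+ 2)%:E)); last first.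
    by move=> y _; congr EFin; ring.
  rewrite (EFin_Rintegral i1) E -/S2 -/S; congr EFin; ring.
have [i1 E] := integrable_quadratic c (- 2 * S) S2.
rewrite (EFin_Rintegral i1) E -/S2 -/S; congr EFin; ring.
Qed.

End variance.

Section cubes.
Context (R : realType) (n : nat) (Omega : set 'rV[R]_n).
Implicit Types (x : 'rV[R]_n) (M delta : R).
Local Notation leb := (@lebesgue_rV R n).

Definition cube_corner (M delta : R) (K : nat) (z : {ffun 'I_n -> 'I_K}) : 'rV[R]_n :=
  \row_i (- M + delta * (z i)%:R).

Definition cube (M delta : R) (K : nat) (z : {ffun 'I_n -> 'I_K}) : set 'rV[R]_n :=
  box (cube_corner M delta z) (cube_corner M delta z + const_mx delta).

Lemma cubeE M delta K (z : {ffun 'I_n -> 'I_K}) x : cube M delta z x <->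
  forall i, delta * (z i)%:R <= x 0 i + M < delta * (z i).+1%:R.
Proof.
split=> H i; have /andP[h1 h2] := H i; apply/andP; move: h1 h2;
  rewrite !mxE -natr1 mulrDr mulr1; split; lra.
Qed.

Lemma lebesgue_cube M delta K (z : {ffun 'I_n -> 'I_K}) : 0 <= delta ->
  leb (cube M delta z) = (delta ^+ n)%:E.
Proof.
move=> d0; rewrite [LHS]lebesgue_rV_box; last by move=> i; rewrite !mxE lerDl.
congr EFin; under eq_bigr do rewrite !mxE [X in X - _]addrC addrK.
by rewrite prodr_const card_ord.
Qed.

Lemma trivIset_cube M delta K (D : set {ffun 'I_n -> 'I_K}) : 0 < delta ->
  trivIset D (@cube M delta K).
Proof.
move=> d0; apply/trivIsetP => z z' _ _ /eqP zz'; apply/seteqP; split => // x.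
move=> [/cubeE zx /cubeE z'x]; apply: zz'; apply/ffunP => i; apply/val_inj/eqP => /=.
have /andP[h1 h2] := zx i; have /andP[h3 h4] := z'x i.
have := le_lt_trans h1 h4; have := le_lt_trans h3 h2.
by rewrite !ltr_pM2l// !ltr_nat !ltnS eqn_leq => -> ->.
Qed.

(** Along each axis the cubes start at - M, and these suffice to reach M. *)
Lemma cube_cover M delta x : 0 < delta -> (forall i, `|x 0 i| <= M) ->
  exists z : {ffun 'I_n -> 'I_(Num.truncn (2 * M / delta)).+1}, cube M delta z x.
Proof.
move=> d0 xM.
have h0 i : 0 <= (x 0 i + M) / delta.
  by rewrite divr_ge0 ?(ltW d0)//; have := xM i; rewrite ler_norml => /andP[? ?]; lra.
have hK (i : 'I_n) : (Num.truncn ((x 0 i + M) / delta)%R < (Num.truncn (2 * M / delta)%R).+1)%N.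
  rewrite ltnS; apply: le_truncn; rewrite ler_wpM2r ?invr_ge0 ?(ltW d0)//.
  by have := xM i; rewrite ler_norml => /andP[? ?]; lra.
exists [ffun i => Ordinal (hK i)]; apply/cubeE => i; rewrite ffunE /=.
have /andP[h1 h2] := truncn_itv (h0 i).
by rewrite mulrC -ler_pdivlMr// h1 [delta * _]mulrC -ltr_pdivrMr// h2.
Qed.

(** On a cube the integral of phi^2 exceeds the squared mean by a double
  integral of increments, which translations of phi control. *)
Lemma poincare_cubes (M delta : R) (phi : 'rV[R]_n -> R) :
  0 < delta -> (forall x, Omega x -> forall i, `|x 0 i| <= M) ->
  test_function Omega phi ->
  2 * delta ^+ n * (\int[leb]_x (phi x ^+ 2)) <=
  2 * (\sum_(z : {ffun 'I_n -> 'I_(Num.truncn (2 * M / delta)).+1})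
         (\int[leb]_(x in cube M delta z) phi x) ^+ 2) +
  (2 * delta) ^+ n * (n%:R * delta ^+ 2) *
    \sum_i \int[leb]_x (partial i phi x ^+ 2).
Proof.
move=> d0 OM tphi; set K := (Num.truncn _).+1.
pose I := {ffun 'I_n -> 'I_K}; pose Q (z : I) := cube M delta z.
have mQ z : measurable (Q z) by exact: measurable_box.
(* B contains the differences of two points of the same cube. *)
pose B := box (const_mx (- delta)) (const_mx delta : 'rV[R]_n).
have mB : measurable B by exact: measurable_box.
have mphi := test_function_measurable tphi.
pose Psi x := (\int[leb]_(h in B) ((phi (h + x) - phi x) ^+ 2)%:E)%E.
pose F (p : 'rV[R]_n * 'rV[R]_n) := (\1_B p.2 * (phi (p.2 + p.1) - phi p.1) ^+ 2)%:E.
have F0 p : (0 <= F p)%E by rewrite lee_fin mulr_ge0// sqr_ge0.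
have mF : measurable_fun setT F.
  apply/measurable_EFinP/measurable_funM.
    exact: (measurableT_comp (measurable_indic mB) measurable_snd).
  apply/measurable_funX/measurable_funB; last exact: (measurableT_comp mphi measurable_fst).
  apply: (measurableT_comp mphi); apply: measurable_fun_rVP => i.
  rewrite (_ : (fun _ => _) = (fun p : 'rV[R]_n * 'rV[R]_n => p.2 0 i + p.1 0 i)); last first.
    by apply/funext => p; rewrite mxE.
  apply: measurable_funD.
    exact: (measurableT_comp (measurable_coor i) measurable_snd).
  exact: (measurableT_comp (measurable_coor i) measurable_fst).
have PsiE x : Psi x = (\int[leb]_h F (x, h))%E.
  rewrite /Psi integral_mkcond; apply: eq_integral => h _; rewrite patchE /F /=.
  by rewrite indicE; case: ifPn => hB; rewrite ?mul1r ?mul0r.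
have mPsi : measurable_fun setT Psi.
  rewrite (_ : Psi = fun x => \int[leb]_h F (x, h))%E; last by apply/funext.
  exact: (@measurable_fun_fubini_tonelli_F _ _ _ _ R leb F).
have Psi0 x : (0 <= Psi x)%E by apply: integral_ge0 => h _; rewrite lee_fin sqr_ge0.
have sqi f : test_function Omega f ->
    leb.-integrable setT (EFin \o (fun x => f x ^+ 2)).
  move=> tf; rewrite (_ : (fun x => f x ^+ 2) = (fun x => f x * f x))//.
  apply: (@test_function_integrable _ _ Omega).
  apply: (@test_functionM _ _ _ setT) => //; first exact: openT.
  by case: tf => sf _; exact: smooth_smooth_on.
pose E := \sum_i \int[leb]_x (partial i phi x ^+ 2).
have iPsi : (\int[leb]_x Psi x <= ((2 * delta) ^+ n * (n%:R * delta ^+ 2) * E)%:E)%E.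
  under eq_integral do rewrite PsiE.
  rewrite (@fubini_tonelli _ _ _ _ R leb leb F)//.
  apply: (@le_trans _ _ (\int[leb]_(h in B) (n%:R * delta ^+ 2 * E)%:E)%E); last first.
    rewrite integral_cst// [X in (_ * X)%E]lebesgue_rV_box; last first.
      by move=> i; rewrite !mxE; lra.
    rewrite -EFinM lee_fin mulrC; under eq_bigr do rewrite !mxE opprK -mulr2n.
    by rewrite prodr_const card_ord -[delta *+ 2]mulr_natl -[X in _ <= X]mulrA.
  rewrite [leRHS]integral_mkcond; apply: ge0_le_integral => //.
  - by move=> h _; exact: integral_ge0.
  - exact: (@measurable_fun_fubini_tonelli_G _ _ _ _ R leb F).
  - by apply/(measurable_restrictT _ mB); exact: measurable_cst.
  move=> h _; rewrite patchE; case: ifPn => hB; last first.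
    rewrite integral0_eq// => x _; rewrite /F /= indicE.
    by rewrite (negbTE hB) mul0r.
  have hd i : `|h 0 i| <= delta.
    by have := set_mem hB i; rewrite !mxE ler_norml => /andP[-> /ltW].
  rewrite (eq_integral (fun x => ((phi (x + h) - phi x) ^+ 2)%:E)); last first.
    by move=> x _; rewrite /F /= indicE hB mul1r [h + x]addrC.
  apply: (le_trans (shift_sqr_le h tphi)).
  apply: (@le_trans _ _ (\int[leb]_x (n%:R * delta ^+ 2 * \sum_i partial i phi x ^+ 2)%:E)%E).
    apply: ge0_le_integral => //.
    - by move=> x _; rewrite lee_fin sqr_ge0.
    - apply/measurable_EFinP/measurable_funX.
      exact: test_function_measurable (test_function_derive h tphi).
    - apply/measurable_EFinP/measurable_funM => //; apply: measurable_sum => i.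
      apply: measurable_funX.
      exact: test_function_measurable (test_function_partial i tphi).
    - move=> x _; rewrite lee_fin; apply: derive_sqr_le => //; last exact: ltW.
      by case: tphi.
  rewrite le_eqVlt; apply/orP; left; apply/eqP.
  rewrite (eq_integral (fun x => (n%:R * delta ^+ 2)%:E * \sum_i (partial i phi x ^+ 2)%:E)%E); last first.
    by move=> x _; rewrite sumEFin -EFinM.
  have mpi i : measurable_fun setT (fun x => (partial i phi x ^+ 2)%:E).
    apply/measurable_EFinP/measurable_funX.
    exact: test_function_measurable (test_function_partial i tphi).
  rewrite ge0_integralZl//; last 3 first.
  - by apply: emeasurable_sum => i; exact: mpi.
  - by move=> x _; apply: sume_ge0 => i _; rewrite lee_fin sqr_ge0.
  - by rewrite lee_fin mulr_ge0// sqr_ge0.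
  rewrite ge0_integral_sum//; last by move=> i x _; rewrite lee_fin sqr_ge0.
  rewrite [RHS]EFinM /E -sumEFin; congr (_ * _)%E; apply: eq_bigr => i _.
  by rewrite (EFin_Rintegral measurableT (sqi _ (test_function_partial i tphi))).
have cell z : (\int[leb]_(x in Q z) \int[leb]_(y in Q z) ((phi x - phi y) ^+ 2)%:E <=
    \int[leb]_(x in Q z) Psi x)%E.
  apply: ge0_le_integral => //.
  - by move=> x _; apply: integral_ge0 => y _; rewrite lee_fin sqr_ge0.
  - pose G (p : 'rV[R]_n * 'rV[R]_n) := (\1_(Q z) p.2 * (phi p.1 - phi p.2) ^+ 2)%:E.
    rewrite (_ : (fun x => _) = (fun x => \int[leb]_y G (x, y))%E); last first.
      apply/funext => x; rewrite integral_mkcond; apply: eq_integral => y _.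
      by rewrite patchE /G /= indicE; case: ifPn => _; rewrite ?mul1r ?mul0r.
    apply: measurable_funTS; apply: (@measurable_fun_fubini_tonelli_F _ _ _ _ R leb G).
      apply/measurable_EFinP/measurable_funM.
        exact: (measurableT_comp (measurable_indic (mQ z)) measurable_snd).
      apply/measurable_funX/measurable_funB.
        exact: (measurableT_comp mphi measurable_fst).
      exact: (measurableT_comp mphi measurable_snd).
    by move=> p; rewrite lee_fin mulr_ge0// sqr_ge0.
  - exact: measurable_funTS.
  move=> x Qx.
  have mQphi : measurable_fun setT ((fun y => ((phi x - phi y) ^+ 2)%:E) \_ (Q z)).
    apply/(measurable_restrictT _ (mQ z))/measurable_EFinP/measurable_funX.
    by apply: measurable_funB => //; exact: measurable_funTS.
  rewrite integral_mkcond -(integral_shift_rV x)//.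
  rewrite /Psi [leRHS]integral_mkcond; apply: ge0_le_integral => //.
  - by move=> h _; rewrite patchE; case: ifP => // _; rewrite lee_fin sqr_ge0.
  - exact: (measurableT_comp mQphi (measurable_shift_rV x)).
  - apply/(measurable_restrictT _ mB)/measurable_EFinP/measurable_funX.
    apply: measurable_funB => //; apply: measurable_funTS.
    exact: (measurableT_comp mphi (measurable_shift_rV x)).
  move=> h _; rewrite !patchE; case: ifPn => [/set_mem Qh|_]; last first.
    by case: ifP => // _; rewrite lee_fin sqr_ge0.
  rewrite mem_set ?lee_fin; first by rewrite -sqrrN opprB.
  move=> i; rewrite !mxE; have /andP[h1 h2] := iffLR (cubeE _ _ _ _) Qx i.
  have /andP[h3 h4] := iffLR (cubeE _ _ _ _) Qh i.
  move: h1 h2 h3 h4; rewrite !mxE -natr1 mulrDr mulr1 => *; apply/andP; split; lra.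
have iphi := test_function_integrable tphi; have iphi2 := sqi _ tphi.
pose S z := \int[leb]_(x in Q z) phi x; pose S2 z := \int[leb]_(x in Q z) (phi x ^+ 2).
have cellE z : ((2 * delta ^+ n * S2 z)%:E <=
    (2 * S z ^+ 2)%:E + \int[leb]_(x in Q z) Psi x)%E.
  have := cell z; rewrite (@variance_integral _ _ _ leb (Q z) (mQ z) (delta ^+ n)).
  - by move=> h; rewrite -leeBlDl// -EFinB.
  - by rewrite [LHS]lebesgue_cube// ltW.
  - exact: integrableS iphi.
  - exact: integrableS iphi2.
have cov : \int[leb]_x (phi x ^+ 2) = \sum_z S2 z.
  apply: EFin_inj; rewrite -(EFin_Rintegral measurableT iphi2) -sumEFin.
  under eq_bigr => z _.
    rewrite -(EFin_Rintegral (mQ z) (integrableS _ _ _ iphi2))//. over.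
  rewrite -ge0_integral_bigsetU//; last 4 first.
  - exact: index_enum_uniq.
  - exact: trivIset_cube.
  - by apply/measurable_EFinP/measurable_funX; exact: measurable_funTS.
  - by move=> x _; rewrite lee_fin sqr_ge0.
  rewrite [RHS]integral_mkcond; apply: eq_integral => x _; rewrite patchE.
  case: ifPn => // xD; have [px|px] := eqVneq (phi x) 0; first by rewrite px expr0n.
  case/negP: xD; apply/mem_set; rewrite -bigcup_seq.
  have [|z zx] := @cube_cover M delta x d0; last by exists z => //=; exact: mem_index_enum.
  apply: OM; case: tphi => _ [L [_ LO Lp]]; apply: LO.
  by apply: contrapT => /Lp px0; rewrite px0 eqxx in px.
have sumPsi : (\sum_(z : I) \int[leb]_(x in Q z) Psi x <= \int[leb]_x Psi x)%E.
  rewrite -ge0_integral_bigsetU//; last 3 first.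
  - exact: index_enum_uniq.
  - exact: trivIset_cube.
  - exact: measurable_funTS.
  apply: ge0_subset_integral => //.
  exact: bigsetU_measurable.
rewrite cov mulr_sumr -lee_fin -sumEFin mulr_sumr EFinD -sumEFin.
apply: (@le_trans _ _ (\sum_(z : I) ((2 * S z ^+ 2)%:E + \int[leb]_(x in Q z) Psi x))%E).
  by apply: lee_sum => z _; exact: cellE.
rewrite big_split/= leeD2l//.
exact: le_trans sumPsi iPsi.
Qed.

End cubes.

(** * The space H^1_0 and Rellich's theorem *)

Section sobolev.
Context (R : realType) (n : nat) (Omega : set 'rV[R]_n) (oO : open Omega).
Local Notation leb := (@lebesgue_rV R n).
Local Notation V2 := (l2 leb (open_measurable_rV oO)).
Local Notation weight := (bweight R Omega).

(** Pairs made of a function and a candidate for its gradient: H^1_0 becomes a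
  closed subspace of a product of L2 spaces. *)
Definition h1 : Type := (V2 * {ffun 'I_n -> V2})%type.
HB.instance Definition _ := GRing.Lmodule.on h1.

Implicit Types (v w : h1) (a : weight) (phi psi : 'rV[R]_n -> R).

Lemma h1_fstB v w : (v - w).1 = v.1 - w.1. Proof. by []. Qed.
Lemma h1_sndB v w i : (v - w).2 i = v.2 i - w.2 i.
Proof. by rewrite !ffunE. Qed.
Lemma h1_fst_lin (c : R) v w : (c *: v + w).1 = c *: v.1 + w.1. Proof. by []. Qed.
Lemma h1_snd_lin (c : R) v w i : (c *: v + w).2 i = c *: v.2 i + w.2 i.
Proof. by rewrite !ffunE. Qed.

Definition bform a v w : R := wip a v.1 w.1.
Definition eform a v w : R := \sum_i wip a (v.2 i) (w.2 i).

Lemma bform_psd a : (forall x, Omega x -> 0 <= a x) -> psd_form (bform a).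
Proof.
move=> /(@wip_psd _ _ _ leb Omega (open_measurable_rV oO) a) pa; split.
- by move=> v w; exact: (psdC pa).
- by move=> c v w z; rewrite /bform h1_fst_lin (psd_linearl pa).
- by move=> v; exact: (psd_ge0 pa).
Qed.

Lemma eform_psd a : (forall x, Omega x -> 0 <= a x) -> psd_form (eform a).
Proof.
move=> /(@wip_psd _ _ _ leb Omega (open_measurable_rV oO) a) pa; split.
- by move=> v w; apply: eq_bigr => i _; exact: (psdC pa).
- move=> c v w z; rewrite /eform mulr_sumr -big_split/=; apply: eq_bigr => i _.
  by rewrite h1_snd_lin (psd_linearl pa).
- by move=> v; apply: sumr_ge0 => i _; exact: (psd_ge0 pa).
Qed.

Definition h1dot v w : R := bform (bw1 R Omega) v w + eform (bw1 R Omega) v w.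

Lemma h1dot_psd : psd_form h1dot.
Proof.
have pb : psd_form (bform (bw1 R Omega)) by apply: bform_psd => x _ /=.
have pe : psd_form (eform (bw1 R Omega)) by apply: eform_psd => x _ /=.
split.
- by move=> v w; rewrite /h1dot (psdC pb) (psdC pe).
- by move=> c v w z; rewrite /h1dot (psd_linearl pb) (psd_linearl pe); ring.
- by move=> v; rewrite addr_ge0// ?(psd_ge0 pb) ?(psd_ge0 pe).
Qed.

Lemma eq_h1dot v w : (forall x, Omega x -> v.1 x = w.1 x) ->
  (forall i x, Omega x -> v.2 i x = w.2 i x) -> h1dot v v = h1dot w w.
Proof.
move=> E1 E2; rewrite /h1dot /bform /eform; congr (_ + _).
  by apply: eq_wip => x Ox; rewrite E1.
by apply: eq_bigr => i _; apply: eq_wip => x Ox; rewrite E2.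
Qed.

Let ipp : psd_form (@ip _ _ _ leb Omega (open_measurable_rV oO)) := ip_psd _ _.

Lemma h1dot_fst v : ip v.1 v.1 <= h1dot v v.
Proof. by rewrite /h1dot lerDl sumr_ge0// => i _; exact: (psd_ge0 ipp). Qed.

Lemma h1dot_snd v i : ip (v.2 i) (v.2 i) <= h1dot v v.
Proof.
rewrite /h1dot /eform (bigD1 i)//= addrCA lerDl addr_ge0 ?(psd_ge0 ipp)//.
by apply: sumr_ge0 => j _; exact: (psd_ge0 ipp).
Qed.

Lemma test_function_sqr phi : test_function Omega phi ->
  leb.-integrable setT (EFin \o (fun x => phi x ^+ 2)).
Proof.
move=> tf; rewrite (_ : (fun x => phi x ^+ 2) = (fun x => phi x * phi x))//.
apply: (@test_function_integrable _ _ Omega).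
apply: (@test_functionM _ _ _ setT) => //; first exact: openT.
by case: tf => sf _; exact: smooth_smooth_on.
Qed.

Lemma test_l2 phi : test_function Omega phi ->
  phi \in l2_pred leb (open_measurable_rV oO).
Proof.
move=> tf; apply: l2_intro.
  by apply: measurable_funTS; exact: test_function_measurable tf.
apply: integrableS (test_function_sqr tf) => //.
exact: open_measurable_rV.
Qed.

Definition tst phi (tphi : test_function Omega phi) : h1 :=
  (L2Fun (test_l2 tphi), [ffun i => L2Fun (test_l2 (test_function_partial i tphi))]).

Lemma tst_fst phi (tphi : test_function Omega phi) x : (tst tphi).1 x = phi x.
Proof. by []. Qed.

Lemma tst_snd phi (tphi : test_function Omega phi) i x :
  (tst tphi).2 i x = partial i phi x.
Proof. by rewrite /= ffunE. Qed.

Lemma tst_lin (c : R) phi psi (tphi : test_function Omega phi)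
    (tpsi : test_function Omega psi) :
  c *: tst tphi + tst tpsi = tst (test_functionD (test_functionZ c tphi) tpsi).
Proof.
congr pair; first exact/val_inj.
apply/ffunP => i; rewrite !ffunE; apply/val_inj/funext => x /=.
have [sphi _] := tphi; have [spsi _] := tpsi.
rewrite partialD; last 2 first.
- by apply: differentiableM; [exact: differentiable_cst|exact: smooth_differentiable].
- exact: smooth_differentiable.
rewrite partialM; [|exact: differentiable_cst|exact: smooth_differentiable].
by rewrite partial_cst mul0r add0r.
Qed.

(** The closure of the test functions, each one paired with its gradient. *)
Definition H10 v : Prop := forall eps : R, 0 < eps ->
  exists phi (tphi : test_function Omega phi), h1dot (v - tst tphi) (v - tst tphi) < eps.

Lemma H10_closed v : (forall eps : R, 0 < eps ->
  exists2 w, H10 w & h1dot (v - w) (v - w) < eps) -> H10 v.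
Proof.
move=> vc eps e0; have e4 : 0 < eps / 4 by rewrite divr_gt0.
have [w Hw vw] := vc _ e4; have [phi [tphi wphi]] := Hw _ e4.
exists phi, tphi; have -> : v - tst tphi = (v - w) + (w - tst tphi).
  by rewrite addrA subrK.
apply: (le_lt_trans (psd_normD_le h1dot_psd _ _)).
by move: (h1dot _ _) (h1dot _ _) vw wphi => x y *; lra.
Qed.

Lemma H10_tst phi (tphi : test_function Omega phi) : H10 (tst tphi).
Proof.
by move=> eps e0; exists phi, tphi; rewrite subrr psd0l//; exact: h1dot_psd.
Qed.

Lemma H10_lin (c : R) v w : H10 v -> H10 w -> H10 (c *: v + w).
Proof.
move=> Hv Hw eps e0.
have e1 : 0 < eps / (4 * (c ^+ 2 + 1)).
  by rewrite divr_gt0// mulr_gt0// ltr_wpDl ?sqr_ge0.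
have e4 : 0 < eps / 4 by rewrite divr_gt0.
have [phi [tphi vphi]] := Hv _ e1; have [psi [tpsi wpsi]] := Hw _ e4.
exists _, (test_functionD (test_functionZ c tphi) tpsi); rewrite -tst_lin.
have -> : c *: v + w - (c *: tst tphi + tst tpsi) =
    c *: (v - tst tphi) + (w - tst tpsi).
  by rewrite scalerBr opprD addrACA.
apply: (le_lt_trans (psd_normD_le h1dot_psd _ _)).
rewrite !(psdZl h1dot_psd, psdZr h1dot_psd) mulrA -expr2.
move: vphi; rewrite ltr_pdivlMr; last by rewrite mulr_gt0// ltr_wpDl ?sqr_ge0.
have := psd_ge0 h1dot_psd (v - tst tphi).
move: (h1dot _ _) (h1dot _ _) wpsi => y x hy x0 hx.
have := mulr_ge0 (sqr_ge0 c) x0; lra.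
Qed.

(** How identities pass from test functions to H10. *)
Lemma H10_vanish (L : h1 -> R) (C : R) v : 0 <= C ->
  (forall v w, L (v - w) = L v - L w) -> (forall v, L v ^+ 2 <= C * h1dot v v) ->
  (forall phi (tphi : test_function Omega phi), L (tst tphi) = 0) ->
  H10 v -> L v = 0.
Proof.
move=> C0 LB LC L0 Hv; apply/eqP; rewrite -sqrf_eq0 eq_le sqr_ge0 andbT.
apply/ler_addgt0Pr => eps e0; rewrite add0r.
have e1 : 0 < eps / (C + 1) by rewrite divr_gt0// ltr_wpDl.
have [phi [tphi vphi]] := Hv _ e1.
have -> : L v = L (v - tst tphi) by rewrite LB L0 subr0.
apply: (le_trans (LC _)); move: vphi; rewrite ltr_pdivlMr ?ltr_wpDl//.
by have := psd_ge0 h1dot_psd (v - tst tphi); move: (h1dot _ _) => x *; lra.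
Qed.

Lemma Rintegral_zero_outside (f : 'rV[R]_n -> R) :
  (forall x, ~ Omega x -> f x = 0) ->
  \int[leb]_(x in Omega) f x = \int[leb]_x f x.
Proof.
move=> f0; rewrite Rintegral_mkcond; apply: eq_Rintegral => x _.
rewrite patchE; case: ifPn => // /negP xO; rewrite f0//.
by move=> Ox; apply: xO; exact: mem_set.
Qed.

Lemma test_function_outside phi x : test_function Omega phi -> ~ Omega x -> phi x = 0.
Proof. by move=> [_ [K [_ KO fK]]] Ox; apply: fK => /KO. Qed.

(** Integration by parts, first for two test functions, then by density in
  each argument. *)
Lemma H10_ibp v w i : H10 v -> H10 w -> ip v.1 (w.2 i) + ip (v.2 i) w.1 = 0.
Proof.
have base phi (tphi : test_function Omega phi) psi (tpsi : test_function Omega psi) :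
    ip (tst tphi).1 ((tst tpsi).2 i) + ip ((tst tphi).2 i) (tst tpsi).1 = 0.
  rewrite /ip /wip -(RintegralD (open_measurable_rV oO)
    (integrable_bw_l2 _ _ _) (integrable_bw_l2 _ _ _)).
  have [sphi _] := tphi; have [spsi _] := tpsi.
  have tpp : test_function Omega (fun x => phi x * psi x).
    apply: (@test_functionM _ _ _ setT) => //; first exact: openT.
    exact: smooth_smooth_on.
  transitivity (\int[leb]_(x in Omega) ('D_(delta_mx 0 i) (fun x => phi x * psi x) x)).
    apply: eq_Rintegral => x _; rewrite !mul1r !tst_snd !tst_fst.
    rewrite -/(partial i _ x) partialM; [|exact: smooth_differentiable..].
    by rewrite addrC.
  rewrite Rintegral_zero_outside; last first.
    by move=> x; exact: (test_function_outside (test_function_derive _ tpp)).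
  by rewrite /Rintegral (integral_derive_test _ tpp).
have ipC (f g : V2) (B : R) : ip f f <= B -> ip f g ^+ 2 <= B * ip g g.
  move=> fB; apply: (le_trans (psd_CauchySchwarz ipp _ _)).
  by rewrite ler_wpM2r// (psd_ge0 ipp).
have bilin (v' : h1) : exists2 C, 0 <= C & forall w',
    (ip v'.1 (w'.2 i) + ip (v'.2 i) w'.1) ^+ 2 <= C * h1dot w' w'.
  exists (4 * h1dot v' v'); first by rewrite mulr_ge0// (psd_ge0 h1dot_psd).
  move=> w'.
  have a1 := le_trans (ipC _ (w'.2 i) _ (h1dot_fst v'))
    (ler_wpM2l (psd_ge0 h1dot_psd v') (h1dot_snd w' i)).
  have a2 := le_trans (ipC _ w'.1 _ (h1dot_snd v' i))
    (ler_wpM2l (psd_ge0 h1dot_psd v') (h1dot_fst w')).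
  move: (ip _ _) (ip _ _) a1 a2 => x y a1 a2.
  have := sqr_ge0 (x - y); rewrite !expr2 in a1 a2 *; lra.
move=> Hv Hw.
have step phi (tphi : test_function Omega phi) :
    ip (tst tphi).1 (w.2 i) + ip ((tst tphi).2 i) w.1 = 0.
  have [C C0 CP] := bilin (tst tphi).
  apply: (H10_vanish (L := fun w => ip (tst tphi).1 (w.2 i) + ip ((tst tphi).2 i) w.1) C0) => //.
  move=> x y; rewrite h1_sndB h1_fstB !(psdBr ipp); ring.
have [C C0 CP] := bilin w.
apply: (H10_vanish (L := fun v => ip v.1 (w.2 i) + ip (v.2 i) w.1) C0) Hv => //.
- move=> x y; rewrite h1_sndB h1_fstB !(psdBl ipp); ring.
- by move=> x; rewrite addrC (psdC ipp) (psdC ipp (x.1)); exact: CP.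
Qed.


(** Product by a function a of gradient da, with the gradient given by the Leibniz
  rule. *)
Definition mulh a (da : 'I_n -> weight) v : h1 :=
  (l2mul a v.1, [ffun i => l2mul a (v.2 i) + l2mul (da i) v.1]).

Lemma mulhB a da v w : mulh a da (v - w) = mulh a da v - mulh a da w.
Proof.
congr pair; first exact: l2mulB.
apply/ffunP => i; rewrite ffunE h1_sndB h1_fstB !l2mulB !ffunE.
by rewrite opprD addrACA.
Qed.

Lemma mulh_bounded a da : exists2 C, 0 <= C & forall v,
  h1dot (mulh a da v) (mulh a da v) <= C * h1dot v v.
Proof.
have [C C0 CP] := l2mul_bounded leb (open_measurable_rV oO) a.
have [D DP] : exists D : 'I_n -> R, forall i, 0 <= D i /\
    forall f : V2, ip (l2mul (da i) f) (l2mul (da i) f) <= D i * ip f f.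
  have H i : exists D, 0 <= D /\ forall f : V2, ip (l2mul (da i) f) (l2mul (da i) f) <= D * ip f f.
    by have [D D0 DP] := l2mul_bounded leb (open_measurable_rV oO) (da i); exists D.
  by have [D DP] := choice H; exists D.
exists (C + \sum_i (2 * C + 2 * D i)).
  rewrite addr_ge0// sumr_ge0// => i _; have [Di _] := DP i; lra.
move=> v; rewrite {1}/h1dot mulrDl lerD//.
  by apply: (le_trans (CP _)); rewrite ler_wpM2l// h1dot_fst.
rewrite mulr_suml ler_sum// => i _; rewrite ffunE.
apply: (le_trans (psd_normD_le ipp _ _)); rewrite [leRHS]mulrDl -[2 * C * _]mulrA -[2 * D i * _]mulrA.
have [Di DPi] := DP i.
rewrite lerD// ler_wpM2l//.
  by apply: (le_trans (CP _)); rewrite ler_wpM2l// h1dot_snd.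
by apply: (le_trans (DPi _)); rewrite ler_wpM2l// h1dot_fst.
Qed.

(** Multiplication by a is bounded for the H^1 norm and preserves test functions. *)
Lemma H10_mulh (U : set 'rV[R]_n) a (da : 'I_n -> weight) v : open U -> Omega `<=` U -> smooth_on U a ->
  (forall i x, Omega x -> da i x = partial i a x) -> H10 v -> H10 (mulh a da v).
Proof.
move=> oU OU sa daE Hv eps e0.
have [C C0 CP] := mulh_bounded a da.
have e1 : 0 < eps / (C + 1) by rewrite divr_gt0// ltr_wpDl.
have [phi [tphi vphi]] := Hv _ e1.
have taphi := test_functionM oU OU sa tphi.
exists _, taphi.
have -> : h1dot (mulh a da v - tst taphi) (mulh a da v - tst taphi) =
    h1dot (mulh a da (v - tst tphi)) (mulh a da (v - tst tphi)).
  rewrite mulhB; apply: eq_h1dot => [//|i x Ox].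
  rewrite !h1_sndB !l2_BE; congr (_ - _); rewrite tst_snd [in RHS]ffunE /=.
  rewrite partialM; last 2 first.
  - by apply: smooth_on_differentiable sa _; exact: OU.
  - by case: (tphi) => sf _; exact: smooth_differentiable.
  rewrite -[RHS]/(a x * (tst tphi).2 i x + da i x * phi x).
  by rewrite tst_snd daE// addrC.
apply: (le_lt_trans (CP _)); move: vphi; rewrite ltr_pdivlMr ?ltr_wpDl//.
by have := psd_ge0 h1dot_psd (v - tst tphi); move: (h1dot _ _) => x *; lra.
Qed.

Lemma H10_complete (v : nat -> h1) : (forall m, H10 (v m)) ->
  (forall eps : R, 0 < eps -> exists N, forall m l, (N <= m)%N -> (N <= l)%N ->
    h1dot (v m - v l) (v m - v l) < eps) ->
  exists2 w, H10 w & forall eps : R, 0 < eps -> exists N, forall m, (N <= m)%N ->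
    h1dot (v m - w) (v m - w) < eps.
Proof.
move=> Hv cv.
have [f fP] : exists f : V2, forall eps : R, 0 < eps -> exists N, forall m, (N <= m)%N ->
    ip ((v m).1 - f) ((v m).1 - f) < eps.
  apply: l2_complete => eps e0; have [N NP] := cv _ e0; exists N => m l Nm Nl.
  by apply: (le_lt_trans _ (NP _ _ Nm Nl)); exact: (h1dot_fst (v m - v l)).
have [g gP] : exists g : 'I_n -> V2, forall i (eps : R), 0 < eps ->
    exists N, forall m, (N <= m)%N -> ip ((v m).2 i - g i) ((v m).2 i - g i) < eps.
  have H i : exists g : V2, forall (eps : R), 0 < eps ->
    exists N, forall m, (N <= m)%N -> ip ((v m).2 i - g) ((v m).2 i - g) < eps.
    apply: l2_complete => eps e0; have [N NP] := cv _ e0; exists N => m l Nm Nl.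
    apply: (le_lt_trans _ (NP _ _ Nm Nl)).
    by rewrite -h1_sndB; exact: h1dot_snd.
  by have [D DP] := choice H; exists D.
pose w : h1 := (f, [ffun i => g i]).
have wP eps : 0 < eps -> exists N, forall m, (N <= m)%N ->
    h1dot (v m - w) (v m - w) < eps.
  move=> e0; have d0 : 0 < eps / n.+1%:R by rewrite divr_gt0.
  have [N NP] := fP _ d0.
  have H i : exists N, forall m, (N <= m)%N ->
      ip ((v m).2 i - g i) ((v m).2 i - g i) < eps / n.+1%:R by exact: gP.
  have [Ni NiP] := choice H.
  exists (maxn N (\max_i Ni i)) => m; rewrite geq_max => /andP[Nm Nim].
  rewrite /h1dot; have -> : eps = eps / n.+1%:R + \sum_(i < n) eps / n.+1%:R.
    rewrite sumr_const card_ord -mulr_natl -natr1; field.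
    by rewrite natr1 pnatr_eq0.
  rewrite ltr_leD//; first exact: NP.
  apply: ler_sum => i _; rewrite h1_sndB ffunE; apply/ltW/NiP.
  by apply: leq_trans Nim; exact: leq_bigmax.
exists w => //; apply: H10_closed => eps e0.
have [N NP] := wP _ e0; exists (v N) => //.
have -> : w - v N = - (v N - w) by rewrite opprB.
rewrite !(psdNl h1dot_psd, psdNr h1dot_psd) opprK.
exact: NP.
Qed.

(** Replaces a test function p by a nearby element v of its closure in a
  compactness estimate: the factors 8 and 4 in the hypothesis leave room for the
  squares of the differences. *)
Lemma compact_stable (eps : R) (s : seq h1) v (p : h1) : 0 <= eps ->
  ip p.1 p.1 <= eps / 8 * eform (bw1 R Omega) p p +
    4^-1 * \sum_(x <- s) ip x.1 p.1 ^+ 2 ->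
  ip v.1 v.1 <= eps * eform (bw1 R Omega) v v + \sum_(x <- s) ip x.1 v.1 ^+ 2 +
    (2 + eps + \sum_(x <- s) ip x.1 x.1) * h1dot (v - p) (v - p).
Proof.
move=> e0 T; have := erefl (h1dot (v - p) (v - p)).
move: {1 3}(h1dot (v - p) (v - p)) => r rP.
have r0 : 0 <= r by rewrite rP; exact: (psd_ge0 h1dot_psd).
have rE : h1dot (p - v) (p - v) = r.
  by rewrite rP -opprB (psdNl h1dot_psd) (psdNr h1dot_psd) opprK.
have X1 : ip v.1 v.1 <= 2 * ip p.1 p.1 + 2 * r.
  have h := psd_normD_le ipp p.1 (v - p).1.
  rewrite h1_fstB [p.1 + _]addrC subrK -h1_fstB in h.
  apply: (le_trans h); rewrite lerD2l; apply: ler_wpM2l; first exact: ler0n.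
  by rewrite rP; exact: (h1dot_fst (v - p)).
have pe : psd_form (eform (bw1 R Omega)) by apply: eform_psd => x _ /=.
have E1 : eform (bw1 R Omega) p p <= 2 * eform (bw1 R Omega) v v + 2 * r.
  have h := psd_normD_le pe v (p - v); rewrite [v + _]addrC subrK in h.
  apply: (le_trans h); rewrite lerD2l; apply: ler_wpM2l; first exact: ler0n.
  by rewrite -rE /h1dot lerDr; exact: (psd_ge0 ipp (p - v).1).
set B := \sum_(x <- s) ip x.1 x.1.
have B0 : 0 <= B by apply: sumr_ge0 => x _; exact: (psd_ge0 ipp).
have Y1 : \sum_(x <- s) ip x.1 p.1 ^+ 2 <=
    2 * (\sum_(x <- s) ip x.1 v.1 ^+ 2) + 2 * (B * r).
  rewrite /B mulr_suml !mulr_sumr -big_split/=; apply: ler_sum => x _.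
  have -> : p.1 = v.1 + (p - v).1 by rewrite h1_fstB addrC subrK.
  rewrite (psdDr ipp).
  have : ip x.1 (p - v).1 ^+ 2 <= ip x.1 x.1 * r.
    apply: (le_trans (psd_CauchySchwarz ipp _ _)).
    by rewrite ler_wpM2l ?(psd_ge0 ipp)// -rE; exact: h1dot_fst.
  move: (ip x.1 v.1) (ip x.1 (p - v).1) (ip x.1 x.1 * r) => a b c h.
  by clear -h; have := sqr_ge0 (a - b); rewrite !expr2 in h *; lra.
have Ev0 := psd_ge0 pe v.
move: X1 E1 Y1 Ev0 T r0 B0; clearbody B.
move: (ip v.1 v.1) (ip p.1 p.1) (eform (bw1 R Omega) v v) (eform (bw1 R Omega) p p).
move: (\sum_(x <- s) ip x.1 p.1 ^+ 2) (\sum_(x <- s) ip x.1 v.1 ^+ 2).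
move=> Yp Yv Xv Xp Ev Ep X1 E1 Y1 Ev0 T r0 B0.
have := ler_wpM2l e0 E1.
have := mulr_ge0 e0 Ev0; have := mulr_ge0 e0 r0; have := mulr_ge0 B0 r0.
by clear -X1 E1 Y1 T r0 Ev0; move=> *; lra.
Qed.

(** Rellich's compactness theorem, in the form of an approximation of the L2
  norm by finitely many functionals: the integrals over small cubes. *)
Lemma H10_compact (M : R) : (forall x, Omega x -> forall i, `|x 0 i| <= M) ->
  forall eps : R, 0 < eps -> exists q : seq h1, forall v, H10 v ->
    ip v.1 v.1 <= eps * eform (bw1 R Omega) v v + \sum_(x <- q) ip x.1 v.1 ^+ 2.
Proof.
move=> OM eps e0.
pose C : R := 2 ^+ n * n%:R + 1.
have C0 : 0 < C by rewrite ltr_wpDl// mulr_ge0// exprn_ge0.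
(* The energy term of poincare_cubes, divided by 2 * delta ^+ n, is at most eps / 8. *)
pose delta := Num.min 1 (eps / (8 * C)).
have d0 : 0 < delta by rewrite lt_min ltr01 divr_gt0// mulr_gt0.
have d1 : delta <= 1 by rewrite ge_min lexx.
have dC : 8 * C * delta <= eps by rewrite mulrC -ler_pdivlMr ?mulr_gt0// ge_min lexx orbT.
pose K := (Num.truncn (2 * M / delta)).+1.
pose I := {ffun 'I_n -> 'I_K}; pose Q (z : I) := cube M delta z.
have mQ z : measurable (Q z) by exact: measurable_box.
have ql2 (z : I) : (\1_(Q z) : 'rV[R]_n -> R) \in l2_pred leb (open_measurable_rV oO).
  apply: l2_intro; first exact: measurable_indic.
  apply: (@integrableS _ _ _ _ setT) => //; first exact: open_measurable_rV.
  have := integrable_indic_box (R := R) (1 : R) (a := cube_corner M delta z)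
    (b := cube_corner M delta z + const_mx delta).
  rewrite (_ : (fun x => 1 * \1_(box _ _) x) = (fun x => \1_(Q z) x ^+ 2)).
    by apply => i; rewrite !mxE lerDl ltW.
  by apply/funext => x; rewrite mul1r !indicE; case: (_ \in _); rewrite ?expr1n ?expr0n.
(* The normalisation makes the squares of the functionals add up to 4 / delta ^+ n
   times the sum in poincare_cubes. *)
pose q (z : I) : h1 := (Num.sqrt (4 / delta ^+ n) *: L2Fun (ql2 z), 0).
have test phi (tphi : test_function Omega phi) :
    ip (tst tphi).1 (tst tphi).1 <= eps / 8 * eform (bw1 R Omega) (tst tphi) (tst tphi) +
      4^-1 * \sum_(x <- [seq q z | z : I]) ip x.1 (tst tphi).1 ^+ 2.
  have := poincare_cubes d0 OM tphi; rewrite -/K.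
  have -> : \int[leb]_x (phi x ^+ 2) = ip (tst tphi).1 (tst tphi).1.
    rewrite -Rintegral_zero_outside.
      by apply: eq_Rintegral => x _; rewrite mul1r tst_fst expr2.
    by move=> x /(test_function_outside tphi) ->; rewrite expr0n.
  have -> : \sum_i \int[leb]_x (partial i phi x ^+ 2) =
      eform (bw1 R Omega) (tst tphi) (tst tphi).
    apply: eq_bigr => i _; rewrite -Rintegral_zero_outside.
      by apply: eq_Rintegral => x _; rewrite mul1r tst_snd expr2.
    move=> x /(test_function_outside (test_function_partial i tphi)) ->.
    by rewrite expr0n.
  have -> : \sum_(z : I) (\int[leb]_(x in cube M delta z) phi x) ^+ 2 =
      delta ^+ n / 4 * \sum_(x <- [seq q z | z : I]) ip x.1 (tst tphi).1 ^+ 2.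
    rewrite big_image/= mulr_sumr; apply: eq_bigr => z _.
    rewrite (psdZl ipp) exprMn sqr_sqrtr ?divr_ge0 ?exprn_ge0 ?(ltW d0)//.
    rewrite mulrA [X in X * _](_ : _ = 1); last first.
      by field; rewrite expf_neq0// gt_eqF.
    rewrite mul1r; congr (_ ^+ 2).
    rewrite Rintegral_mkcond -[RHS]/(\int[leb]_(x in Omega) _) Rintegral_zero_outside; last first.
      by move=> x Ox; rewrite [X in _ * (_ * X)](test_function_outside tphi Ox) !mulr0.
    apply: eq_Rintegral => x _; rewrite patchE /= mul1r indicE.
    by case: ifPn => // _; rewrite ?mul1r ?mul0r.
  have e0' : 0 <= eform (bw1 R Omega) (tst tphi) (tst tphi).
    by apply: sumr_ge0 => i _; exact: (psd_ge0 ipp).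
  move: (ip _ _) (eform _ _ _) (\sum_(x <- _) _) e0' => X E Y E0.
  rewrite exprMn.
  have dn : 0 < delta ^+ n by rewrite exprn_gt0.
  have dd : C * delta ^+ 2 <= eps / 8.
    apply: (@le_trans _ _ (C * delta)); last by lra.
    by rewrite ler_pM2l// expr2 ler_piMl// ltW.
  move: (delta ^+ n) dn => D D0 h.
  have h2 : D * (2 * X) <= D * (2^-1 * Y + C * delta ^+ 2 * E).
    have : 0 <= D * (delta ^+ 2 * E) by apply: mulr_ge0; [exact: ltW|apply: mulr_ge0 => //; exact: sqr_ge0].
    by rewrite /C; move: (2 ^+ n) (n%:R) (delta ^+ 2) h => t m d2 *; lra.
  move: h2; rewrite ler_pM2l// => h2.
  have := mulr_ge0 (ltW e0) E0; have := ler_wpM2r E0 dd; move: (C * _) h2 => F *; lra.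
exists [seq q z | z : I] => v Hv; set s := [seq q z | z : I] in test *.
apply/ler_addgt0Pr => eta eta0.
pose B := \sum_(x <- s) ip x.1 x.1.
have B0 : 0 <= B by apply: sumr_ge0 => x _; exact: (psd_ge0 ipp).
have D0 : 0 < 2 + eps + B by clear -e0 B0; move: B B0 => B *; lra.
have [phi [tphi vphi]] := Hv _ (divr_gt0 eta0 D0).
apply: (le_trans (compact_stable v (ltW e0) (test _ tphi))).
by rewrite lerD2l mulrC -ler_pdivlMr// ltW.
Qed.

End sobolev.

(** * The Dirichlet problem on a bounded domain of the half-space *)

Lemma Rintegral_sum d (T : measurableType d) (R : realType)
    (mu : {measure set T -> \bar R}) (D : set T) (I : Type) (r : seq I)
    (F : I -> T -> R) : measurable D ->
  (forall i, mu.-integrable D (EFin \o F i)) ->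
  \int[mu]_(x in D) (\sum_(i <- r) F i x) = \sum_(i <- r) \int[mu]_(x in D) F i x.
Proof.
move=> mD iF; elim: r => [|i r ih].
  rewrite big_nil; transitivity (\int[mu]_(x in D) (0 : R)).
    by apply: eq_Rintegral => x _; rewrite big_nil.
  by rewrite Rintegral_cst// mul0r.
rewrite big_cons -ih -RintegralD//; last first.
  rewrite (_ : _ \o _ = fun x => (\sum_(j <- r) (EFin \o F j) x)%E).
    exact: integrable_sum.
  by apply/funext => x /=; rewrite sumEFin.
by apply: eq_Rintegral => x _; rewrite big_cons.
Qed.

Lemma sum_delta (R : pzSemiRingType) (I : finType) (p : I) (F : I -> R) :
  \sum_j (j == p)%:R * F j = F p.
Proof.
by rewrite (bigD1 p)//= eqxx mul1r big1 ?addr0// => j /negbTE ->; rewrite mul0r.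
Qed.

Section half_space_domain.
Context (R : realType) (m : nat) (t : R) (Omega : set 'rV[R]_m.+1)
  (oO : open Omega) (OH : Omega `<=` @half_space R m)
  (cO : compact (closure Omega `&` @half_space R m)).
Local Notation leb := (@lebesgue_rV R m.+1).
Local Notation V2 := (l2 leb (open_measurable_rV oO)).
Local Notation h1 := (h1 oO).
Local Notation g := (half_metric t).
Local Notation n := (m.+1%:R : R).

(** Compactness of the closure of Omega inside the half-space makes powers of x_n of
  either sign, as well as the coordinates, bounded on Omega. *)
Lemma bounded_on_domain (f : 'rV[R]_m.+1 -> R) :
  {in @half_space R m, continuous f} -> exists M, forall x, Omega x -> `|f x| <= M.
Proof.
move=> cf.
have cC : {within closure Omega `&` @half_space R m, continuous f}.
  apply: continuous_in_subspaceT => x /set_mem[_ Hx]; apply: cf; exact: mem_set.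
have [M [_ MP]] := compact_bounded (continuous_compact cC cO).
exists (`|M| + 1) => x Ox; apply: (MP (`|M| + 1)).
  by rewrite (le_lt_trans (ler_norm M))// ltrDl.
by exists x => //; split; [exact: subset_closure|exact: OH].
Qed.

Lemma smooth_on_half_measurable (f : 'rV[R]_m.+1 -> R) :
  smooth_on (@half_space R m) f -> measurable_fun Omega f.
Proof.
move=> sf; apply: continuous_in_measurable_rV => // x /set_mem/OH Hx.
exact: smooth_on_continuous sf Hx.
Qed.

Lemma smooth_on_half_bounded (f : 'rV[R]_m.+1 -> R) :
  smooth_on (@half_space R m) f -> exists M, forall x, Omega x -> `|f x| <= M.
Proof.
move=> sf; apply: bounded_on_domain => x /set_mem Hx.
exact: smooth_on_continuous sf Hx.
Qed.

Definition smooth_weight f (sf : smooth_on (@half_space R m) f) : bweight R Omega :=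
  BWeight (smooth_on_half_measurable sf) (smooth_on_half_bounded sf).

Definition pw (s : R) : bweight R Omega := smooth_weight (smooth_on_xlast_powR m s).

Definition cw (p : 'I_m.+1) : bweight R Omega :=
  smooth_weight (smooth_on_coord p (@open_half_space R m)).

Lemma domain_coord_bounded : exists M, forall x, Omega x -> forall i, `|x 0 i| <= M.
Proof.
have H (i : 'I_m.+1) : exists M, forall x, Omega x -> `|cw i x| <= M by exact: bw_bounded.
have [M MP] := choice H; exists (\sum_i `|M i|) => x Ox i.
apply: (le_trans (MP i x Ox)); apply: (le_trans (ler_norm _)).
by rewrite (bigD1 i)//= lerDl sumr_ge0.
Qed.

Lemma pw_gt0 s x : Omega x -> 0 < pw s x.
Proof. by move=> /OH Hx; rewrite powR_gt0. Qed.

Lemma pwD s r x : Omega x -> pw (s + r) x = pw s x * pw r x.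
Proof.
by move=> /OH Hx; rewrite /= powRD//; apply/implyP => _; rewrite gt_eqF.
Qed.

Lemma pwN s x : Omega x -> pw s x * pw (- s) x = 1.
Proof. by move=> Ox; rewrite -pwD// subrr /= powRr0. Qed.

(* x_n^s0 is the volume density; the inverse metric contributes a further x_n^t to
   the Dirichlet energy, whose weight is x_n^s1. *)
Let s0 : R := - (n * t / 2).
Let s1 : R := t + s0.

Lemma half_vol_density x : Omega x -> vol_density g x = pw s0 x.
Proof.
move=> /OH Hx; rewrite /vol_density /half_metric det_scalar -powRN -powR_mulrn ?powR_ge0//.
by rewrite -powR12_sqrt ?powR_ge0// -!powRrM /s0 /=; congr (_ `^ _); field.
Qed.

Lemma half_inner x (v w : 'rV[R]_m.+1) : Omega x ->
  inner g x v w = pw (- t) x * \sum_i v 0 i * w 0 i.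
Proof.
move=> Ox; rewrite /inner /half_metric mul_mx_scalar -scalemxAl mxE -powRN /=.
by rewrite mxE; congr (_ * _); apply: eq_bigr => i _; rewrite mxE.
Qed.

Lemma half_grad (f : 'rV[R]_m.+1 -> R) x i : grad g f x 0 i = pw t x * partial i f x.
Proof.
by rewrite /grad /half_metric invmx_scalar invrK mul_mx_scalar !mxE.
Qed.

Lemma vol_integralE (f : 'rV[R]_m.+1 -> R) :
  vol_integral g Omega f = \int[leb]_(x in Omega) (f x * pw s0 x).
Proof.
by apply: eq_Rintegral => x /set_mem Ox; rewrite half_vol_density.
Qed.

Lemma evol_integralE (f : 'rV[R]_m.+1 -> R) :
  evol_integral g Omega f = (\int[leb]_(x in Omega) (f x * pw s0 x)%:E)%E.
Proof.
by apply: eq_integral => x /set_mem Ox; rewrite half_vol_density.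
Qed.

Lemma vol_integral_wip (f h : V2) :
  vol_integral g Omega (fun x => f x * h x) = wip (pw s0) f h.
Proof. by rewrite vol_integralE; apply: eq_Rintegral => x _; rewrite mulrC. Qed.

(** Powers of x_n being bounded, the Riemannian and Euclidean norms are equivalent. *)
Lemma wip_pw_le (s r : R) : exists2 C, 0 < C &
  forall f : V2, wip (pw s) f f <= C * wip (pw r) f f.
Proof.
have [M MP] := bw_bounded (pw (s - r)).
exists (`|M| + 1); first by rewrite ltr_wpDl.
move=> f; rewrite /wip -RintegralZl//; last 2 first.
- exact: open_measurable_rV.
- exact: integrable_bw_l2.
apply: le_Rintegral => //; first exact: open_measurable_rV.
- exact: integrable_bw_l2.
- apply: integrableZ_fin; first exact: open_measurable_rV.
  exact: integrable_bw_l2.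
move=> x Ox; rewrite [leRHS]mulrA; apply: ler_wpM2r; first by rewrite -expr2 sqr_ge0.
rewrite -[s in leLHS](subrK r) pwD//; apply: ler_wpM2r; first exact/ltW/pw_gt0.
apply: (le_trans (ler_norm _)); apply: (le_trans (MP x Ox)).
by apply: (le_trans (ler_norm _)); rewrite lerDl.
Qed.

Lemma ip_pw0 (f h : V2) : ip f h = wip (pw 0) f h.
Proof. by apply: eq_wip => x Ox; rewrite /= powRr0. Qed.

(** The L2 product and the Dirichlet energy for the Riemannian volume, in terms of
  Euclidean partial derivatives. *)
Definition bvol (v w : h1) : R := bform (pw s0) v w.
Definition evol (v w : h1) : R := eform (pw s1) v w.

Lemma bvol_psd : psd_form bvol.
Proof. by apply: bform_psd => x Ox; exact/ltW/pw_gt0. Qed.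

Lemma evol_psd : psd_form evol.
Proof. by apply: eform_psd => x Ox; exact/ltW/pw_gt0. Qed.

Lemma h1dot_le : exists2 C, 0 < C & forall v : h1,
  h1dot v v <= C * (bvol v v + evol v v).
Proof.
have [C C0 CP] := wip_pw_le 0 s0; have [D D0 DP] := wip_pw_le 0 s1.
exists (C + D) => [|v]; first exact: addr_gt0.
have h1 : ip v.1 v.1 <= C * bvol v v by rewrite ip_pw0; exact: CP.
have h2 : eform (bw1 R Omega) v v <= D * evol v v.
  rewrite /evol /eform mulr_sumr; apply: ler_sum => i _.
  rewrite -[leLHS]/(ip (v.2 i) (v.2 i)) ip_pw0; exact: DP.
rewrite -[h1dot v v]/(ip v.1 v.1 + eform (bw1 R Omega) v v).
have b0 := psd_ge0 bvol_psd v; have e0 := psd_ge0 evol_psd v.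
move: (ip _ _) (eform _ _ _) (bvol _ _) (evol _ _) b0 e0 h1 h2 => x y b e b0 e0 h1 h2.
have := mulr_ge0 (ltW C0) e0; have := mulr_ge0 (ltW D0) b0.
by clear -h1 h2; move=> *; lra.
Qed.

Lemma le_h1dot : exists2 C, 0 < C & forall v : h1,
  bvol v v + evol v v <= C * h1dot v v.
Proof.
have [C C0 CP] := wip_pw_le s0 0; have [D D0 DP] := wip_pw_le s1 0.
exists (C + D) => [|v]; first exact: addr_gt0.
have h1 : bvol v v <= C * ip v.1 v.1 by rewrite ip_pw0; exact: CP.
have h2 : evol v v <= D * eform (bw1 R Omega) v v.
  rewrite /evol /eform mulr_sumr; apply: ler_sum => i _.
  rewrite -[X in D * X]/(ip (v.2 i) (v.2 i)) ip_pw0; exact: DP.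
rewrite -[h1dot v v]/(ip v.1 v.1 + eform (bw1 R Omega) v v).
have b0 : 0 <= ip v.1 v.1 by exact: (psd_ge0 (ip_psd _ _)).
have e0 : 0 <= eform (bw1 R Omega) v v.
  by apply: sumr_ge0 => i _; exact: (psd_ge0 (ip_psd _ _)).
move: (ip _ _) (eform _ _ _) (bvol _ _) (evol _ _) b0 e0 h1 h2 => x y b e b0 e0 h1 h2.
have := mulr_ge0 (ltW C0) e0; have := mulr_ge0 (ltW D0) b0.
by clear -h1 h2; move=> *; lra.
Qed.


Definition weak_eigen (lam : R) (v : h1) : Prop :=
  H10 v /\ forall w, H10 w -> evol v w = lam * bvol v w.

Lemma evol_bvol_bounded (lam : R) (v : h1) : exists2 C, 0 <= C & forall w : h1,
  (evol v w - lam * bvol v w) ^+ 2 <= C * h1dot w w.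
Proof.
have [C C0 CP] := le_h1dot.
pose A := 2 * evol v v + 2 * lam ^+ 2 * bvol v v.
have ev0 := psd_ge0 evol_psd v; have bv0 := psd_ge0 bvol_psd v.
have A0 : 0 <= A.
  by rewrite /A addr_ge0//; apply: mulr_ge0 => //; rewrite mulr_ge0// sqr_ge0.
exists (A * C) => [|w]; first by rewrite mulr_ge0// ltW.
rewrite -mulrA; apply: (@le_trans _ _ (A * (bvol w w + evol w w))); last first.
  exact: ler_wpM2l.
have h1 := psd_CauchySchwarz evol_psd v w; have h2 := psd_CauchySchwarz bvol_psd v w.
have ew0 := psd_ge0 evol_psd w; have bw0 := psd_ge0 bvol_psd w.
rewrite /A; move: (evol v w) (bvol v w) (evol v v) (bvol v v) (evol w w) (bvol w w)
  ev0 bv0 ew0 bw0 h1 h2 => x y a b c d a0 b0 c0 d0 h1 h2; clear -a0 b0 c0 d0 h1 h2.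
have := ler_wpM2l (sqr_ge0 lam) h2; have := sqr_ge0 (x + lam * y).
have := mulr_ge0 a0 d0; have := mulr_ge0 (sqr_ge0 lam) (mulr_ge0 b0 c0).
rewrite !expr2 in h1 h2 *; lra.
Qed.

Lemma l2_sumE (I : Type) (r : seq I) (F : I -> V2) x :
  (\sum_(i <- r) F i : V2) x = \sum_(i <- r) F i x.
Proof. by elim/big_rec2 : _ => // i y1 y2 _ <-. Qed.

(** Green's formula for a field that is only known on Omega, where its product by
  the volume density extends to the test functions chi. *)
Lemma H10_div (v : h1) (X : 'rV[R]_m.+1 -> 'rV[R]_m.+1)
    (chi : 'I_m.+1 -> 'rV[R]_m.+1 -> R) (tchi : forall i, test_function Omega (chi i)) :
  H10 v -> (forall i y, Omega y -> pw s0 y * X y 0 i = chi i y) ->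
  vol_integral g Omega (fun x => v.1 x * divergence g X x) =
  - \sum_i ip (v.2 i) (tst oO (tchi i)).1.
Proof.
move=> Hv Xchi.
rewrite vol_integralE -sumrN.
transitivity (ip v.1 (\sum_i (tst oO (tchi i)).2 i)).
  apply: eq_Rintegral => x /set_mem Ox; rewrite mul1r -mulrA; congr (_ * _).
  rewrite /divergence half_vol_density// mulrAC mulVf ?mul1r; last first.
    by rewrite gt_eqF ?pw_gt0.
  rewrite l2_sumE; apply: eq_bigr => i _; rewrite tst_snd.
  apply: near_eq_partial; have : nbhs x Omega by exact: open_nbhs_nbhs.
  by apply: filterS => y Oy; rewrite half_vol_density// Xchi.
rewrite (psd_sumr (ip_psd _ _)); apply: eq_bigr => i _.
by have /eqP := H10_ibp i Hv (H10_tst oO (tchi i)); rewrite addr_eq0 => /eqP.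
Qed.

Lemma test_function_pwM (s : R) phi : test_function Omega phi ->
  test_function Omega (fun x => pw s x * phi x).
Proof.
exact: (test_functionM (@open_half_space R m) OH (smooth_on_xlast_powR m s)).
Qed.

Lemma H10_laplacian (v : h1) phi (tphi : test_function Omega phi) : H10 v ->
  vol_integral g Omega (fun x => v.1 x * laplacian g phi x) = - evol v (tst oO tphi).
Proof.
move=> Hv.
have tchi i := test_function_pwM s1 (test_function_partial i tphi).
rewrite (H10_div tchi Hv); last first.
  by move=> i y Oy; rewrite half_grad mulrA [pw s0 y * _]mulrC -pwD.
congr (- _); apply: eq_bigr => i _; apply: eq_wip => x Ox.
by rewrite mul1r tst_snd mulrCA.
Qed.

Lemma weak_eigen_test (lam : R) (v : h1) : H10 v ->
  (forall phi (tphi : test_function Omega phi),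
    vol_integral g Omega (fun x => v.1 x * laplacian g phi x) =
    - lam * vol_integral g Omega (fun x => v.1 x * phi x)) ->
  weak_eigen lam v.
Proof.
move=> Hv eqv; split => // w Hw; apply/eqP; rewrite -subr_eq0; apply/eqP.
have [C C0 CP] := evol_bvol_bounded lam v.
apply: (H10_vanish (L := fun w => evol v w - lam * bvol v w) C0) Hw => //.
  move=> x y; rewrite (psdBr evol_psd) (psdBr bvol_psd); ring.
move=> phi tphi; have := eqv _ tphi; rewrite H10_laplacian//.
rewrite (vol_integral_wip v.1 (tst oO tphi).1) mulNr => /oppr_inj ->.
by rewrite subrr.
Qed.

Lemma l2_weighted (r : R) (f : 'rV[R]_m.+1 -> R) : measurable_fun Omega f ->
  (\int[leb]_(x in Omega) (f x ^+ 2 * pw r x)%:E < +oo)%E ->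
  f \in l2_pred leb (open_measurable_rV oO).
Proof.
move=> mf fr; apply: l2_intro => //.
have mO := open_measurable_rV oO.
have [M MP] := bw_bounded (pw (- r)).
apply: (@le_integrable _ _ _ leb _ mO _ (EFin \o (fun x => M * (f x ^+ 2 * pw r x)))).
- by apply/measurable_EFinP; exact: measurable_funX.
- move=> x Ox; rewrite /= lee_fin ger0_norm ?sqr_ge0//.
  apply: (le_trans _ (ler_norm _)).
  rewrite [leLHS](_ : _ = pw (- r) x * (f x ^+ 2 * pw r x)); last first.
    by rewrite mulrCA [pw (- r) x * _]mulrC pwN// mulr1.
  apply: ler_wpM2r; first by rewrite mulr_ge0 ?sqr_ge0// ltW ?pw_gt0.
  exact: (le_trans (ler_norm _) (MP x Ox)).
- apply: integrableZ_fin => //; apply/integrableP; split.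
    apply/measurable_EFinP; apply: measurable_funM; first exact: measurable_funX.
    exact: bw_measurable.
  rewrite (eq_integral (fun x => (f x ^+ 2 * pw r x)%:E)) => [//|x /set_mem Ox].
  by rewrite /= ger0_norm// mulr_ge0 ?sqr_ge0// ltW ?pw_gt0.
Qed.

Lemma evol_integral_sqr (f : V2) :
  evol_integral g Omega (fun x => f x ^+ 2) = (wip (pw s0) f f)%:E.
Proof.
rewrite evol_integralE EFin_wip; apply: eq_integral => x _.
by rewrite mulrC expr2.
Qed.

Lemma evol_integral_inner (z : h1) (F : 'rV[R]_m.+1 -> 'rV[R]_m.+1) :
  (forall x i, Omega x -> F x 0 i = pw t x * z.2 i x) ->
  evol_integral g Omega (fun x => inner g x (F x) (F x)) = (evol z z)%:E.
Proof.
move=> FE; rewrite evol_integralE.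
rewrite (eq_integral (fun x => \sum_i (pw s1 x * (z.2 i x * z.2 i x))%:E)%E); last first.
  move=> x /set_mem Ox; rewrite half_inner// sumEFin; congr EFin.
  rewrite mulr_sumr mulr_suml; apply: eq_bigr => i _; rewrite !FE//.
  have := pwN t Ox; rewrite /s1 pwD//.
  move: (pw t x) (pw (- t) x) (pw s0 x) (z.2 i x) => a b c d ab.
  transitivity ((a * b) * (a * c * (d * d))); first by ring.
  by rewrite ab mul1r.
have mO := open_measurable_rV oO.
rewrite ge0_integral_sum//.
- by rewrite /evol /eform -sumEFin; apply: eq_bigr => i _; rewrite EFin_wip.
- move=> i; apply/measurable_EFinP; apply: measurable_funM; first exact: bw_measurable.
  by apply: measurable_funM; exact: measurable_l2.
- move=> i x Ox; rewrite lee_fin; apply: mulr_ge0; first exact/ltW/pw_gt0.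
  by rewrite -expr2 sqr_ge0.
Qed.

(** A solution u with Riemannian weak gradient G is paired with the Euclidean one,
  x_n^-t G; test functions that approximate u in H^1 then approximate the pair. *)
Lemma dirichlet_solution_weak_eigen (lam : R) (u : 'rV[R]_m.+1 -> R) :
  dirichlet_solution g Omega lam u -> exists2 v : h1, l2_fun v.1 = u & weak_eigen lam v.
Proof.
have mO := open_measurable_rV oO.
move=> [[G [[mu u2] [mG G2] _] [phi [tphi cphi]]] eqn].
have ul2 : u \in l2_pred leb (open_measurable_rV oO) by apply: (l2_weighted (r := s0) mu); rewrite -evol_integralE.
have Dl2 i : (fun x => pw (- t) x * G x 0 i) \in l2_pred leb (open_measurable_rV oO).
  have mD : measurable_fun Omega (fun x => pw (- t) x * G x 0 i).
    by apply: measurable_funM; [exact: bw_measurable|exact: mG].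
  apply: (l2_weighted (r := s1) mD); apply: le_lt_trans G2; rewrite evol_integralE.
  apply: ge0_le_integral => //.
  - by move=> x Ox; rewrite lee_fin mulr_ge0 ?sqr_ge0// ltW ?pw_gt0.
  - apply/measurable_EFinP; apply: measurable_funM; first exact: measurable_funX.
    exact: bw_measurable.
  - apply: (eq_measurable_fun (fun x => (pw (- t) x * (\sum_i G x 0 i * G x 0 i) * pw s0 x)%:E)).
      by move=> x /set_mem Ox; rewrite half_inner.
    apply/measurable_EFinP; apply: measurable_funM; last exact: bw_measurable.
    apply: measurable_funM; first exact: bw_measurable.
    by apply: measurable_sum => j; apply: measurable_funM; exact: mG.
  move=> x Ox; rewrite lee_fin half_inner// /s1 pwD//.
  have := pwN t Ox; have := pw_gt0 (- t) Ox; have := pw_gt0 s0 Ox.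
  have : G x 0 i * G x 0 i <= \sum_j G x 0 j * G x 0 j.
    by rewrite (bigD1 i)//= lerDl sumr_ge0// => j _; rewrite -expr2 sqr_ge0.
  move: (pw t x) (pw (- t) x) (pw s0 x) (G x 0 i) (\sum_j _) => a b c d S dS c0 b0 ab.
  have -> : (b * d) ^+ 2 * (a * c) = (a * b) * ((b * (d * d)) * c) by ring.
  by rewrite ab mul1r; apply: ler_wpM2r; [exact: ltW|apply: ler_wpM2l; [exact: ltW|]].
pose v : h1 := (L2Fun ul2, [ffun i => L2Fun (Dl2 i)]).
have Hv : H10 v.
  move=> eps e0; have [C C0 CP] := h1dot_le.
  have d0 : 0 < eps / C by rewrite divr_gt0.
  have : \forall k \near \oo, (evol_integral g Omega (fun x => (phi k x - u x) ^+ 2)%R +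
     evol_integral g Omega (fun x =>
       inner g x (grad g (phi k) x - G x) (grad g (phi k) x - G x))%R < (eps / C)%:E)%E.
    apply: (cphi [set y | (y < (eps / C)%:E)%E]).
    apply: open_nbhs_nbhs; split; last by rewrite /= lte_fin.
    exact: lray_open.
  move=> [k _ /(_ k (leqnn k))/=].
  set z := v - tst oO (tphi k).
  have -> : evol_integral g Omega (fun x => (phi k x - u x) ^+ 2) = (bvol z z)%:E.
    rewrite -[bvol z z]/(wip (pw s0) z.1 z.1) -evol_integral_sqr; congr evol_integral.
    by apply/funext => x; rewrite -sqrrN opprB.
  rewrite (@evol_integral_inner (- z)); last first.
    move=> x i Ox; rewrite mxE [X in _ + X]mxE half_grad.
    rewrite -[(- z).2 i x]/([ffun i => - z.2 i] i x) ffunE.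
    rewrite -[(- z.2 i) x]/(- (z.2 i x)) h1_sndB l2_BE opprB mulrBr tst_snd; congr (_ - _).
    by rewrite ffunE /= mulrA pwN// mul1r.
  rewrite (psdNl evol_psd) (psdNr evol_psd) opprK -EFinD lte_fin => zC.
  exists (phi k), (tphi k); apply: (le_lt_trans (CP _)).
  by rewrite mulrC -ltr_pdivlMr.
by exists v => //; apply: weak_eigen_test.
Qed.

(** The converse: minimisers obtained by the direct method are solutions in the
  sense in which multiplicities are counted. *)
Lemma weak_eigen_dirichlet_solution (lam : R) (v : h1) :
  weak_eigen lam v -> dirichlet_solution g Omega lam v.1.
Proof.
have mO := open_measurable_rV oO.
move=> [Hv eqv]; split; last first.
  move=> phi tphi; rewrite H10_laplacian// eqv; last exact: H10_tst.
  by rewrite mulNr (vol_integral_wip v.1 (tst oO tphi).1).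
pose G x : 'rV[R]_m.+1 := \row_i (pw t x * v.2 i x).
have GE x i : G x 0 i = pw t x * v.2 i x by rewrite mxE.
exists G.
  split.
  - split; first exact: measurable_l2.
    by rewrite evol_integral_sqr ltry.
  - split.
      move=> i; rewrite (_ : (fun x => _) = (fun x => pw t x * v.2 i x)).
        by apply: measurable_funM; [exact: bw_measurable|exact: measurable_l2].
      by apply/funext => x; rewrite GE.
    by rewrite (@evol_integral_inner v) ?ltry.
  - move=> X tX; have tchi i := test_function_pwM s0 (tX i).
    rewrite (H10_div tchi Hv)//; congr (- _).
    rewrite -Rintegral_sum//; last by move=> i; exact: integrable_bw_l2.
    rewrite vol_integralE; apply: eq_Rintegral => x /set_mem Ox.
    rewrite half_inner// mulr_sumr mulr_suml; apply: eq_bigr => i _; rewrite GE [LHS]mul1r tst_fst.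
    have := pwN t Ox; move: (pw t x) (pw (- t) x) (pw s0 x) (v.2 i x) => a b c d ab.
    by rewrite -[LHS]mul1r -ab; ring.
have [C C0 CP] := le_h1dot.
have phiP (k : nat) : exists p : ('rV[R]_m.+1 -> R) * R, [/\ test_function Omega p.1,
    (evol_integral g Omega (fun x => (p.1 x - v.1 x) ^+ 2)%R +
     evol_integral g Omega (fun x =>
       inner g x (grad g p.1 x - G x) (grad g p.1 x - G x))%R = p.2%:E)%E &
    0 <= p.2 <= k.+1%:R^-1].
  have d0 : 0 < k.+1%:R^-1 / C by rewrite divr_gt0// invr_gt0.
  have [phi [tphi vphi]] := Hv _ d0.
  set z := v - tst oO tphi in vphi.
  exists (phi, bvol z z + evol z z); split => //=; last first.
    rewrite addr_ge0 ?(psd_ge0 bvol_psd) ?(psd_ge0 evol_psd)//=.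
    by apply: (le_trans (CP _)); rewrite mulrC -ler_pdivlMr//; exact: ltW.
  have -> : evol_integral g Omega (fun x => (phi x - v.1 x) ^+ 2) = (bvol z z)%:E.
    rewrite -[bvol z z]/(wip (pw s0) z.1 z.1) -evol_integral_sqr; congr evol_integral.
    by apply/funext => x; rewrite -sqrrN opprB.
  rewrite (@evol_integral_inner (- z)); last first.
    move=> x i Ox; rewrite mxE [X in _ + X]mxE half_grad.
    rewrite -[(- z).2 i x]/([ffun i => - z.2 i] i x) ffunE.
    rewrite -[(- z.2 i) x]/(- (z.2 i x)) h1_sndB l2_BE opprB mulrBr tst_snd; congr (_ - _).
    by rewrite GE.
  by rewrite (psdNl evol_psd) (psdNr evol_psd) opprK -EFinD.
have [p {}phiP] := choice phiP.
exists (fun k => (p k).1); split; first by move=> k; have [] := phiP k.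
rewrite (_ : (fun k => _) = (fun k => ((p k).2)%:E)); last first.
  by apply/funext => k; have [] := phiP k.
apply/cvg_EFin; first exact: nearW.
apply: (@squeeze_cvgr _ _ _ _ (cst 0) (@harmonic R)).
- by apply: nearW => k; have [] := phiP k.
- exact: cvg_cst.
- exact: cvg_harmonic.
Qed.


(** * The variational principle *)

Lemma wip_ae0 (a : bweight R Omega) (f h : V2) :
  (\forall x \ae leb, Omega x -> f x = 0) -> wip a f h = 0.
Proof.
move=> f0; have mO := open_measurable_rV oO.
apply: EFin_inj; rewrite EFin_wip.
rewrite (ae_eq_integral (fun=> 0%E))//; first by rewrite integral0.
- exact: measurable_int (integrable_bw_l2 a f h).
- by apply: filterS f0 => x fx Ox; rewrite fx// mul0r mulr0.
Qed.

Lemma bvol_compact (eps : R) : 0 < eps -> exists q : seq h1, forall v, H10 v ->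
  bvol v v <= eps * evol v v + \sum_(x <- q) bvol x v ^+ 2.
Proof.
move=> e0; have [M MP] := domain_coord_bounded.
have [C C0 CP] := wip_pw_le s0 0; have [D D0 DP] := wip_pw_le 0 s1.
have d0 : 0 < eps / (C * D) by rewrite divr_gt0// mulr_gt0.
have [q qP] := H10_compact oO MP d0.
exists [seq (Num.sqrt C *: l2mul (pw (- s0)) x.1, 0) | x <- q] => v Hv.
have -> : \sum_(x <- [seq (Num.sqrt C *: l2mul (pw (- s0)) x.1, 0) | x <- q]) bvol x v ^+ 2 =
    C * \sum_(x <- q) ip x.1 v.1 ^+ 2.
  rewrite big_map mulr_sumr; apply: eq_bigr => x _.
  rewrite -[bvol _ _]/(wip (pw s0) (Num.sqrt C *: l2mul (pw (- s0)) x.1) v.1).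
  rewrite (psdZl (wip_psd _ _ (fun x Ox => ltW (pw_gt0 s0 Ox)))) exprMn sqr_sqrtr ?ltW//.
  congr (_ * _ ^+ 2); apply: eq_wip => y Oy.
  by rewrite -[l2mul _ _ y]/(pw (- s0) y * x.1 y) -mulrA mulrA pwN.
apply: (@le_trans _ _ (C * ip v.1 v.1)); first by rewrite ip_pw0; exact: CP.
have h2 : eform (bw1 R Omega) v v <= D * evol v v.
  rewrite /evol /eform mulr_sumr; apply: ler_sum => i _.
  rewrite -[leLHS]/(ip (v.2 i) (v.2 i)) ip_pw0; exact: DP.
have := ler_wpM2l (ltW C0) (qP _ Hv); move/le_trans; apply.
rewrite mulrDr lerD2r mulrA.
have := ler_wpM2l (ltW (mulr_gt0 C0 d0)) h2; move/le_trans; apply.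
rewrite le_eqVlt; apply/orP; left; apply/eqP; rewrite mulrA; congr (_ * _).
by field; rewrite !gt_eqF.
Qed.

Lemma bvol_complete (v : nat -> h1) : (forall m, H10 (v m)) ->
  (forall eps : R, 0 < eps -> exists N, forall m l, (N <= m)%N -> (N <= l)%N ->
    bvol (v m - v l) (v m - v l) + evol (v m - v l) (v m - v l) < eps) ->
  exists2 w, H10 w & forall eps : R, 0 < eps -> exists N, forall m, (N <= m)%N ->
    bvol (v m - w) (v m - w) + evol (v m - w) (v m - w) < eps.
Proof.
move=> Hv cv; have [C C0 CP] := h1dot_le; have [D D0 DP] := le_h1dot.
have [eps e0|w Hw wP] := H10_complete Hv.
  have [N NP] := cv _ (divr_gt0 e0 C0); exists N => i l Ni Nl.
  by apply: (le_lt_trans (CP _)); rewrite mulrC -ltr_pdivlMr// NP.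
exists w => // eps e0; have [N NP] := wP _ (divr_gt0 e0 D0); exists N => i Ni.
by apply: (le_lt_trans (DP _)); rewrite mulrC -ltr_pdivlMr// NP.
Qed.

(** Modulo almost everywhere equality, d + 1 elements of a space of dimension d are
  linearly dependent, and a dependent family is not orthonormal. *)
Lemma dirichlet_multiplicity_bound (mu : R) (d : nat) (f : 'I_d.+1 -> h1) :
  dirichlet_multiplicity g Omega mu d -> (forall r, weak_eigen mu (f r)) ->
  ~ (forall r s, bvol (f r) (f s) = (r == s)%:R).
Proof.
move=> [w [_ _ w_span]] fe fo.
have cP r : exists c : 'I_d -> R, \forall x \ae leb,
    Omega x -> (f r).1 x = \sum_j c j * w j x.
  by apply: w_span; exact: weak_eigen_dirichlet_solution.
have {cP} [c cP] := choice cP.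
pose A : 'M[R]_(d.+1, d) := \matrix_(r, j) c r j.
have : kermx A != 0.
  rewrite kermx_eq0; apply/negP => /eqP rA.
  by have := rank_leq_col A; rewrite rA ltnn.
move=> /rowV0Pn[a /sub_kermxP aA]; apply/negP; rewrite negbK; apply/eqP/rowP => s.
pose Z : V2 := \sum_r a 0 r *: (f r).1.
have Z0 : \forall x \ae leb, Omega x -> Z x = 0.
  apply: filterS (filter_forall _ cP) => x cx Ox.
  rewrite l2_sumE; transitivity (\sum_r \sum_j a 0 r * (A r j * w j x)).
    apply: eq_bigr => r _; rewrite -[LHS]/(a 0 r * (f r).1 x) (cx r Ox) mulr_sumr.
    by apply: eq_bigr => j _; rewrite mxE.
  rewrite exchange_big big1// => j _.
  transitivity ((a *m A) 0 j * w j x); last by rewrite aA mxE mul0r.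
  by rewrite mxE mulr_suml; apply: eq_bigr => r _; rewrite mulrA.
have pW := wip_psd leb (open_measurable_rV oO) (fun x Ox => ltW (pw_gt0 s0 Ox)).
have := wip_ae0 (pw s0) (f s).1 Z0.
rewrite (psd_suml pW) (bigD1 s)//= (psdZl pW).
rewrite -[wip _ _ _]/(bvol (f s) (f s)) fo eqxx mulr1 big1 ?addr0 ?mxE//.
move=> r rs; rewrite (psdZl pW) -[wip _ _ _]/(bvol (f r) (f s)) fo.
by rewrite (negbTE rs) mulr0.
Qed.

(** Otherwise the direct method gives an eigenfunction z for some mu < lam k,
  orthogonal to the first k ones. All the indices of mu in the spectrum are less than
  k, so z together with the v i of eigenvalue mu is one eigenfunction too many. *)
Lemma rayleigh_bound (lam : nat -> R) (v : nat -> h1) (k : nat) (w : h1) :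
  dirichlet_spectrum g Omega lam -> (forall i, weak_eigen (lam i) (v i)) ->
  (forall i j, bvol (v i) (v j) = (i == j)%:R) ->
  H10 w -> (forall i, (i < k)%N -> bvol w (v i) = 0) ->
  lam k * bvol w w <= evol w w.
Proof.
move=> [mono mult] ve vo Hw wv; rewrite leNgt; apply/negP => wk.
have [||||mu [z [muk Hz z1 zv ze]]] := @rayleigh_minimizer R h1 bvol evol bvol_psd evol_psd
  (@H10 R m.+1 Omega oO) (fun a v w => @H10_lin _ _ _ oO a v w) k (fun i => v i) (fun i => lam i)
  _ _ _ (lam k) w bvol_compact bvol_complete Hw _ wk.
- by move=> i; have [] := ve i.
- by move=> i j; exact: vo.
- by move=> i x Hx; have [_] := ve i; exact.
- by move=> i; exact: wv.
have [N Nlt multN] := mult mu.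
set S := [pred i : 'I_N | lam i == mu] in multN.
have Smu (j : 'I_#|S|) : lam (enum_val j) = mu.
  by have := enum_valP j; rewrite inE => /eqP.
have Sk (j : 'I_#|S|) : (enum_val j < k)%N.
  rewrite ltnNge; apply/negP => kj.
  by have := mono _ _ kj; rewrite Smu leNgt muk.
pose f (r : 'I_#|S|.+1) : h1 := if unlift ord0 r is Some j then v (enum_val j) else z.
apply: (dirichlet_multiplicity_bound (f := f) multN).
- move=> r; rewrite /f; case: unliftP => [j _|_]; last by split.
  by rewrite -(Smu j); exact: ve.
- move=> r s; rewrite /f; case: unliftP => [i ->|->]; case: unliftP => [j ->|->].
  + by rewrite vo (inj_eq lift_inj) (inj_eq val_inj) (inj_eq enum_val_inj).
  + by rewrite (psdC bvol_psd) (zv (Ordinal (Sk i))) eq_sym (negbTE (neq_lift _ _)).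
  + by rewrite (zv (Ordinal (Sk j))) (negbTE (neq_lift _ _)).
  + by rewrite eqxx z1.
Qed.

(** * Trial functions and Yang's inequality *)

Section multiplications.
Implicit Types (v w : h1) (f h : V2).

Definition dpw (s : R) (i : 'I_m.+1) : bweight R Omega :=
  bwZ ((i == ord_max)%:R * s) (pw (s - 1)).

Definition dcw (p i : 'I_m.+1) : bweight R Omega := bwZ (i == p)%:R (bw1 R Omega).

Lemma H10_pw s v : H10 v -> H10 (mulh (pw s) (dpw s) v).
Proof.
move=> Hv; apply: (H10_mulh (a := pw s) (da := dpw s) (@open_half_space R m) OH
  (smooth_on_xlast_powR m s) _ Hv) => i x /OH Hx.
by rewrite partial_xlast_powR//= mulrA.
Qed.

Lemma H10_cw p v : H10 v -> H10 (mulh (cw p) (dcw p) v).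
Proof.
move=> Hv; apply: (H10_mulh (a := cw p) (da := dcw p) (@open_half_space R m) OH
  (smooth_on_coord p (@open_half_space R m)) _ Hv) => i x Ox.
by rewrite [RHS]partial_coord /= mulr1.
Qed.

Local Notation J s := (wip (mu := leb) (mD := open_measurable_rV oO) (pw s)).

Lemma J_psd s : psd_form (J s).
Proof. by apply: wip_psd => x Ox; exact/ltW/pw_gt0. Qed.

Lemma J_pw s r f h : J s (l2mul (pw r) f) h = J (s + r) f h.
Proof. by apply: eq_wip => x Ox; rewrite pwD// -!mulrA. Qed.

Lemma J_bwZ s c (a : bweight R Omega) f h :
  J s (l2mul (bwZ c a) f) h = c * J s (l2mul a f) h.
Proof.
rewrite -(psdZl (J_psd s)); apply: eq_wip => x Ox.
by rewrite -[(c *: _ : V2) x]/(c * (a x * f x)) /= !mulrA.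
Qed.

Lemma J_bw1 s f h : J s (l2mul (bw1 R Omega) f) h = J s f h.
Proof. by apply: eq_wip => x Ox; rewrite /= mul1r. Qed.

Lemma J_cw s p f h : J s (l2mul (cw p) f) h = J s f (l2mul (cw p) h).
Proof.
apply: eq_wip => x Ox.
rewrite -[l2mul (cw p) f x]/(cw p x * f x) -[l2mul (cw p) h x]/(cw p x * h x).
by move: (pw s x) (cw p x) (f x) (h x) => a b c d; ring.
Qed.

Lemma ip_pw s f h : ip (l2mul (pw s) f) h = J s f h.
Proof.
apply: eq_wip => x Ox.
rewrite -[l2mul (pw s) f x]/(pw s x * f x) -[bw1 R Omega x]/1.
by move: (pw s x) (f x) (h x) => a b c; ring.
Qed.

(** Integration by parts between x_n^s v and w. *)
Lemma H10_ibp_pw s v w p : H10 v -> H10 w ->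
  J s v.1 (w.2 p) + J s (v.2 p) w.1 + (p == ord_max)%:R * s * J (s - 1) v.1 w.1 = 0.
Proof.
move=> Hv Hw; have := H10_ibp p (H10_pw s Hv) Hw; rewrite ffunE.
have E : ip (l2mul (dpw s p) v.1) w.1 = (p == ord_max)%:R * s * J (s - 1) v.1 w.1.
  by rewrite ip_pw0 /dpw J_bwZ J_pw add0r.
have E1 : ip (l2mul (pw s) v.1) (w.2 p) = J s v.1 (w.2 p) by exact: ip_pw.
have E2 : ip (l2mul (pw s) (v.2 p)) w.1 = J s (v.2 p) w.1 by exact: ip_pw.
rewrite [X in _ + X](psdDl (ip_psd _ _)) E E2.
rewrite -[(mulh (pw s) (dpw s) v).1]/(l2mul (pw s) v.1) E1.
by rewrite addrA.
Qed.

(** This is 2 <grad x_p, grad v> + v (laplacian x_p), the laplacian of x_p v when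
  the term x_p (laplacian v) is taken away. *)
Definition yang_p p v : V2 :=
  l2mul (bwZ 2 (pw t)) (v.2 p) + l2mul (bwZ ((p == ord_max)%:R * s1) (pw (t - 1))) v.1.

Lemma J_yang_p p v h : J s0 (yang_p p v) h =
  2 * J s1 (v.2 p) h + (p == ord_max)%:R * s1 * J (s1 - 1) v.1 h.
Proof.
have e1 : s0 + t = s1 by rewrite /s1 addrC.
have e2 : s0 + (t - 1) = s1 - 1 by rewrite addrA e1.
by rewrite /yang_p (psdDl (J_psd s0)) (J_bwZ s0 2) (J_bwZ s0) !J_pw e1 e2.
Qed.

(** Weak form of laplacian (x_p v) = - lam x_p v + yang_p p v. *)
Lemma evol_cw lam p v w : weak_eigen lam v -> H10 w ->
  evol (mulh (cw p) (dcw p) v) w =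
  lam * bvol (mulh (cw p) (dcw p) v) w - J s0 (yang_p p v) w.1.
Proof.
move=> [Hv ve] Hw; rewrite J_yang_p.
pose S := \sum_j J s1 (v.2 j) (l2mul (cw p) (w.2 j)).
have E1 : evol (mulh (cw p) (dcw p) v) w = S + J s1 v.1 (w.2 p).
  rewrite -[X in _ = _ + X](sum_delta p (fun j => J s1 v.1 (w.2 j))) -big_split/=.
  apply: eq_bigr => j _; rewrite ffunE (psdDl (J_psd s1)) J_cw J_bwZ.
  by rewrite J_bw1.
have E2 : evol v (mulh (cw p) (dcw p) w) = S + J s1 (v.2 p) w.1.
  rewrite -[X in _ = _ + X](sum_delta p (fun j => J s1 (v.2 j) w.1)) -big_split/=.
  apply: eq_bigr => j _; rewrite ffunE (psdDr (J_psd s1)).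
  by rewrite [X in _ + X](psdC (J_psd s1)) J_bwZ J_bw1 (psdC (J_psd s1) w.1).
have := ve _ (H10_cw p Hw); rewrite E2.
have -> : bvol v (mulh (cw p) (dcw p) w) = bvol (mulh (cw p) (dcw p) v) w.
  by rewrite -[LHS]/(J s0 v.1 (l2mul (cw p) w.1)) -J_cw.
have := H10_ibp_pw s1 p Hv Hw; rewrite E1.
by move: (bvol _ _) (J s1 _ _) (J s1 _ _) (_ * J _ _ _) => a b c d; clear; lra.
Qed.

(** Integrating v^2 x_p (laplacian x_p) by parts leaves the integral of
  |grad x_p|^2 v^2, where |grad x_p|^2 = x_n^t. *)
Lemma yang_p_cw p v : H10 v ->
  - J s0 (l2mul (cw p) v.1) (yang_p p v) = J s1 v.1 v.1.
Proof.
move=> Hv; rewrite (psdC (J_psd s0)) J_yang_p.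
have := H10_ibp_pw s1 p Hv (H10_cw p Hv); rewrite ffunE (psdDr (J_psd s1)).
rewrite [X in _ + X + _ + _](psdC (J_psd s1)) J_bwZ J_bw1 eqxx mul1r.
rewrite -J_cw (psdC (J_psd s1) (l2mul _ _)).
rewrite -[(mulh (cw p) (dcw p) v).1]/(l2mul (cw p) v.1).
by move: (J s1 (v.2 p) _) (J s1 v.1 v.1) (_ * J (s1 - 1) _ _) => a b c e; lra.
Qed.

(** The laplacian of x_p vanishes unless p is the last index. The equation tested
  against x_n^t v evaluates the sum of the squares of the derivatives of v, and
  v (partial_n v) is half the derivative of v^2. *)
Lemma sum_yang_p lam v : weak_eigen lam v ->
  \sum_p J s0 (yang_p p v) (yang_p p v) =
  4 * lam * J s1 v.1 v.1 +
  ((- (n ^+ 2 / 4) + n + 1) * t ^+ 2 - n * t) * J (2 * t - 2 + s0) v.1 v.1.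
Proof.
move=> [Hv ve].
(* The weight x_n^q goes with v (partial_n v), and its derivative with v^2. *)
pose q := 2 * t + s0 - 1.
have E (p : 'I_m.+1) : J s0 (yang_p p v) (yang_p p v) =
    4 * J (s1 + t) (v.2 p) (v.2 p) +
    (p == ord_max)%:R * (4 * s1 * J q (v.2 p) v.1 + s1 ^+ 2 * J (2 * t - 2 + s0) v.1 v.1).
  rewrite J_yang_p (psdC (J_psd s1) (v.2 p)) (psdC (J_psd (s1 - 1)) v.1).
  rewrite !(psdDl (J_psd _)) !J_bwZ !J_pw.
  have -> : s1 + (t - 1) = q by rewrite /q /s1; ring.
  have -> : s1 - 1 + t = q by rewrite /q /s1; ring.
  have -> : s1 - 1 + (t - 1) = 2 * t - 2 + s0 by rewrite /s1; ring.
  rewrite (psdC (J_psd q) v.1).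
  case: (p == ord_max) => /=; ring.
under eq_bigr do rewrite E.
rewrite big_split/= -mulr_sumr sum_delta.
have := ve _ (H10_pw t Hv).
have -> : bvol v (mulh (pw t) (dpw t) v) = J s1 v.1 v.1.
  rewrite -[LHS]/(J s0 v.1 (l2mul (pw t) v.1)) (psdC (J_psd s0)) J_pw.
  by rewrite addrC.
have -> : evol v (mulh (pw t) (dpw t) v) =
    \sum_p J (s1 + t) (v.2 p) (v.2 p) + t * J q (v.2 ord_max) v.1.
  rewrite -(sum_delta ord_max (fun p => t * J q (v.2 p) v.1)) -big_split/=.
  apply: eq_bigr => p _.
  rewrite ffunE (psdC (J_psd s1)) (psdDl (J_psd s1)) J_pw /dpw J_bwZ J_pw.
  have -> : s1 + (t - 1) = q by rewrite /q /s1; ring.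
  by rewrite (psdC (J_psd q) v.1) mulrA.
have := H10_ibp_pw q ord_max Hv Hv; rewrite eqxx mul1r (psdC (J_psd q) v.1).
have -> : q - 1 = 2 * t - 2 + s0 by rewrite /q; ring.
move: (\sum_p _) (J q _ _) (J s1 _ _) (J (2 * t - 2 + s0) _ _) => A B I1 I2 ibp en.
have -> : A = lam * I1 - t * B by rewrite -en addrK.
have -> : B = - (q / 2) * I2 by clear -ibp; lra.
by rewrite /q /s1 /s0; field.
Qed.

Lemma vol_integral_pw_sqr s f :
  vol_integral g Omega (fun x => xlast x `^ s * f x ^+ 2) = J (s + s0) f f.
Proof.
rewrite vol_integralE; apply: eq_Rintegral => x /set_mem Ox; rewrite pwD//.
rewrite -[xlast x `^ s]/(pw s x).
by move: (pw s x) (pw s0 x) (f x) => a b c; ring.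
Qed.

Section eigenfunctions.
Context (lam : nat -> R) (v : nat -> h1) (k : nat).
Hypotheses (spec : dirichlet_spectrum g Omega lam)
  (v_eigen : forall i, weak_eigen (lam i) (v i))
  (v_orth : forall i j, bvol (v i) (v j) = (i == j)%:R).

Let u (i : 'I_k) : h1 := v i.
Let u_orth i j : bvol (u i) (u j) = (i == j)%:R. Proof. exact: v_orth. Qed.

Lemma H10_coproj w : H10 w -> H10 (coproj bvol u w).
Proof.
move=> Hw.
have H0 : H10 (0 : h1) by rewrite -(addNr w) -scaleN1r; exact: (H10_lin _ Hw Hw).
have Hs : H10 (\sum_j bvol w (u j) *: u j).
  apply: (big_ind (@H10 R m.+1 Omega oO)) => [|x y Hx Hy|i _].
  - exact: H0.
  - by rewrite -[x]scale1r; exact: (H10_lin _ Hx Hy).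
  - by have [Hi _] := v_eigen i; rewrite -[_ *: _]addr0; exact: (H10_lin _ Hi H0).
by rewrite /coproj addrC -scaleN1r; exact: (H10_lin _ Hs Hw).
Qed.

(** The function x_p u_i, made orthogonal to the first k eigenfunctions, is the
  trial function in the variational principle for lam k. *)
Lemma yang_coordinate p :
  \sum_(i < k) (lam k - lam i) ^+ 2 * J s1 (v i).1 (v i).1 <=
  \sum_(i < k) (lam k - lam i) * J s0 (yang_p p (v i)) (yang_p p (v i)).
Proof.
pose G (i : 'I_k) : h1 := mulh (cw p) (dcw p) (u i).
pose Y (i : 'I_k) : h1 := (yang_p p (u i), 0).
have HG i : H10 (G i) by apply: H10_cw; have [] := v_eigen i.
have GC i j : bvol (G i) (u j) = bvol (G j) (u i).
  rewrite -[LHS]/(J s0 (l2mul (cw p) (u i).1) (u j).1) J_cw (psdC (J_psd s0)).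
  by [].
have eG (i : 'I_k) w : H10 w -> evol (G i) w = lam i * bvol (G i) w - bvol (Y i) w.
  exact: evol_cw.
have Y_u i j : bvol (Y i) (u j) = (lam i - lam j) * bvol (G i) (u j).
  have [Hj ej] := v_eigen j; have := eG i _ Hj.
  rewrite (psdC evol_psd) (ej _ (HG i)) (psdC bvol_psd (v j)).
  rewrite -[v j]/(u j).
  by move: (bvol (Y i) _) (bvol (G i) _) (lam i) (lam j) => y a l1 l2 e; lra.
have trial (i : 'I_k) : (lam k - lam i) * bvol (coproj bvol u (G i)) (coproj bvol u (G i)) <=
    - bvol (Y i) (coproj bvol u (G i)).
  have Hz := H10_coproj (HG i); have z_u := coproj_orth bvol_psd u_orth (G i).
  have zG := coprojE bvol_psd (G i) z_u.
  have ez : evol (coproj bvol u (G i)) (coproj bvol u (G i)) =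
      evol (G i) (coproj bvol u (G i)).
    rewrite {1}/coproj (psdBl evol_psd) (psd_suml evol_psd) big1 ?subr0// => j _.
    have [_ ej] := v_eigen j.
    by rewrite (psdZl evol_psd) (ej _ Hz) (psdC bvol_psd (v j)) (z_u j : bvol _ (v j) = 0) !mulr0.
  have := rayleigh_bound spec v_eigen v_orth Hz (fun j jk => z_u (Ordinal jk)).
  rewrite ez eG// zG (psdC bvol_psd _ (G i)).
  by move: (bvol (Y i) _) (bvol (G i) _) (lam i) (lam k) => y a l1 l2 e; lra.
have lam_le (i : 'I_k) : lam i <= lam k by have [mono _] := spec; exact/mono/ltnW.
have := psd_Yang bvol_psd u_orth lam_le GC Y_u trial.
have -> // : \sum_(i < k) (lam k - lam i) ^+ 2 * - bvol (G i) (Y i) =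
  \sum_(i < k) (lam k - lam i) ^+ 2 * J s1 (v i).1 (v i).1.
apply: eq_bigr => i _; congr (_ * _).
by rewrite -(@yang_p_cw p (v i))//; have [] := v_eigen i.
Qed.

Let I s i := vol_integral g Omega (fun x => xlast x `^ s * (v i).1 x ^+ 2).

Lemma yang_inequality :
  \sum_(i < k) (lam k - lam i) ^+ 2 * (n * I t i) <=
  \sum_(i < k) (lam k - lam i) * (4 * lam i * I t i +
    ((- (n ^+ 2 / 4) + n + 1) * t ^+ 2 - n * t) * I (2 * t - 2) i).
Proof.
have IE s i : I s i = J (s + s0) (v i).1 (v i).1 by exact: vol_integral_pw_sqr.
under eq_bigr do rewrite IE; under [leRHS]eq_bigr do rewrite !IE.
have -> : \sum_(i < k) (lam k - lam i) ^+ 2 * (n * J s1 (v i).1 (v i).1) =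
    \sum_(p < m.+1) \sum_(i < k) (lam k - lam i) ^+ 2 * J s1 (v i).1 (v i).1.
  rewrite sumr_const card_ord -[RHS]mulr_natl mulr_sumr; apply: eq_bigr => i _.
  exact: mulrCA.
apply: (le_trans (ler_sum _ (fun p _ => yang_coordinate p))).
rewrite exchange_big le_eqVlt; apply/orP; left; apply/eqP; apply: eq_bigr => i _.
by rewrite -mulr_sumr (sum_yang_p (v_eigen i)).
Qed.

End eigenfunctions.

End multiplications.

End half_space_domain.

Theorem proposition1p2 (R : realType) (m : nat) (t : R)
    (Omega : set 'rV[R]_m.+1) (lam : nat -> R)
    (u : nat -> 'rV[R]_m.+1 -> R) (k : nat) :
  bounded_domain Omega -> connected Omega ->
  dirichlet_spectrum (half_metric t) Omega lam ->
  0 < lam 0%N -> lam 0%N < lam 1%N ->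
  (forall i, dirichlet_solution (half_metric t) Omega (lam i) (u i)) ->
  (forall i j,
     vol_integral (half_metric t) Omega (fun x => u i x * u j x) = (i == j)%:R) ->
  (0 < k)%N ->
  let n : R := m.+1%:R in
  let I1 i := vol_integral (half_metric t) Omega
    (fun x => xlast x `^ t * u i x ^+ 2) in
  let I2 i := vol_integral (half_metric t) Omega
    (fun x => xlast x `^ (2 * t - 2) * u i x ^+ 2) in
  \sum_(i < k) (lam k - lam i) ^+ 2 * (n * I1 i) <=
  \sum_(i < k) (lam k - lam i) *
    (4 * lam i * I1 i + ((- (n ^+ 2 / 4) + n + 1) * t ^+ 2 - n * t) * I2 i).
Proof.
move=> [oO OH cO] _ spec _ _ sol orth _; cbv zeta.
have H i : exists v : h1 oO, l2_fun v.1 = u i /\ weak_eigen t OH cO (lam i) v.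
  by have [v vu ve] := dirichlet_solution_weak_eigen oO OH cO (sol i); exists v.
have {H} [v vP] := choice H.
have uE : u = fun i => l2_fun (v i).1 by apply/funext => i; have [] := vP i.
have v_eigen i : weak_eigen t OH cO (lam i) (v i) by have [] := vP i.
have v_orth i j : bvol t OH cO (v i) (v j) = (i == j)%:R.
  by rewrite -orth uE (vol_integral_wip t OH cO).
rewrite uE; exact: (yang_inequality k spec v_eigen v_orth).
Qed.
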